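(* Let $T$ be a power-bounded operator on a complex Banach space $X$, satisfying the (dGSF) condition. Let $f\in\mathcal{B}(\mathbb{D})$. Then $\sigma(f(T))=f(\sigma(T))$. Moreover, the following statements hold for any $\lambda\in\mathbb{C}$: (a) If $x\in X$ and $Tx=\lambda x$, then $f(T)x=f(\lambda)x$. (b) If $x^*\in X^*$ and $T^*x^*=\lambda x^*$, then $f(T)^*x^*=f(\lambda)x^*$. (c) If $(x_n)_{n\ge1}$ is a sequence of unit vectors in $X$ and $\lim_{n\to\infty}\|Tx_n-\lambda x_n\|=0$, then $\lim_{n\to\infty}\|f(T)x_n-f(\lambda)x_n\|=0$.
   Context: $\mathbb{D}$ is the open unit disc in $\mathbb{C}$ and $\overline{\mathbb{D}}$ its closure. $L(X)$ is the Banach algebra of bounded linear operators on $X$; $T\in L(X)$ is power-bounded if $\sup_{n\ge0}\|T^n\|<\infty$ (so $\sigma(T)\subseteq\overline{\mathbb{D}}$). $\mathcal{B}(\mathbb{D})$ is the Banach algebra (pointwise operations) of all holomorphic functions $f$ on $\mathbb{D}$ such that $\|f\|_{\mathcal{B}_0}:=\int_0^1\sup_{|\theta|\le\pi}|f'(re^{i\theta})|\,dr<\infty$, with the norm $\|f\|_{\mathcal{B}}:=\|f\|_\infty+\|f\|_{\mathcal{B}_0}$, where $\|f\|_\infty:=\sup_{z\in\mathbb{D}}|f(z)|<\infty$. Each $f\in\mathcal{B}(\mathbb{D})$ extends continuously to $\overline{\mathbb{D}}$, and $f$ also denotes the extension. The polynomials are dense in $\mathcal{B}(\mathbb{D})$.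 $T$ satisfies the (dGSF) (discrete Gomilko–Shi–Feng) condition if, for all $x\in X$ and $x^*\in X^*$, $$\sup_{0<r<1}(1-r)\int_{-\pi}^\pi\big|\langle T(I-re^{i\theta}T)^{-2}x,x^*\rangle\big|\,d\theta<\infty .$$ For such $T$, the operator $f(T)\in L(X)$ is defined for $f\in\mathcal{B}(\mathbb{D})$ by $$\langle f(T)x,x^*\rangle = f(0)\langle x,x^*\rangle+\frac{2}{\pi}\int_0^1 r\log\frac1r\int_{-\pi}^\pi f'(re^{i\theta})\,\langle T(I-re^{-i\theta}T)^{-2}x,x^*\rangle\,d\theta\,dr,\qquad x\in X,\ x^*\in X^*;$$ the map $f\mapsto f(T)$ is the unique bounded algebra homomorphism $\mathcal{B}(\mathbb{D})\to L(X)$ mapping the constant function $1$ to $I$ and the identity function $z$ to $T$. In (a) and (b), if $x\neq0$ (respectively $x^*\ne0$), and in (c), $\lambda$ automatically lies in $\sigma(T)\subseteq\overline{\mathbb{D}}$, so $f(\lambda)$ is defined; the case of a zero vector in (a), (b) is trivial. *)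

(* Defs.v *)
From HB Require Import structures.
From mathcomp Require Import all_boot all_order all_algebra.
From mathcomp Require Import complex.
From mathcomp Require Import all_classical all_reals all_analysis.

Set Implicit Arguments.
Unset Strict Implicit.
Unset Printing Implicit Defensive.

Import Order.TTheory GRing.Theory Num.Theory.
Import numFieldNormedType.Exports.

Local Open Scope classical_set_scope.
Local Open Scope complex_scope.
Local Open Scope ring_scope.

Record blinear (K : numFieldType) (V W : normedModType K) := BLinear {
  blinear_fun :> {linear V -> W};
  blinear_continuous : continuous blinear_fun }.

Section blinear_instances.
Context (K : numFieldType) (V W : normedModType K).

HB.instance Definition _ := gen_eqMixin (blinear V W).
HB.instance Definition _ := gen_choiceMixin (blinear V W).

Lemma null_fun_continuous : continuous (\0 : V -> W).
Proof. exact: cst_continuous. Qed.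

HB.instance Definition _ := isPointed.Build (blinear V W)
  (@BLinear K V W (\0 : V -> W) null_fun_continuous).

End blinear_instances.

Section blinear_comp.
Context (K : numFieldType) (U V W : normedModType K).

Lemma blinear_comp_continuous (S : blinear V W) (T : blinear U V) :
  continuous (S \o T).
Proof.
by move=> x; apply: continuous_comp; apply: blinear_continuous.
Qed.

Definition blinear_comp (S : blinear V W) (T : blinear U V) : blinear U W :=
  @BLinear K U W (S \o T) (@blinear_comp_continuous S T).

End blinear_comp.

Section operators.
Context (R : realType) (X : normedModType R[i]).

(* The norm of a complex normed space takes its values in R[i]. *)
Definition rnorm (V : normedModType R[i]) (v : V) : R := complex.Re `|v|.

Definition dual := blinear X R[i]^o.

Definition adjoint (T : blinear X X) (xs : dual) : dual := blinear_comp xs T.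

Definition opnorm (S : X -> X) : \bar R :=
  ereal_sup [set (rnorm (S x))%:E | x in [set x : X | rnorm x <= 1]].

Definition power_bounded (T : blinear X X) : Prop :=
  (ereal_sup (range (fun n : nat => opnorm (iter n T))) < +oo)%E.

Definition is_op_inverse (S : X -> X) (B : blinear X X) : Prop :=
  cancel S B /\ cancel B S.

Definition spectrum (T : blinear X X) : set R[i] :=
  [set l | ~ exists B, is_op_inverse (fun x => l *: x - T x) B].

(* Equal to 0 when S has no bounded inverse. *)
Definition op_inv (S : X -> X) : blinear X X := get (is_op_inverse S).

Definition T_resolvent_sq (T : blinear X X) (z : R[i]) (x : X) : X :=
  let B := op_inv (fun y => y - z *: T y) in T (B (B x)).

Definition polar (r t : R) : R[i] := (r * cos t) +i* (r * sin t).

Definition dGSF (T : blinear X X) : Prop :=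
  forall (x : X) (xs : dual),
    (ereal_sup [set (1 - r)%:E *
        \int[lebesgue_measure]_(t in `[(- pi)%R, pi%R])
          (rnorm (xs (T_resolvent_sq T (polar r t) x)))%:E
      | r in `]0%R, 1%R[] < +oo)%E.

End operators.

Section functions_on_the_disc.
Context (R : realType).
Implicit Type f : R[i]^o -> R[i]^o.

Definition unit_disc : set R[i]^o := [set z | `|z| < 1].

Definition holomorphic_on_disc f : Prop :=
  forall z, unit_disc z -> derivable f z (1 : R[i]).

Definition B0_seminorm f : \bar R :=
  \int[lebesgue_measure]_(r in `]0%R, 1%R[)
    ereal_sup [set (rnorm (derive1 f (polar r t)))%:E | t in `[(- pi)%R, pi%R]].

(* Elements of B(D) are represented by total functions, whose values outside
   of the open disc are irrelevant here and in what follows. *)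
Definition besov f : Prop :=
  holomorphic_on_disc f /\ (B0_seminorm f < +oo)%E.

(* The extension to the closed disc, by limits from inside the disc. *)
Definition disc_ext f (z : R[i]^o) : R[i]^o := lim (f @ within unit_disc (nbhs z)).

Definition cintegral (D : set R) (g : R -> R[i]) : R[i] :=
  (\int[lebesgue_measure]_(t in D) complex.Re (g t)) +i*
  (\int[lebesgue_measure]_(t in D) complex.Im (g t)).

End functions_on_the_disc.

Section functional_calculus.
Context (R : realType) (X : normedModType R[i]).

Definition is_calculus (T : blinear X X) (f : R[i]^o -> R[i]^o)
    (S : blinear X X) : Prop :=
  forall (x : X) (xs : dual X),
    xs (S x) = f 0 * xs x + (2 / pi)%:C *
      cintegral `]0, 1[ (fun r => (r * ln (r^-1))%:C *
        cintegral `[(- pi)%R, pi%R] (fun t =>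
          derive1 f (polar r t) * xs (T_resolvent_sq T (polar r (- t)) x))).

(* By Hahn-Banach at most one operator satisfies is_calculus T f; there is one
   when X is complete, T is power-bounded and satisfies dGSF, and besov f. *)
Definition calculus (T : blinear X X) (f : R[i]^o -> R[i]^o) : blinear X X :=
  get (is_calculus T f).

End functional_calculus.

(* Main.v *)
Require Import Defs.
From HB Require Import structures.
From mathcomp Require Import all_boot all_order all_algebra.
From mathcomp Require Import complex.
From mathcomp Require Import all_classical all_reals all_analysis.
From mathcomp Require Import measurable_realfun.
From mathcomp Require Import ring lra.

(** Write a_n for the Taylor coefficients of f, and t_n = xs (T^n x). On the
    circle of radius s, the resolvent term of the calculus is the power series
    with coefficients (n+1) t_(n+1). Parseval's formula and the integral
    - int_0^1 s^(2n+1) log s ds = 1 / (4 (n+1)^2) show formally that the double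
    integral defining f(T) is the sum of the a_n t_n for n > 0. The series need
    not converge. If the weight s log (1/s) is replaced by s log^+ (tau/s) with
    tau < 1, then a_n is multiplied by tau^(2n) and the series converges
    absolutely ([weighted_pairing]). The error of this replacement is at most
    a constant depending on x and xs, supplied by the dGSF condition, times a
    quantity that depends on f and tau only and tends to 0 as tau tends to 1
    ([pairing_defect], [log_defect_cvg]). So there are polynomials p_k and a
    rate e_k, independent of x and xs, such that xs (p_k(T) x) approaches the
    value prescribed for xs (f(T) x) with an error of order e_k ([besov_polynomials]).

    Two instances are used. For the resolvent of T, the uniform boundedness
    principle turns the weak estimates with a common rate into norm convergence
    of p_k(T); the limit satisfies the equation defining f(T), and by the
    Hahn-Banach theorem it is f(T) ([calculus_approximation]). For the scalar
    kernel z / (1 - z w)^2, where the Poisson kernel replaces the dGSF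
    condition, the same polynomials converge uniformly on the closed disc, to
    the continuous extension of f ([besov_approximation]). Thus a single
    polynomial is uniformly close to f on the closed disc and close to f(T) in
    norm ([polynomial_approximation]).

    Everything else follows by approximation. For a polynomial, p(T) - p(l) has
    the factor T - l, which gives (a), (b) and (c), the point l being in the
    closed disc because T is power-bounded. The same factorization and the
    stability of invertibility under small perturbations give
    f(sigma(T)) in sigma(f(T)) ([invertible_calculus_resolvent]). For the
    converse, let m be at distance g > 0 from the compact set f(sigma(T)). For
    a close polynomial p, all m - w - p(T) with w small compared to g are
    invertible, because m - w - p splits into linear factors whose roots avoid
    sigma(T). Taylor's theorem for the resolvent and uniform boundedness bound
    the powers of (m - p(T))^-1 geometrically ([resolvent_power_growth]), and
    since f(T) - p(T) is small and commutes with this inverse, a Neumann series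
    inverts m - f(T) ([calculus_resolvent_invertible]).

    The analysis used on the way is developed from real integrals: Taylor's
    theorem for functions that are complex differentiable at each point of the
    disc ([taylor]) by Goursat's bisection in polar coordinates, and uniform
    boundedness by a gliding hump. *)

Import Order.TTheory GRing.Theory Num.Theory.
Import numFieldNormedType.Exports.

Local Open Scope classical_set_scope.
Local Open Scope complex_scope.
Local Open Scope ring_scope.

Set Implicit Arguments.
Unset Strict Implicit.
Unset Printing Implicit Defensive.

Import ComplexField.Normc.
Local Arguments normc : simpl never.

(** * Norms and null sequences *)

Section norms.
Context (R : realType).
Local Notation C := R[i].
Implicit Types V W : normedModType C.

Lemma normc_ge0 (z : C) : 0 <= normc z.
Proof. by case: z => a b; rewrite /normc sqrtr_ge0. Qed.

Lemma normrC (z : C) : `|z| = (normc z)%:C.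
Proof. by rewrite normc_def; case: z. Qed.

Lemma rnorm_scalar (z : C) : rnorm (z : C^o) = normc z.
Proof. by rewrite /rnorm [`|_|]normrC. Qed.

Lemma normr_rnorm V (v : V) : `|v| = (rnorm v)%:C.
Proof.
rewrite /rnorm; have := normr_ge0 v; case: `|v| => a b.
by rewrite lecE /= => /andP[/eqP -> _].
Qed.

Lemma rnorm_ge0 V (v : V) : 0 <= rnorm v.
Proof. by have := normr_ge0 v; rewrite normr_rnorm lecE /= => /andP[]. Qed.

Lemma rnorm0 V : rnorm (0 : V) = 0.
Proof. by rewrite /rnorm normr0. Qed.

Lemma rnorm0_eq0 V (v : V) : rnorm v = 0 -> v = 0.
Proof. by move=> v0; apply/eqP; rewrite -normr_eq0 normr_rnorm v0. Qed.

Lemma rnormN V (v : V) : rnorm (- v) = rnorm v.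
Proof. by rewrite /rnorm normrN. Qed.

Lemma rnormD V (v w : V) : rnorm (v + w) <= rnorm v + rnorm w.
Proof.
by have := ler_normD v w; rewrite !normr_rnorm -rmorphD /= lecR.
Qed.

Lemma rnormB V (v w : V) : rnorm (v - w) <= rnorm v + rnorm w.
Proof. by rewrite -[rnorm w]rnormN rnormD. Qed.

Lemma rdistC V (v w : V) : rnorm (v - w) = rnorm (w - v).
Proof. by rewrite -rnormN opprB. Qed.

Lemma rdistD V (u v w : V) : rnorm (v - w) <= rnorm (v - u) + rnorm (u - w).
Proof. by rewrite -[v - w](subrKA u) rnormD. Qed.

Lemma rnormZ V (l : C) (v : V) : rnorm (l *: v) = normc l * rnorm v.
Proof.
by rewrite /rnorm normrZ normrC normr_rnorm -rmorphM.
Qed.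

Lemma normcD (z w : C) : normc (z + w) <= normc z + normc w.
Proof. exact: le_normcD. Qed.

Lemma normcB (z w : C) : normc (z - w) <= normc z + normc w.
Proof. by rewrite -[normc w]normcN normcD. Qed.

Lemma normc_distC (z w : C) : normc (z - w) = normc (w - z).
Proof. by rewrite -normcN opprB. Qed.

Lemma normc_distD (u v w : C) : normc (v - w) <= normc (v - u) + normc (u - w).
Proof. by rewrite -[v - w](subrKA u) normcD. Qed.

Lemma normc_sum (I : Type) (r : seq I) (P : pred I) (F : I -> C) :
  normc (\sum_(i <- r | P i) F i) <= \sum_(i <- r | P i) normc (F i).
Proof.
elim/big_rec2: _ => [|i a b _ ab]; first by rewrite normc0.
by rewrite (le_trans (normcD _ _))// lerD2l.
Qed.

Lemma normcX (z : C) n : normc (z ^+ n) = normc z ^+ n.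
Proof. by elim: n => [|n IH]; rewrite ?normc1 // !exprS normcM IH. Qed.

Lemma normcR (x : R) : normc x%:C = `|x|.
Proof. by rewrite /normc /= expr0n /= addr0 sqrtr_sqr. Qed.

Lemma normc_eq0 (z : C) : (normc z == 0) = (z == 0).
Proof.
by apply/eqP/eqP => [/eq0_normc//|->]; rewrite normc0.
Qed.

Lemma normc_gt0 (z : C) : (0 < normc z) = (z != 0).
Proof. by rewrite lt_def normc_ge0 andbT normc_eq0. Qed.

Lemma Re_le_normc (z : C) : `|complex.Re z| <= normc z.
Proof.
case: z => a b; rewrite /normc /= -sqrtr_sqr ler_sqrt.
  by rewrite lerDl sqr_ge0.
by rewrite addr_ge0 ?sqr_ge0.
Qed.

Lemma Im_le_normc (z : C) : `|complex.Im z| <= normc z.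
Proof.
case: z => a b; rewrite /normc /= -sqrtr_sqr ler_sqrt.
  by rewrite lerDr sqr_ge0.
by rewrite addr_ge0 ?sqr_ge0.
Qed.

Lemma normc_le_ReIm (z : C) : normc z <= `|complex.Re z| + `|complex.Im z|.
Proof.
rewrite [z in normc z]complexE.
rewrite (le_trans (normcD _ _))// normcR normcM normcR lerD2l.
by rewrite [normc 'i]/normc /= expr0n/= expr1n add0r sqrtr1 mul1r.
Qed.

Lemma ltC0P (e : C) : 0 < e -> exists2 r : R, 0 < r & e = r%:C.
Proof.
by case: e => a b; rewrite ltcE /= => /andP[/eqP -> a0]; exists a.
Qed.

(** The norm takes its values in R[i], whereas limits are handled below as
    real null families. *)
Lemma cvg_rnormP V T (F : set_system T) {FF : Filter F} (f : T -> V) (l : V) :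
  f x @[x --> F] --> l <-> rnorm (f x - l) @[x --> F] --> (0 : R).
Proof.
split.
  move=> /cvgrPdist_lt fl; apply/cvgrPdist_lt => e e0.
  have e0' : 0 < e%:C :> C by rewrite ltcR.
  near=> t.
  have : `|l - f t| < e%:C by near: t; exact: fl.
  by rewrite sub0r normrN ger0_norm ?rnorm_ge0// normr_rnorm ltcR rdistC.
move=> /cvgrPdist_lt fl; apply/cvgrPdist_lt => _ /ltC0P[e e0 ->].
near=> t.
have : `|0 - rnorm (f t - l)| < e by near: t; exact: fl.
by rewrite sub0r normrN ger0_norm ?rnorm_ge0// normr_rnorm ltcR rdistC.
Unshelve. all: by end_near. Qed.

Lemma cvg_normcP T (F : set_system T) {FF : Filter F} (f : T -> C) (l : C) :
  (f x : C^o) @[x --> F] --> (l : C^o) <->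
  normc (f x - l) @[x --> F] --> (0 : R).
Proof.
rewrite cvg_rnormP; under eq_fun do rewrite rnorm_scalar; by [].
Qed.

Lemma null_le T (F : set_system T) {FF : Filter F} (f g : T -> R) :
  (forall x, 0 <= f x) -> (\near F, f F <= g F) -> g x @[x --> F] --> (0 : R) ->
  f x @[x --> F] --> (0 : R).
Proof.
move=> f0 fg g0; apply: (@squeeze_cvgr _ _ _ _ (fun=> 0) g f) => //.
  by near=> x; rewrite f0 /=; near: x.
exact: cvg_cst.
Unshelve. all: by end_near. Qed.

Lemma null_leS (f g : nat -> R) :
  (forall n, 0 <= f n) -> (forall n, f n <= g n) -> g x @[x --> \oo] --> (0 : R) ->
  f x @[x --> \oo] --> (0 : R).
Proof. by move=> f0 fg; apply: null_le => //; near=> x.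
Unshelve. all: by end_near. Qed.

Lemma nullP (f : nat -> R) : (forall n, 0 <= f n) ->
  f n @[n --> \oo] --> (0 : R) <->
  (forall e, 0 < e -> exists N, forall n, (N <= n)%N -> f n < e).
Proof.
move=> f0; split=> [/cvgrPdist_lt fl e e0|fl].
  have [N _ HN] := fl _ e0; exists N => n Nn.
  by have := HN n Nn; rewrite /= sub0r normrN ger0_norm.
apply/cvgrPdist_lt => e /fl[N HN]; exists N => // n Nn /=.
by rewrite sub0r normrN ger0_norm // HN.
Qed.

Lemma nullM T (F : set_system T) {FF : Filter F} (c : R) (f : T -> R) :
  f x @[x --> F] --> (0 : R) -> (c * f x) @[x --> F] --> (0 : R).
Proof. by move=> f0; rewrite -[X in _ --> X](mulr0 c); apply: cvgMr. Qed.

Lemma nullD T (F : set_system T) {FF : Filter F} (f g : T -> R) :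
  f x @[x --> F] --> (0 : R) -> g x @[x --> F] --> (0 : R) ->
  (f x + g x) @[x --> F] --> (0 : R).
Proof. by move=> f0 g0; rewrite -[X in _ --> X](addr0 0); apply: cvgD. Qed.

Lemma null_ge0_eq (x : R) (f : nat -> R) : 0 <= x -> (forall n, x <= f n) ->
  f n @[n --> \oo] --> (0 : R) -> x = 0.
Proof.
move=> x0 xf f0; apply/le_anti/andP; split=> //.
apply/ler_addgt0Pr => e e0; rewrite add0r.
have f_ge0 n : 0 <= f n by exact: le_trans (xf n).
have [N HN] := (nullP f_ge0).1 f0 _ e0.
by rewrite (le_trans (xf N))// ltW// HN.
Qed.

Lemma null_eq (f g : nat -> R) : (forall n, f n = g n) ->
  f n @[n --> \oo] --> (0 : R) -> g n @[n --> \oo] --> (0 : R).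
Proof. by move=> /funext ->. Qed.

(** Completeness is inherited from the real and imaginary parts, which are
    1-Lipschitz. *)
Lemma complex_cauchy_cvg (F : set_system C^o) : ProperFilter F ->
  cauchy F -> cvg F.
Proof.
move=> FF cF; have /cauchyP Fex := cF.
have cvg_coord (h : C -> R) : (forall z w, `|h z - h w| <= normc (z - w)) ->
    exists a : R, h z @[z --> F] --> a.
  move=> hlip; have : cvg (h @ F).
    apply/cauchy_cvgP/cauchyP => e e0.
    have [|z Fz] := Fex e%:C; first by rewrite ltcR.
    exists (h z).
    apply: (@filterS _ F _ (ball z e%:C) (h @^-1` ball (h z) e)) => // w zw.
    suff : `|h z - h w| < e by rewrite /= -ball_normE.
    rewrite (le_lt_trans (hlip _ _))// -rnorm_scalar.
    by move: zw; rewrite -ball_normE /= normr_rnorm ltcR.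
  by move=> hc; exists (lim (h @ F)).
have [|a Fa] := cvg_coord (@complex.Re R).
  by move=> z w; rewrite -raddfB Re_le_normc.
have [|b Fb] := cvg_coord (@complex.Im R).
  by move=> z w; rewrite -raddfB Im_le_normc.
apply/cvg_ex; exists (a +i* b : C^o).
suff : (fun z : C^o => z) z @[z --> F] --> (a +i* b : C^o) by [].
apply/cvg_normcP.
apply: (@null_le _ _ _ _ (fun z => `|complex.Re z - a| + `|complex.Im z - b|)).
- by move=> z; exact: normc_ge0.
- near=> z; rewrite (le_trans (normc_le_ReIm _))//.
  by rewrite !raddfB.
- rewrite -(addr0 0); apply: cvgD.
    by rewrite -(normr0 R); apply: cvg_norm; apply/subr_cvg0.
  by rewrite -(normr0 R); apply: cvg_norm; apply/subr_cvg0.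
Unshelve. all: by end_near. Qed.

(** The rate e is kept in the conclusion: it is the uniformity of such rates
    that makes limits of operators linear, bounded and close to their
    approximants. *)
Lemma Cauchy_rnorm_gen V (u : nat -> V) (e : nat -> R) :
  (forall F : set_system V, ProperFilter F -> cauchy F -> cvg F) ->
  e n @[n --> \oo] --> (0 : R) ->
  (forall m n, (n <= m)%N -> rnorm (u m - u n) <= e n) ->
  exists l, (forall n, rnorm (l - u n) <= e n) /\ u n @[n --> \oo] --> l.
Proof.
move=> Vcomplete e0 ue.
have e_ge0 n : 0 <= e n by have := ue n n (leqnn _); rewrite subrr rnorm0.
have cu : cvg (u @ \oo).
  apply: Vcomplete; apply/cauchyP => _ /ltC0P[r r0 ->].
  have [N HN] := (nullP e_ge0).1 e0 _ r0.
  exists (u N), N => // n Nn /=.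
  rewrite -ball_normE /= normr_rnorm ltcR rdistC.
  by rewrite (le_lt_trans (ue _ _ Nn))// HN.
exists (lim (u @ \oo)); split => // n.
have /cvg_rnormP ul : u n @[n --> \oo] --> lim (u @ \oo) by [].
apply/ler_addgt0Pr => d d0.
have [N HN] := (nullP (fun n => rnorm_ge0 _)).1 ul _ d0.
rewrite (le_trans (rdistD (u (maxn N n)) _ _))// addrC lerD//.
  by rewrite ue// leq_maxr.
by rewrite ltW// rdistC HN// leq_maxl.
Qed.

Lemma Cauchy_rnorm (V : completeNormedModType C) (u : nat -> V) (e : nat -> R) :
  e n @[n --> \oo] --> (0 : R) ->
  (forall m n, (n <= m)%N -> rnorm (u m - u n) <= e n) ->
  exists l, (forall n, rnorm (l - u n) <= e n) /\ u n @[n --> \oo] --> l.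
Proof. by apply: Cauchy_rnorm_gen => F FF; exact: cauchy_cvg. Qed.

Lemma Cauchy_normc (u : nat -> C) (e : nat -> R) :
  e n @[n --> \oo] --> (0 : R) ->
  (forall m n, (n <= m)%N -> normc (u m - u n) <= e n) ->
  exists l, forall n, normc (l - u n) <= e n.
Proof.
move=> e0 ue; have [||l [lu _]] := @Cauchy_rnorm_gen C^o u e _ e0.
- exact: complex_cauchy_cvg.
- by move=> m n nm; rewrite rnorm_scalar ue.
- by exists l => n; rewrite -rnorm_scalar lu.
Qed.

Lemma blinear_bounded V W (T : blinear V W) :
  exists2 c, 0 < c & forall x, rnorm (T x) <= c * rnorm x.
Proof.
have /cvg_rnormP : T x @[x --> (0 : V)] --> T 0 by exact: blinear_continuous.
rewrite linear0 => /cvgrPdist_lt/(_ 1 ltr01)/nbhs_ballP[_ /= /ltC0P[d d0 ->] Hd].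
have {}Hd x : rnorm x < d -> rnorm (T x) < 1.
  move=> xd; have := Hd x; rewrite -ball_normE /= sub0r normrN normr_rnorm ltcR.
  by move=> /(_ xd); rewrite subr0 sub0r normrN ger0_norm ?rnorm_ge0.
exists (2 / d); first by rewrite divr_gt0.
move=> x; have [/rnorm0_eq0 ->|/eqP x0] := pselect (rnorm x = 0).
  by rewrite linear0 !rnorm0 mulr0.
have xgt0 : 0 < rnorm x by rewrite lt_def x0 rnorm_ge0.
have k0 : 0 < d / (2 * rnorm x) by rewrite divr_gt0 ?mulr_gt0.
have := Hd ((d / (2 * rnorm x))%:C *: x).
rewrite linearZ /= !rnormZ normcR gtr0_norm//.
have -> : d / (2 * rnorm x) * rnorm x = d / 2 by field.
rewrite ltr_pdivrMr// ltr_pMr// ltr1n => /(_ isT).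
rewrite -ltr_pdivlMl// mulr1 invf_div => /ltW; congr (_ <= _); by field; rewrite gt_eqF.
Qed.

(** The converse of [blinear_bounded]; together they allow proofs to work with
    plain functions satisfying an inequality. *)
Lemma bounded_blinear V W (f : V -> W) (c : R) : linear f ->
  (forall x, rnorm (f x) <= c * rnorm x) -> exists B : blinear V W, B =1 f.
Proof.
move=> lf cf.
pose L : {linear V -> W} := HB.pack f (GRing.isLinear.Build _ _ _ _ f lf).
have cL : continuous L.
  move=> x; apply/cvg_rnormP.
  apply: (@null_le _ _ _ _ (fun y => `|c| * rnorm (y - x))).
  - by move=> y; exact: rnorm_ge0.
  - near=> y; have -> : L y - L x = f (y - x) by rewrite -[RHS]/(L _) linearB.
    rewrite (le_trans (cf _))// ler_wpM2r ?rnorm_ge0//.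
    exact: ler_norm.
  - rewrite -(mulr0 `|c|); apply: cvgMr.
    by apply/cvg_rnormP; exact: cvg_id.
by exists (BLinear cL).
Unshelve. all: by end_near. Qed.

Lemma continuous_rnorm V : continuous (@rnorm R V).
Proof.
move=> z; apply/cvgrPdist_lt => e e0.
have /cvgrPdist_lt/(_ _ e0) zz : rnorm (w - z) @[w --> z] --> (0 : R).
  by apply/cvg_rnormP; exact: cvg_id.
near=> w.
have : `|0 - rnorm (w - z)| < e by near: w; exact: zz.
rewrite sub0r normrN ger0_norm ?rnorm_ge0//; apply: le_lt_trans.
rewrite ler_norml; apply/andP; split.
  by rewrite lerNl opprB lerBlDr (le_trans _ (rnormD _ _))// subrK.
by rewrite lerBlDr rdistC (le_trans _ (rnormD _ _))// subrK.
Unshelve. all: by end_near. Qed.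

Lemma compact_closed_disc : compact [set z : C^o | normc z <= 1].
Proof.
pose h (p : R * R) : C^o := p.1 +i* p.2.
have hcont : continuous h.
  move=> p; apply/cvg_normcP.
  apply: (@null_le _ _ _ _ (fun q => `|q.1 - p.1| + `|q.2 - p.2|)).
  - by move=> q; exact: normc_ge0.
  - by near=> q; exact: normc_le_ReIm.
  - rewrite -(addr0 0); apply: cvgD.
      rewrite -(normr0 R); apply: cvg_norm; apply/subr_cvg0; exact: cvg_fst.
    rewrite -(normr0 R); apply: cvg_norm; apply/subr_cvg0; exact: cvg_snd.
have hc : compact (h @` (`[(-1)%R, 1%R] `*` `[(-1)%R, 1%R])).
  apply: continuous_compact; first exact: continuous_subspaceT.
  by apply: compact_setX; exact: segment_compact.
have clD : closed [set z : C^o | normc z <= 1].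
  have -> : [set z : C^o | normc z <= 1] = @rnorm R C^o @^-1` [set x : R | x <= 1].
    by apply/seteqP; split=> z /=; rewrite rnorm_scalar.
  apply: closed_comp; last exact: closed_le.
  by move=> z _; exact: continuous_rnorm.
apply: (subclosed_compact clD hc) => z /= z1.
exists (complex.Re z, complex.Im z); last by case: z {z1}.
rewrite /= !in_itv /= -!ler_norml.
by rewrite !(le_trans _ z1) ?Re_le_normc ?Im_le_normc.
Unshelve. all: by end_near. Qed.

End norms.

(** * The gliding hump *)

Section uniform_boundedness.
Context (R : realType).
Local Notation C := R[i].

Lemma expr3V_gt0 n : 0 < (3^-1 : R) ^+ n.
Proof. by rewrite exprn_gt0// invr_gt0. Qed.

(** The uniform boundedness principle is needed once on a Banach space and
    once on a space of functionals. It is stated for a vector space with a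
    relation B e r, to be read as: the norm of e is at most r, so that no norm
    has to be constructed on the functionals. Instead of Baire's theorem,
    Sokal's choice between x + psi and x - psi is used: for a seminorm p, one
    of p (x + psi), p (x - psi) is at least p psi. *)
Lemma gliding_hump (E : lmodType C) (B : E -> R -> Prop) (I : Type)
    (p : I -> E -> R) :
  (forall e r a, B e r -> B (a *: e) (normc a * r)) ->
  (forall e_ : nat -> E, (forall n, B (e_ n) (3^-1 ^+ n)) ->
    exists e, (exists r, B e r) /\
      forall n, B (e - \sum_(k < n) e_ k) (3 / 2 * 3^-1 ^+ n)) ->
  (forall i e f, p i (e + f) <= p i e + p i f) ->
  (forall i a e, p i (a *: e) = normc a * p i e) ->
  (forall i, exists c, forall e, B e 1 -> p i e <= c) ->
  (forall e r, B e r -> exists M, forall i, p i e <= M) ->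
  exists K, forall i e, B e 1 -> p i e <= K.
Proof.
move=> BZ Bcomplete pD pZ pbd ppt; apply: contrapT => unbounded.
have pN i e : p i (- e) = p i e by rewrite -scaleN1r pZ normcN normc1 mul1r.
have p_ge0 i e : 0 <= p i e.
  have := pD i e (- e); rewrite subrr pN -(scale0r e) pZ normc0 mul0r.
  by rewrite -mulr2n pmulrn_lge0.
have hump K : 0 < K -> exists ie : I * E, [/\ B ie.2 1, K < p ie.1 ie.2 &
    forall e', B e' 1 -> p ie.1 e' <= 4 / 3 * p ie.1 ie.2].
  move=> K0.
  have [i [e0 [Be0 Ke0]]] : exists i e, B e 1 /\ 2 * K < p i e.
    apply: contrapT => h; apply: unbounded; exists (2 * K) => i e Be.
    by rewrite leNgt; apply/negP => Kp; apply: h; exists i, e.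
  pose A := [set p i e | e in [set e | B e 1]].
  (* a nearly maximal value of p i on the unit ball, up to the factor 4/3 *)
  have supA : has_sup A.
    split; first by exists (p i e0), e0.
    by have [c pc] := pbd i; exists c => _ [e Be <-]; exact: pc.
  have c_gt : 2 * K < sup A.
    by rewrite (lt_le_trans Ke0)// ub_le_sup//; [case: supA|exists e0].
  have eps0 : 0 < sup A / 4 by rewrite divr_gt0//; lra.
  have [_ [e Be <-] pe] := sup_adherent eps0 supA.
  exists (i, e); split => //=; first by lra.
  move=> e' Be'; have : p i e' <= sup A.
    by apply: ub_le_sup; [case: supA|exists e'].
  lra.
have K_gt0 n : 0 < 3 * 3 ^+ n * n.+1%:R :> R by rewrite !mulr_gt0// exprn_gt0.
(* the n-th hump is so high that it still exceeds 3 (n+1) when scaled by 3^-n *)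
have [ie Hie] := choice (fun n => hump _ (K_gt0 n)).
pose psi n := (3^-1 ^+ n)%:C *: (ie n).2.
pose step n x := if p (ie n).1 (x - psi n) <= p (ie n).1 (x + psi n)
  then x + psi n else x - psi n.
pose x := fix F n := if n is m.+1 then step m (F m) else 0.
have psi_p n : p (ie n).1 (psi n) = 3^-1 ^+ n * p (ie n).1 (ie n).2.
  by rewrite pZ normcR gtr0_norm// expr3V_gt0.
have xS n : 3^-1 ^+ n * p (ie n).1 (ie n).2 <= p (ie n).1 (x n.+1).
  rewrite -psi_p /=.
  have : p (ie n).1 (psi n) *+ 2 <= p (ie n).1 (x n + psi n) + p (ie n).1 (x n - psi n).
    rewrite mulr2n -{1}[psi n](addrK (x n)) -addrA.
    have -> : psi n + (x n - x n) = psi n by rewrite subrr addr0.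
    have -> : p (ie n).1 (x n - psi n) = p (ie n).1 (psi n - x n).
      by rewrite -pN opprB.
    have := pD (ie n).1 (x n + psi n) (psi n - x n).
    have -> : x n + psi n + (psi n - x n) = 2 *: psi n.
      by rewrite addrC addrA subrK scaler_nat mulr2n.
    have -> : (2 : C) = (2 : R)%:C by rewrite rmorph_nat.
    rewrite pZ normcR ger0_norm//; lra.
  rewrite /step; case: ifPn => [|/negP]; first by lra.
  by move=> /negP; rewrite -ltNge; lra.
have dB n : B (x n.+1 - x n) (3^-1 ^+ n).
  have Bpsi : B (psi n) (3^-1 ^+ n).
    have [Be _ _] := Hie n.
    have := BZ _ _ (3^-1 ^+ n)%:C Be.
    by rewrite normcR gtr0_norm ?expr3V_gt0// mulr1.
  rewrite /= /step; case: ifPn => _.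
    by rewrite addrAC subrr add0r.
  rewrite addrAC subrr add0r -scaleN1r.
  by have := BZ _ _ (-1) Bpsi; rewrite normcN normc1 mul1r.
have [y [[r Br] ytail]] := Bcomplete _ dB.
have sumx n : \sum_(k < n) (x k.+1 - x k) = x n.
  elim: n => [|n IH]; first by rewrite big_ord0.
  by rewrite big_ord_recr IH /= addrC subrK.
have [M pM] := ppt _ _ Br.
have lower n : n.+1%:R < p (ie n).1 y.
  have [Be Ke pe] := Hie n.
  have t0 : 0 < (2 * 3 ^+ n : R) by rewrite mulr_gt0// exprn_gt0.
  have : p (ie n).1 (x n.+1 - y) <= 2 / 3 * 3^-1 ^+ n * p (ie n).1 (ie n).2.
    rewrite -pN opprB -sumx.
    have := BZ _ _ (2 * 3 ^+ n)%:C (ytail n.+1).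
    rewrite normcR gtr0_norm//.
    have -> : 2 * 3 ^+ n * (3 / 2 * 3^-1 ^+ n.+1) = 1 :> R.
      by rewrite exprS exprVn; field; rewrite expf_neq0.
    move=> /pe; rewrite pZ normcR gtr0_norm// -ler_pdivlMl//.
    move=> /le_trans; apply; rewrite le_eqVlt; apply/orP; left; apply/eqP.
    by rewrite exprVn; field; rewrite expf_neq0.
  have := pD (ie n).1 y (x n.+1 - y); rewrite addrC subrK.
  have := xS n.
  have : n.+1%:R < 1 / 3 * 3^-1 ^+ n * p (ie n).1 (ie n).2.
    have -> : 1 / 3 * 3^-1 ^+ n * p (ie n).1 (ie n).2 =
        p (ie n).1 (ie n).2 / (3 * 3 ^+ n).
      by rewrite exprVn; field; rewrite expf_neq0.
    by rewrite ltr_pdivlMr ?mulr_gt0 ?exprn_gt0// mulrC.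
  by lra.
have := lower (Num.truncn M); apply/negP; rewrite -leNgt (le_trans (pM _))//.
by rewrite ltW// truncnS_gt.
Qed.

End uniform_boundedness.

(** * The Hahn-Banach theorem *)

Section hahn_banach.
Context (R : realType) (V : normedModType R[i]).
Local Notation C := R[i].
Implicit Types (G : set (V * R)) (u v : V).

(** A real-linear functional on a subspace is represented by its graph, so
    that Zorn's lemma applies to an inclusion of sets. *)
Definition dominated_graph G :=
  (forall a p q, G p -> G q -> G (a%:C *: p.1 + q.1, a * p.2 + q.2)) /\
  (forall p, G p -> p.2 <= rnorm p.1).

Lemma dominated_graph_fun G u r s : dominated_graph G ->
  G (u, r) -> G (u, s) -> r = s.
Proof.
move=> [Glin Gdom].
have le_rs r' s' : G (u, r') -> G (u, s') -> s' <= r'.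
  move=> Gr Gs; have := Gdom _ (Glin (-1) _ _ Gr Gs).
  by rewrite /= rmorphN1 scaleN1r addNr rnorm0 mulN1r addrC subr_le0.
by move=> Gr Gs; apply/le_anti; rewrite !le_rs.
Qed.

Lemma dominated_graph_extend G v0 : dominated_graph G -> G (0, 0) ->
  exists2 H, dominated_graph H & G `<=` H /\ exists alpha, H (v0, alpha).
Proof.
move=> [Glin Gdom] G0.
have GD p q : G p -> G q -> G (p.1 + q.1, p.2 + q.2).
  by move=> Gp Gq; have := Glin 1 _ _ Gp Gq; rewrite rmorph1 scale1r mul1r.
have GZ a p : G p -> G (a%:C *: p.1, a * p.2).
  by move=> Gp; have := Glin a _ _ Gp G0; rewrite /= !addr0.
pose A := [set p.2 - rnorm (p.1 - v0) | p in G].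
have ubA q : G q -> ubound A (rnorm (q.1 + v0) - q.2).
  move=> Gq _ [p Gp <-]; rewrite lerBrDr addrAC lerBlDr.
  rewrite (le_trans (Gdom _ (GD _ _ Gp Gq)))//=.
  have -> : p.1 + q.1 = (q.1 + v0) + (p.1 - v0).
    by rewrite addrACA subrr addr0 addrC.
  exact: rnormD.
have supA : has_sup A.
  by split; [exists (0 - rnorm (0 - v0)), (0, 0)|exists (rnorm (0 + v0) - 0); exact: (ubA (0, 0))].
pose alpha := sup A.
have alphaP p : G p -> p.2 + alpha <= rnorm (p.1 + v0).
  by move=> Gp; rewrite addrC -lerBrDr; apply: ge_sup; [case: supA|exact: ubA].
have alphaN p : G p -> p.2 - alpha <= rnorm (p.1 - v0).
  move=> Gp; rewrite lerBlDr addrC -lerBlDr.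
  by apply: ub_le_sup; [case: supA|exists p].
(* any alpha between the bounds alphaN and alphaP is an admissible value at v0 *)
pose H := [set p : V * R | exists q b, G q /\
  p = (q.1 + b%:C *: v0, q.2 + b * alpha)].
exists H; last first.
  split=> [[u r] Gp|]; first by exists (u, r), 0; rewrite scale0r mul0r !addr0.
  by exists alpha, (0, 0), 1; rewrite scale1r mul1r !add0r.
split.
  move=> a _ _ [p [b [Gp ->]]] [q [c [Gq ->]]].
  exists (a%:C *: p.1 + q.1, a * p.2 + q.2), (a * b + c); split; first exact: Glin.
  rewrite /=; congr pair; last by ring.
  by rewrite rmorphD rmorphM /= scalerDr scalerDl scalerA addrACA.
move=> _ [p [b [Gp ->]]] /=.
have [b0|b0|->] := ltgtP b 0.
- have nb0 : 0 < - b by rewrite oppr_gt0.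
  have := alphaN _ (GZ (- b)^-1 _ Gp); rewrite -(ler_pM2l nb0) /=.
  have -> : - b * ((- b)^-1 * p.2 - alpha) = p.2 + b * alpha.
    by field; rewrite lt_eqF.
  move=> /le_trans; apply.
  have {1}<- : normc (- b)%:C = - b by rewrite normcR gtr0_norm.
  rewrite -rnormZ scalerBr scalerA -rmorphM mulfV ?gt_eqF// rmorph1 scale1r.
  by rewrite rmorphN scaleNr opprK.
- have := alphaP _ (GZ b^-1 _ Gp); rewrite -(ler_pM2l b0) /=.
  have -> : b * (b^-1 * p.2 + alpha) = p.2 + b * alpha.
    by field; rewrite gt_eqF.
  move=> /le_trans; apply.
  have {1}<- : normc b%:C = b by rewrite normcR gtr0_norm.
  by rewrite -rnormZ scalerDr scalerA -rmorphM mulfV ?gt_eqF// rmorph1 scale1r.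
- by rewrite scale0r mul0r !addr0; exact: Gdom.
Qed.

(** A maximal real functional g dominated by the norm is complexified as g v -
    i g (i v), and the bound passes to it by rotating v so that the value
    becomes real. *)
Lemma norming_functional v0 : exists phi : blinear V C^o,
  phi v0 = (rnorm v0)%:C /\ forall v, normc (phi v) <= rnorm v.
Proof.
pose G0 := [set p : V * R | exists a : R, p = (a%:C *: v0, a * rnorm v0)].
have good0 : dominated_graph G0.
  split=> [a _ _ [b ->] [c ->]|_ [b ->]] /=.
    exists (a * b + c); rewrite rmorphD rmorphM /= scalerDl scalerA.
    by congr pair; ring.
  by rewrite rnormZ normcR ler_wpM2r ?rnorm_ge0// ler_norm.
have G00 : G0 (0, 0) by exists 0; rewrite scale0r mul0r.
(* G0 is joined to every member so that the empty chain has an upper bound *)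
have [A [goodA maxA]] : exists A, dominated_graph (A `|` G0) /\
    forall B, A `<` B -> ~ dominated_graph (B `|` G0).
  apply: (@Zorn_bigcup _ (fun A => dominated_graph (A `|` G0))) => F FP Ftot.
  have common p q : (\bigcup_(X in F) X `|` G0) p ->
      (\bigcup_(X in F) X `|` G0) q ->
      exists G, [/\ dominated_graph G, G p, G q &
        G `<=` \bigcup_(X in F) X `|` G0].
    move=> [[X FX Xp]|G0p] [[Y FY Yq]|G0q].
    - have [XY|YX] := Ftot _ _ FX FY.
        exists (Y `|` G0); split; [exact: FP|by left; exact: XY|by left|].
        by apply: setSU => z Yz; exists Y.
      exists (X `|` G0); split; [exact: FP|by left|by left; exact: YX|].
      by apply: setSU => z Yz; exists X.
    - exists (X `|` G0); split; [exact: FP|by left|by right|].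
      by apply: setSU => z Yz; exists X.
    - exists (Y `|` G0); split; [exact: FP|by right|by left|].
      by apply: setSU => z Yz; exists Y.
    - by exists G0; split => //; right.
  split=> [a p q Up Uq|p Up].
    have [G [[Glin _] Gp Gq GU]] := common _ _ Up Uq.
    by apply: GU; exact: Glin.
  by have [G [[_ Gdom] Gp _ _]] := common _ _ Up Up; exact: Gdom.
set G := A `|` G0 in goodA.
have G0G : G0 `<=` G by right.
have total u : exists r, G (u, r).
  apply: contrapT => nG.
  have [H goodH [GH [alpha Hu]]] := dominated_graph_extend u goodA (G0G _ G00).
  apply: (maxA H).
    split; first by move=> p Ap; apply: GH; left.
    by move=> HA; apply: nG; exists alpha; left; exact: HA.
  by rewrite (_ : H `|` G0 = H)//; apply/setUidPl => p /G0G/GH.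
have [g Gg] := choice total.
have gE u r : G (u, r) -> g u = r by exact: dominated_graph_fun.
have glin a u v : g (a%:C *: u + v) = a * g u + g v.
  by apply: gE; exact: goodA.1 _ _ _ (Gg u) (Gg v).
have g0 : g 0 = 0 by apply: gE; exact: G0G.
have gZ a u : g (a%:C *: u) = a * g u by rewrite -[_ *: u]addr0 glin g0 addr0.
have gD u v : g (u + v) = g u + g v.
  by rewrite -[u](scale1r u) -(rmorph1 (real_complex R)) glin mul1r rmorph1 scale1r.
have gN u : g (- u) = - g u by rewrite -scaleN1r -(rmorphN1 (real_complex R)) gZ mulN1r.
pose phi u : C^o := g u +i* (- g ('i *: u)).
have phiD u v : phi (u + v) = phi u + phi v.
  by rewrite /phi scalerDr !gD opprD; simpc.
have phiR a u : phi (a%:C *: u) = a%:C * phi u.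
  rewrite /phi scalerA mulrC -scalerA !gZ; apply/eqP; rewrite eq_complex /=.
  by rewrite !mul0r subr0 addr0 mulrN !eqxx.
have phiI u : phi ('i *: u) = 'i * phi u.
  rewrite /phi scalerA -expr2 sqr_i scaleN1r gN; apply/eqP; rewrite eq_complex /=.
  by apply/andP; split; apply/eqP; ring.
have phiZ a u : phi (a *: u) = a * phi u.
  rewrite [a in LHS]complexE scalerDl phiD phiR -scalerA phiI phiR mulrA.
  by rewrite -mulrDl -complexE.
have philin : linear phi by move=> a u v; rewrite phiD phiZ.
have phi_le u : normc (phi u) <= rnorm u.
  have [->|p0] := eqVneq (phi u) 0; first by rewrite normc0 rnorm_ge0.
  have n0 : normc (phi u) != 0 by rewrite normc_eq0.
  pose c := (normc (phi u))%:C / phi u.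
  have c1 : normc c = 1.
    by rewrite normcM normcV normcR ger0_norm ?normc_ge0// divff.
  have : complex.Re (phi (c *: u)) <= rnorm u.
    by rewrite -[rnorm u]mul1r -c1 -rnormZ; exact: goodA.2 _ (Gg _).
  by rewrite phiZ divfK.
have [B Bphi] : exists B : blinear V C^o, B =1 phi.
  apply: (@bounded_blinear R V C^o _ 1) => // u.
  by rewrite mul1r rnorm_scalar.
exists B; split => [|v]; last by rewrite Bphi.
rewrite Bphi; have gv0 : g v0 = rnorm v0.
  by apply: gE; apply: G0G; exists 1; rewrite scale1r mul1r.
have := phi_le v0; rewrite /phi gv0 /normc -[leRHS]ger0_norm ?rnorm_ge0//.
rewrite -sqrtr_sqr ler_sqrt ?sqr_ge0// gerDl => h.
have /eqP : (- g ('i *: v0)) ^+ 2 = 0 by apply/le_anti; rewrite h sqr_ge0.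
by rewrite sqrf_eq0 => /eqP ->.
Qed.

End hahn_banach.

(** * Uniform boundedness *)

Section weak_boundedness.
Context (R : realType).
Local Notation C := R[i].

Lemma null_expr3V (c : R) : (c * 3^-1 ^+ n) @[n --> \oo] --> (0 : R).
Proof.
apply: nullM; apply: cvg_expr; rewrite ger0_norm ?invr_ge0//; lra.
Qed.

Lemma tail_geometric3 (V : normedModType C) (e_ : nat -> V) :
  (forall n, rnorm (e_ n) <= 3^-1 ^+ n) -> forall m n, (n <= m)%N ->
  rnorm (\sum_(k < m) e_ k - \sum_(k < n) e_ k) <= 3 / 2 * 3^-1 ^+ n.
Proof.
move=> eB m n /subnK <-; move: (m - n)%N => {}m.
suff : rnorm (\sum_(k < m + n) e_ k - \sum_(k < n) e_ k) <=
    3 / 2 * (3^-1 ^+ n - 3^-1 ^+ (m + n)).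
  move/le_trans; apply; rewrite ler_pM2l ?divr_gt0//.
  by rewrite gerBl exprn_ge0// invr_ge0.
elim: m => [|m IH]; first by rewrite add0n !subrr rnorm0 mulr0.
rewrite addSn big_ord_recr /= addrAC (le_trans (rnormD _ _))//.
rewrite (le_trans (lerD IH (eB _)))// exprS; lra.
Qed.

Lemma banach_steinhaus (X : completeNormedModType C) (W : normedModType C)
    (I : Type) (S : I -> blinear X W) :
  (forall x, exists M, forall i, rnorm (S i x) <= M) ->
  exists2 K, 0 <= K & forall i x, rnorm (S i x) <= K * rnorm x.
Proof.
move=> Spt.
have [||||||K HK] := @gliding_hump R X (fun x r => rnorm x <= r) I
    (fun i x => rnorm (S i x)).
- by move=> e r a er; rewrite rnormZ ler_wpM2l ?normc_ge0.
- move=> e_ eB.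
  have [e [eT _]] := Cauchy_rnorm (@null_expr3V (3 / 2)) (tail_geometric3 eB).
  by exists e; split; [exists (rnorm e)|].
- by move=> i e f; rewrite linearD rnormD.
- by move=> i a e; rewrite linearZ rnormZ.
- move=> i; have [c c0 cS] := blinear_bounded (S i).
  by exists c => e e1; rewrite (le_trans (cS e))// ler_piMr// ltW.
- by move=> e _ _; exact: Spt.
exists `|K| => // i x.
have [/rnorm0_eq0 ->|/eqP x0] := pselect (rnorm x = 0).
  by rewrite linear0 !rnorm0 mulr0.
have xgt0 : 0 < rnorm x by rewrite lt_def x0 rnorm_ge0.
have := HK i ((rnorm x)^-1%:C *: x); rewrite linearZ /= !rnormZ normcR.
rewrite gtr0_norm ?invr_gt0// mulVf ?gt_eqF// => /(_ (lexx _)).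
rewrite mulrC ler_pdivrMr// => /le_trans; apply.
by rewrite ler_wpM2r ?rnorm_ge0// ler_norm.
Qed.

(** The gliding hump is applied to the functionals of norm at most r, the
    vectors y i playing the role of the operators; the Hahn-Banach theorem
    then returns from functionals to vectors. *)
Lemma weakly_bounded_vectors (V : normedModType C) (I : Type) (y : I -> V) :
  (forall phi : blinear V C^o, exists M, forall i, normc (phi (y i)) <= M) ->
  exists K, forall i, rnorm (y i) <= K.
Proof.
move=> ywk.
pose B (f : V -> C^o) (r : R) := linear f /\ forall v, normc (f v) <= r * rnorm v.
have [||||||K HK] := @gliding_hump R (V -> C^o) B I (fun i f => normc (f (y i))).
- move=> f r a [lf fr]; split.
    move=> b u v; rewrite -[LHS]/(a * f _) lf.
    rewrite -[RHS]/(b * (a * f u) + a * f v) mulrDr; congr (_ + _).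
    by rewrite -[b *: f u]/(b * f u) mulrCA.
  move=> v; rewrite -[_ v]/(a * f v) normcM -mulrA.
  by rewrite ler_wpM2l ?normc_ge0.
- move=> e_ eB.
  have sumE n v : (\sum_(k < n) e_ k) v = \sum_(k < n) e_ k v.
    by elim/big_rec2: _ => // k f g _ <-.
  have tailE m n v : (n <= m)%N ->
      rnorm (\sum_(k < m) e_ k v - \sum_(k < n) e_ k v : C^o) <=
      3 / 2 * 3^-1 ^+ n * rnorm v.
    move=> nm.
    have [v0|/eqP v0] := pselect (rnorm v = 0).
      have z k : e_ k v = 0.
        have [_ /(_ v)] := eB k; rewrite v0 mulr0 => h.
        by apply: eq0_normc; apply/le_anti; rewrite h normc_ge0.
      by rewrite !big1 ?subrr ?rnorm0 ?v0 ?mulr0.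
    have vgt0 : 0 < rnorm v by rewrite lt_def v0 rnorm_ge0.
    rewrite -ler_pdivrMr//.
    have /= := @tail_geometric3 C^o (fun k => (rnorm v)^-1%:C * e_ k v) _ m n nm.
    rewrite -!mulr_sumr -mulrBr !rnorm_scalar normcM normcR gtr0_norm ?invr_gt0//.
    rewrite mulrC; apply => k; rewrite rnorm_scalar normcM normcR.
    rewrite gtr0_norm ?invr_gt0// mulrC ler_pdivrMr//; exact: (eB k).2.
  have lim_ v : exists l : C^o, forall n, normc (l - \sum_(k < n) e_ k v) <=
      3 / 2 * 3^-1 ^+ n * rnorm v.
    have nl : (3 / 2 * 3^-1 ^+ n * rnorm v) @[n --> \oo] --> (0 : R).
      by under eq_fun do rewrite mulrAC; exact: null_expr3V.
    have [m n nm|l lT] := @Cauchy_normc R (fun n => \sum_(k < n) e_ k v) _ nl.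
      by rewrite -rnorm_scalar tailE.
    by exists l.
  have [f Hf] := choice lim_.
  have flin : linear f.
    move=> a u v; apply/eqP; rewrite -subr_eq0 -normc_eq0; apply/eqP.
    pose c := normc a * rnorm u + rnorm v + rnorm (a *: u + v).
    apply: (@null_ge0_eq _ _ (fun n => 3 / 2 * c * 3^-1 ^+ n)).
    + exact: normc_ge0.
    + move=> n; rewrite /c.
      have sl : \sum_(k < n) e_ k (a *: u + v) =
          a * \sum_(k < n) e_ k u + \sum_(k < n) e_ k v.
        rewrite mulr_sumr -big_split /=; apply: eq_bigr => k _.
        by rewrite (eB k).1.
      have -> : f (a *: u + v) - (a *: f u + f v) =
        (f (a *: u + v) - \sum_(k < n) e_ k (a *: u + v)) -
        (a * (f u - \sum_(k < n) e_ k u) + (f v - \sum_(k < n) e_ k v)).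
        by rewrite sl -[a *: f u]/(a * f u); ring.
      rewrite (le_trans (normcB _ _))// addrC.
      have := normcD (a * (f u - \sum_(k < n) e_ k u)) (f v - \sum_(k < n) e_ k v).
      rewrite normcM.
      have := Hf (a *: u + v) n; have := Hf v n.
      have := ler_wpM2l (normc_ge0 a) (Hf u n).
      lra.
    + exact: null_expr3V.
  exists f; split.
    exists (3 / 2); split => // v; have := Hf v 0%N.
    by rewrite big_ord0 subr0 expr0 mulr1.
  move=> n; split.
    move=> a u v; rewrite -[LHS]/(f _ - _) flin sumE.
    rewrite -[RHS]/(a * (f u - _) + (f v - _)) !sumE.
    have -> : \sum_(k < n) e_ k (a *: u + v) =
          a * \sum_(k < n) e_ k u + \sum_(k < n) e_ k v.
      rewrite mulr_sumr -big_split /=; apply: eq_bigr => k _.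
      by rewrite (eB k).1.
    by rewrite -[a *: f u]/(a * f u); ring.
  by move=> v; rewrite -[X in normc X]/(f v - _) sumE; exact: (Hf v).
- by move=> i f g; exact: normcD.
- by move=> i a f; rewrite -[X in normc X]/(a * f _) normcM.
- move=> i; exists (rnorm (y i)) => f [_ /(_ (y i))]; by rewrite mul1r.
- move=> f r [lf fr].
  have [phi phiE] : exists phi : blinear V C^o, phi =1 f.
    by apply: (@bounded_blinear R V C^o f r) => // u; rewrite rnorm_scalar.
  by have [M HM] := ywk phi; exists M => i; rewrite -phiE.
exists K => i; have [phi [phiy phi1]] := norming_functional (y i).
have := HK i phi; rewrite phiy normcR ger0_norm ?rnorm_ge0//; apply; split.
  exact: linearP.
by move=> v; rewrite mul1r.
Qed.

(** This turns estimates of the scalars xs (S x), which are all that the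
    definition of the calculus provides, into estimates in operator norm. *)
Lemma weakly_bounded_operators (X : completeNormedModType C) (I : Type)
    (S : I -> blinear X X) :
  (forall x (xs : dual X), exists M, forall i, normc (xs (S i x)) <= M) ->
  exists2 K, 0 <= K & forall i x, rnorm (S i x) <= K * rnorm x.
Proof.
move=> Swk; apply: banach_steinhaus => x.
by apply: weakly_bounded_vectors => xs; exact: Swk.
Qed.

End weak_boundedness.

(** * Integrals of complex-valued functions *)

Section complex_integral.
Context (R : realType).
Local Notation C := R[i].
Local Notation mu := (@lebesgue_measure R).
Implicit Types (D : set R) (g h : R -> C).

Lemma ReD (z w : C) : complex.Re (z + w) = complex.Re z + complex.Re w.
Proof. by case: z; case: w. Qed.

Lemma ImD (z w : C) : complex.Im (z + w) = complex.Im z + complex.Im w.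
Proof. by case: z; case: w. Qed.

Lemma ReB (z w : C) : complex.Re (z - w) = complex.Re z - complex.Re w.
Proof. by case: z; case: w. Qed.

Lemma ImB (z w : C) : complex.Im (z - w) = complex.Im z - complex.Im w.
Proof. by case: z; case: w. Qed.

Lemma cvg_Re_Im T (F : set_system T) {FF : Filter F} (g : T -> C) (l : C) :
  normc (g x - l) @[x --> F] --> (0 : R) ->
  complex.Re (g x) @[x --> F] --> complex.Re l /\
  complex.Im (g x) @[x --> F] --> complex.Im l.
Proof.
move=> gl; split; apply/subr_cvg0/norm_cvg0P.
  by apply: null_le gl => [x|] //; near=> x; rewrite -ReB Re_le_normc.
by apply: null_le gl => [x|] //; near=> x; rewrite -ImB Im_le_normc.
Unshelve. all: by end_near. Qed.

Definition cmeas D g := measurable_fun D (fun t => complex.Re (g t)) /\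
  measurable_fun D (fun t => complex.Im (g t)).

Definition cintegrable D g :=
  mu.-integrable D (EFin \o (fun t => complex.Re (g t))) /\
  mu.-integrable D (EFin \o (fun t => complex.Im (g t))).

Lemma cmeas_cst D (c : C) : cmeas D (fun=> c).
Proof. by split; exact: measurable_cst. Qed.

Lemma cmeasD D g h : cmeas D g -> cmeas D h -> cmeas D (fun t => g t + h t).
Proof.
move=> [g1 g2] [h1 h2]; split.
  by under eq_fun do rewrite ReD; exact: measurable_funD.
by under eq_fun do rewrite ImD; exact: measurable_funD.
Qed.

Lemma cmeasM D g h : cmeas D g -> cmeas D h -> cmeas D (fun t => g t * h t).
Proof.
move=> [g1 g2] [h1 h2]; split.
  rewrite (_ : (fun t => _) = (fun t => complex.Re (g t) * complex.Re (h t) -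
      complex.Im (g t) * complex.Im (h t))).
    by apply: measurable_funB; exact: measurable_funM.
  by apply/funext => t; case: (g t) => a b; case: (h t).
rewrite (_ : (fun t => _) = (fun t => complex.Re (g t) * complex.Im (h t) +
    complex.Im (g t) * complex.Re (h t))).
  by apply: measurable_funD; exact: measurable_funM.
by apply/funext => t; case: (g t) => a b; case: (h t) => c d /=; ring.
Qed.

Lemma cmeasX D g n : cmeas D g -> cmeas D (fun t => g t ^+ n).
Proof.
move=> mg; elim: n => [|n IH]; first by under eq_fun do rewrite expr0; exact: cmeas_cst.
by under eq_fun do rewrite exprS; exact: cmeasM.
Qed.

Lemma cmeas_sum D (I : Type) (r : seq I) (P : pred I) (F : I -> R -> C) :
  (forall i, cmeas D (F i)) -> cmeas D (fun t => \sum_(i <- r | P i) F i t).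
Proof.
move=> mF; elim: r => [|i r IH].
  by under eq_fun do rewrite big_nil; exact: cmeas_cst.
case Pi : (P i); under eq_fun do rewrite big_cons Pi; last exact: IH.
exact: cmeasD.
Qed.

Lemma cmeas_cvg D (g_ : nat -> R -> C) g : (forall n, cmeas D (g_ n)) ->
  (forall t, D t -> normc (g_ n t - g t) @[n --> \oo] --> (0 : R)) -> cmeas D g.
Proof.
move=> mg gg; split.
  by apply: (measurable_fun_cvg (fun n => (mg n).1)) => t /gg/cvg_Re_Im[].
by apply: (measurable_fun_cvg (fun n => (mg n).2)) => t /gg/cvg_Re_Im[].
Qed.

Lemma cmeas_continuous g :
  (forall t, normc (g s - g t) @[s --> t] --> (0 : R)) -> cmeas setT g.
Proof.
by move=> gc; split; apply: continuous_measurable_fun => t;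
  have /cvg_Re_Im[] := gc t.
Qed.

Lemma cmeas_itv_continuous (a b : R) g :
  (forall t, a <= t <= b -> normc (g s - g t) @[s --> t] --> (0 : R)) ->
  cmeas `[a, b] g.
Proof.
by move=> gc; split; apply: subspace_continuous_measurable_fun => //;
  apply: continuous_in_subspaceT => t; rewrite inE /= in_itv /= => /gc/cvg_Re_Im[].
Qed.

Lemma cmeas_sub (D E : set R) g : measurable E -> D `<=` E -> cmeas E g ->
  cmeas D g.
Proof.
by move=> mE DE [m1 m2]; split; [exact: measurable_funS m1|exact: measurable_funS m2].
Qed.

Lemma le_cintegrable D g (h : R -> R) : measurable D -> cmeas D g ->
  (forall t, D t -> normc (g t) <= h t) -> mu.-integrable D (EFin \o h) ->
  cintegrable D g.
Proof.
move=> mD [m1 m2] gh ih; split; apply: le_integrable ih => //.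
- exact/measurable_EFinP.
- move=> t Dt /=; rewrite lee_fin (le_trans (Re_le_normc _))//.
  by rewrite (le_trans (gh _ Dt))// ler_norm.
- exact/measurable_EFinP.
- move=> t Dt /=; rewrite lee_fin (le_trans (Im_le_normc _))//.
  by rewrite (le_trans (gh _ Dt))// ler_norm.
Qed.

Lemma integrable_cst_itv (a b M : R) (x y : bool) :
  mu.-integrable [set` Interval (BSide x a) (BSide y b)] (EFin \o (fun=> M)).
Proof.
have muI : (mu [set` Interval (BSide x a) (BSide y b)] < +oo)%E.
  by rewrite lebesgue_measure_itv; case: ifP => _; rewrite ltry.
by apply: measurable_bounded_integrable => //; exact: bounded_cst.
Qed.

Lemma bounded_cintegrable (a b M : R) (x y : bool) g :
  cmeas [set` Interval (BSide x a) (BSide y b)] g ->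
  (forall t, a <= t <= b -> normc (g t) <= M) ->
  cintegrable [set` Interval (BSide x a) (BSide y b)] g.
Proof.
move=> mg gM; apply: (le_cintegrable (h := fun=> M)) => //.
  move=> t /=; rewrite itv_boundlr => /andP[at_ tb]; apply: gM; apply/andP; split.
    by move: at_; case: x {mg} => //= /ltW.
  by move: tb; case: y {mg} => //= /ltW.
exact: integrable_cst_itv.
Qed.

Lemma eq_cintegral D g h : (forall t, D t -> g t = h t) ->
  cintegral D g = cintegral D h.
Proof.
move=> gh; rewrite /cintegral; congr Complex; apply: eq_Rintegral => t;
  by rewrite inE => /gh ->.
Qed.

Lemma cintegralD D g h : measurable D -> cintegrable D g -> cintegrable D h ->
  cintegral D (fun t => g t + h t) = cintegral D g + cintegral D h.
Proof.
move=> mD [g1 g2] [h1 h2]; rewrite /cintegral; simpc; congr Complex.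
  by rewrite -RintegralD//; apply: eq_Rintegral => t _ /=; rewrite ReD.
by rewrite -RintegralD//; apply: eq_Rintegral => t _ /=; rewrite ImD.
Qed.

Lemma cintegrableD D g h : measurable D -> cintegrable D g -> cintegrable D h ->
  cintegrable D (fun t => g t + h t).
Proof.
move=> mD [g1 g2] [h1 h2]; split.
  have := @integrableD _ _ _ mu D mD _ _ g1 h1; apply: eq_integrable => // t _ /=.
  by rewrite ReD.
have := @integrableD _ _ _ mu D mD _ _ g2 h2; apply: eq_integrable => // t _ /=.
by rewrite ImD.
Qed.

Lemma cintegrableZ D g (c : C) : measurable D -> cintegrable D g ->
  cintegrable D (fun t => c * g t).
Proof.
move=> mD [g1 g2]; split.
  have := @integrableB _ _ _ mu D mD _ _ (@integrableZl _ _ _ mu D mD (complex.Re c) _ g1)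
    (@integrableZl _ _ _ mu D mD (complex.Im c) _ g2).
  apply: eq_integrable => // t _ /=.
  by rewrite -!EFinM -EFinB; congr EFin; case: (c) => a b; case: (g t).
have := @integrableD _ _ _ mu D mD _ _ (@integrableZl _ _ _ mu D mD (complex.Re c) _ g2)
  (@integrableZl _ _ _ mu D mD (complex.Im c) _ g1).
apply: eq_integrable => // t _ /=.
by rewrite -!EFinM -EFinD; congr EFin; case: (c) => a b; case: (g t) => x y /=; ring.
Qed.

Lemma cintegralZ D g (c : C) : measurable D -> cintegrable D g ->
  cintegral D (fun t => c * g t) = c * cintegral D g.
Proof.
move=> mD [g1 g2]; rewrite /cintegral.
have Z1 (a : R) : mu.-integrable D (EFin \o (fun t => a * complex.Re (g t))).
  by have := @integrableZl _ _ _ mu D mD a _ g1; apply: eq_integrable.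
have Z2 (a : R) : mu.-integrable D (EFin \o (fun t => a * complex.Im (g t))).
  by have := @integrableZl _ _ _ mu D mD a _ g2; apply: eq_integrable.
case: c => a b; rewrite [RHS]/GRing.mul /=; congr Complex.
  rewrite -!RintegralZl// -RintegralB//.
  by apply: eq_Rintegral => t _; case: (g t).
rewrite -!RintegralZl// -RintegralD//.
by apply: eq_Rintegral => t _; case: (g t).
Qed.

Lemma cintegralB D g h : measurable D -> cintegrable D g -> cintegrable D h ->
  cintegral D (fun t => g t - h t) = cintegral D g - cintegral D h.
Proof.
move=> mD ig ih.
under [LHS]eq_cintegral => t _ do rewrite -mulN1r.
rewrite cintegralD//; last exact: cintegrableZ.
by rewrite cintegralZ// mulN1r.
Qed.

Lemma cintegrableB D g h : measurable D -> cintegrable D g -> cintegrable D h ->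
  cintegrable D (fun t => g t - h t).
Proof.
move=> mD ig ih; under eq_fun do rewrite -mulN1r.
by apply: cintegrableD => //; exact: cintegrableZ.
Qed.

Lemma cintegrable0 D : cintegrable D (fun=> 0).
Proof. by split; exact: integrable0. Qed.

Lemma cintegral0 D : cintegral D (fun=> 0) = 0 :> C.
Proof. by rewrite /cintegral /Rintegral /= !integral0. Qed.

Lemma cintegrable_sum D (I : Type) (r : seq I) (F : I -> R -> C) :
  measurable D -> (forall i, cintegrable D (F i)) ->
  cintegrable D (fun t => \sum_(i <- r) F i t).
Proof.
move=> mD iF; elim: r => [|i r IH].
  by under eq_fun do rewrite big_nil; exact: cintegrable0.
by under eq_fun do rewrite big_cons; exact: cintegrableD.
Qed.

Lemma cintegral_sum D (I : Type) (r : seq I) (F : I -> R -> C) :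
  measurable D -> (forall i, cintegrable D (F i)) ->
  cintegral D (fun t => \sum_(i <- r) F i t) = \sum_(i <- r) cintegral D (F i).
Proof.
move=> mD iF; elim: r => [|i r IH].
  by under [LHS]eq_cintegral => t _ do rewrite big_nil; rewrite big_nil cintegral0.
under [LHS]eq_cintegral => t _ do rewrite big_cons.
by rewrite cintegralD// ?IH ?big_cons//; exact: cintegrable_sum.
Qed.

(** The factor 2 comes from estimating the real and imaginary parts
    separately. *)
Lemma normc_cintegral_le D g (h : R -> R) : measurable D -> cintegrable D g ->
  mu.-integrable D (EFin \o h) -> (forall t, D t -> normc (g t) <= h t) ->
  normc (cintegral D g) <= 2 * \int[mu]_(t in D) h t.
Proof.
move=> mD [g1 g2] ih gh.
have coord (k : C -> R) : (forall z, `|k z| <= normc z) ->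
    mu.-integrable D (EFin \o (fun t => k (g t))) ->
    `|\int[mu]_(t in D) k (g t)| <= \int[mu]_(t in D) h t.
  move=> kn ik; rewrite (le_trans (@le_normr_Rintegral _ _ _ mu D _ mD ik))//.
  apply: le_Rintegral => //.
    by have := integrable_norm ik; apply: eq_integrable.
  by move=> t Dt; rewrite (le_trans (kn _))// gh.
rewrite (le_trans (normc_le_ReIm _))//= mulr_natl mulr2n.
by rewrite lerD// coord//; [exact: Re_le_normc|exact: Im_le_normc].
Qed.

Lemma Rintegral_itv_cst (a b M : R) : a <= b ->
  \int[mu]_(t in `[a, b]) M = M * (b - a).
Proof.
move=> ab; have muE : fine (mu `[a, b]) = b - a.
  rewrite lebesgue_measure_itv; case: ifPn => [_|]; first by rewrite -EFinB.
  rewrite lte_fin -leNgt => ba; have -> : a = b by apply/le_anti; rewrite ab.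
  by rewrite subrr.
rewrite Rintegral_cst//; congr (_ * _); exact: muE.
Qed.

Lemma normc_cintegral_itv (a b M : R) g : a <= b -> cintegrable `[a, b] g ->
  (forall t, a <= t <= b -> normc (g t) <= M) ->
  normc (cintegral `[a, b] g) <= 2 * (M * (b - a)).
Proof.
move=> ab ig gM; rewrite -Rintegral_itv_cst//.
by apply: normc_cintegral_le => //; exact: integrable_cst_itv.
Qed.

Lemma cintegral_itv_cst (a b : R) (c : C) : a <= b ->
  cintegral `[a, b] (fun=> c) = c * (b - a)%:C.
Proof.
move=> ab; rewrite /cintegral !Rintegral_itv_cst//.
by case: c => x y; rewrite [RHS]/GRing.mul /= !mulr0 subr0 add0r.
Qed.

Lemma cintegral_dominated D (g_ : nat -> R -> C) g (h : R -> R) : measurable D ->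
  (forall n, cmeas D (g_ n)) -> mu.-integrable D (EFin \o h) ->
  (forall n t, D t -> normc (g_ n t) <= h t) ->
  (forall t, D t -> normc (g_ n t - g t) @[n --> \oo] --> (0 : R)) ->
  cintegrable D g /\
  normc (cintegral D (g_ n) - cintegral D g) @[n --> \oo] --> (0 : R).
Proof.
move=> mD mg ih gh gg.
have m_g : cmeas D g by exact: cmeas_cvg gg.
have g_h t : D t -> normc (g t) <= h t.
  move=> Dt; apply/ler_addgt0Pr => e e0.
  have [N HN] := (nullP (fun n => normc_ge0 _)).1 (gg t Dt) _ e0.
  have := HN N (leqnn N); have := gh N t Dt.
  have := normc_distD (g_ N t) (g t) 0; rewrite !subr0 (normc_distC (g t)).
  by lra.
have ig : cintegrable D g by exact: le_cintegrable g_h ih.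
split => //.
have coord (k : {additive C -> R}) : (forall z, `|k z| <= normc z) ->
    (forall n, measurable_fun D (fun t => k (g_ n t))) ->
    mu.-integrable D (EFin \o (fun t => k (g t))) ->
    `|\int[mu]_(t in D) k (g_ n t) - \int[mu]_(t in D) k (g t)| @[n --> \oo] --> (0 : R).
  move=> kn mk ik.
  have kcvg : (\int[mu]_(t in D) (k (g_ n t))%:E)%E @[n --> \oo] -->
      (\int[mu]_(t in D) (k (g t))%:E)%E.
    apply: (@dominated_cvg _ _ _ mu D mD (fun n t => (k (g_ n t))%:E) _ (EFin \o h)).
    - by move=> n; apply/measurable_EFinP; exact: mk.
    - move=> t Dt; apply: cvg_EFin; first by near=> n.
      apply/subr_cvg0/norm_cvg0P.
      by apply: null_leS (gg t Dt) => n //=; rewrite -raddfB kn.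
    - by [].
    - exact: ih.
    - by move=> n t Dt; rewrite lee_fin (le_trans (kn _))// gh.
  apply/norm_cvg0P/subr_cvg0.
  have kfin := @integrable_fin_num _ _ _ mu D mD _ ik.
  have {}kcvg : (\int[mu]_(t in D) (k (g_ n t))%:E)%E @[n --> \oo] -->
      (fine (\int[mu]_(t in D) (k (g t))%:E)%E)%:E by rewrite fineK.
  exact: (fine_cvg kcvg).
apply: (@null_leS _ _ (fun n =>
   `|\int[mu]_(t in D) complex.Re (g_ n t) - \int[mu]_(t in D) complex.Re (g t)| +
   `|\int[mu]_(t in D) complex.Im (g_ n t) - \int[mu]_(t in D) complex.Im (g t)|)).
- by move=> n; exact: normc_ge0.
- by move=> n; rewrite (le_trans (normc_le_ReIm _)).
apply: nullD.
  by apply: (coord (@complex.Re R)) => [z|n|]; [exact: Re_le_normc|exact: (mg n).1|exact: ig.1].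
by apply: (coord (@complex.Im R)) => [z|n|]; [exact: Im_le_normc|exact: (mg n).2|exact: ig.2].
Unshelve. all: by end_near. Qed.

End complex_integral.

(** * The unit circle *)

Section circle.
Context (R : realType).
Local Notation C := R[i].
Local Notation mu := (@lebesgue_measure R).

Lemma Rintegral_FTC (F f : R -> R) (a b : R) : a < b ->
  (forall x : R, is_derive x (1 : R) F (f x)) -> continuous f ->
  \int[mu]_(x in `[a, b]) f x = F b - F a.
Proof.
move=> ab dF cf.
have cF : continuous F.
  by move=> x; apply: differentiable_continuous; apply/derivable1_diffP; case: (dF x).
rewrite /Rintegral (@continuous_FTC2 _ f F)//.
- exact: continuous_subspaceT.
- split=> [x _||]; first by case: (dF x).
    by apply: cvg_at_right_filter; exact: cF.
  by apply: cvg_at_left_filter; exact: cF.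
- by move=> x _; rewrite derive1E; case: (dF x).
Qed.

Definition expi (t : R) : C := cos t +i* sin t.

Lemma expi0 : expi 0 = 1.
Proof. by rewrite /expi cos0 sin0. Qed.

Lemma expiD s t : expi (s + t) = expi s * expi t.
Proof.
rewrite /expi cosD sinD [RHS]/GRing.mul /=; congr Complex.
by rewrite addrC [X in _ + X]mulrC [cos s * _]mulrC; ring.
Qed.

Lemma expiMn (t : R) n : expi (n%:R * t) = expi t ^+ n.
Proof.
elim: n => [|n IH]; first by rewrite mul0r expi0 expr0.
by rewrite -natr1 mulrDl mul1r expiD IH exprSr.
Qed.

Lemma normc_expi t : normc (expi t) = 1.
Proof. by rewrite /normc /expi cos2Dsin2 sqrtr1. Qed.

Lemma expi_neq0 t : expi t != 0.
Proof. by rewrite -normc_eq0 normc_expi oner_eq0. Qed.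

Lemma expiN t : expi (- t) = (expi t)^-1.
Proof.
by apply: (mulIf (expi_neq0 t)); rewrite -expiD addNr expi0 mulVf ?expi_neq0.
Qed.

Lemma polarE (r t : R) : polar r t = r%:C * expi t.
Proof. by rewrite /polar /expi [RHS]/GRing.mul /= !mul0r subr0 addr0. Qed.

Lemma normc_polar (r t : R) : normc (polar r t) = `|r|.
Proof. by rewrite polarE normcM normcR normc_expi mulr1. Qed.

Lemma expi_pi : expi pi = expi (- (pi : R)).
Proof. by rewrite /expi cosN sinN sinpi oppr0. Qed.

Lemma polar_exists (z : C) : exists2 t, - pi <= t <= pi & z = polar (normc z) t.
Proof.
have [->|z0] := eqVneq z 0.
  exists 0; first by rewrite oppr_le0 pi_ge0.
  by rewrite normc0 polarE rmorph0 mul0r.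
have n0 : normc z != 0 by rewrite normc_eq0.
have : (complex.Re z / normc z) ^+ 2 + (complex.Im z / normc z) ^+ 2 = 1.
  rewrite !expr_div_n -mulrDl; case: z z0 n0 => a b _ n0 /=.
  rewrite /normc sqr_sqrtr ?addr_ge0 ?sqr_ge0// divff//.
  by move: n0; rewrite /normc sqrtr_eq0 -ltNge => /gt_eqF ->.
set c := _ / _; set s := _ / _ => cs.
have c1 : -1 <= c <= 1.
  rewrite -ler_norml -[leRHS]normr1 -ler_sqr ?nnegrE// !real_normK ?num_real// expr1n -cs.
  by rewrite lerDl sqr_ge0.
have sE : s ^+ 2 = sin (acos c) ^+ 2.
  by rewrite sin2cos2 acosK ?in_itv//= -cs; ring.
have zE : z = (normc z)%:C * (c +i* s).
  rewrite [RHS]/GRing.mul /= !mul0r subr0 addr0 /c /s ![_ * (_ / _)]mulrC !divfK//.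
  by case: (z).
have : s == sin (acos c) \/ s == - sin (acos c).
  by apply/orP; rewrite -eqf_sqr; apply/eqP.
have a0 : 0 <= acos c by exact: acos_ge0.
have api : acos c <= pi by exact: acos_lepi.
case=> /eqP sE'; [exists (acos c)|exists (- acos c)];
  rewrite ?lerN2 ?(le_trans _ a0) ?(le_trans _ api) ?oppr_le0 ?pi_ge0//;
  try by rewrite polarE [LHS]zE /expi ?cosN ?sinN acosK ?in_itv//= sE'.
by rewrite lerNl (le_trans _ a0)// oppr_le0 (le_trans a0).
Qed.

Lemma cvg_dist0 T (F : set_system T) {FF : Filter F} (f : T -> R) (l : R) :
  f x @[x --> F] --> l -> `|f x - l| @[x --> F] --> (0 : R).
Proof.
move=> /cvgrPdist_lt fl; apply/cvgrPdist_lt => e e0.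
near=> x; rewrite sub0r normrN normr_id distrC; near: x; exact: fl.
Unshelve. all: by end_near. Qed.

Lemma expi_continuous t : normc (expi s - expi t) @[s --> t] --> (0 : R).
Proof.
apply: (@null_le _ _ _ _ _ (fun s => `|cos s - cos t| + `|sin s - sin t|)).
- by move=> s; exact: normc_ge0.
- by near=> s; rewrite (le_trans (normc_le_ReIm _)).
- apply: nullD.
    exact: (cvg_dist0 (@continuous_cos R t)).
  exact: (cvg_dist0 (@continuous_sin R t)).
Unshelve. all: by end_near. Qed.

Lemma cmeas_expi : cmeas setT expi.
Proof. exact: cmeas_continuous expi_continuous. Qed.

Lemma cmeas_comp (g : R -> C) (h : R -> R) : measurable_fun setT h ->
  cmeas setT g -> cmeas setT (g \o h).
Proof.
by move=> mh [m1 m2]; split; [exact: (measurableT_comp m1 mh)|exact: (measurableT_comp m2 mh)].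
Qed.

Lemma cmeas_expiM (k : R) : cmeas setT (fun t => expi (k * t)).
Proof. by apply: (@cmeas_comp expi ( *%R k)); [exact: mulrl_measurable|exact: cmeas_expi]. Qed.

Lemma cmeas_polar (r : R) : cmeas setT (polar r).
Proof.
have -> : polar r = (fun t => r%:C * expi t) by apply/funext => t; exact: polarE.
apply: cmeasM; first exact: cmeas_cst.
exact: cmeas_expi.
Qed.

Lemma cmeas_polarN (r : R) : cmeas setT (fun t => polar r (- t)).
Proof. by apply: (@cmeas_comp (polar r) -%R); [exact: oppr_measurable|exact: cmeas_polar]. Qed.

Lemma cintegral_expi (k a b : R) : a <= b ->
  cintegral `[a, b] (fun t => k *i * expi (k * t)) = expi (k * b) - expi (k * a).
Proof.
rewrite le_eqVlt => /predU1P[->|ab].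
  rewrite subrr set_itv1 /cintegral !Rintegral_set1//.
rewrite /cintegral /expi [RHS]/GRing.add /= /GRing.opp /=; congr Complex.
  transitivity (\int[mu]_(t in `[a, b]) (- (k * sin (k * t)))).
    by apply: eq_Rintegral => t _ /=; rewrite mul0r sub0r.
  apply: (@Rintegral_FTC (fun t => cos (k * t))) => // x.
    by apply: is_derive_eq; rewrite /GRing.scale /=; ring.
  apply: cvgN; apply: cvgMr.
  apply: (@continuous_comp _ _ _ (fun t => k * t) sin); last exact: continuous_sin.
  exact: mulrl_continuous.
transitivity (\int[mu]_(t in `[a, b]) (k * cos (k * t))).
  by apply: eq_Rintegral => t _ /=; rewrite mul0r add0r.
apply: (@Rintegral_FTC (fun t => sin (k * t))) => // x.
  by apply: is_derive_eq; rewrite /GRing.scale /=; ring.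
apply: cvgMr.
apply: (@continuous_comp _ _ _ (fun t => k * t) cos); last exact: continuous_cos.
exact: mulrl_continuous.
Qed.

Lemma pi_itv : - pi <= pi :> R.
Proof. by have := pi_ge0 R; lra. Qed.

Lemma cintegrable_expiM (k : R) : cintegrable `[- pi, pi] (fun t => expi (k * t)).
Proof.
apply: (@bounded_cintegrable _ _ _ 1).
  apply: cmeas_sub (cmeas_expiM k) => //.
by move=> t _; rewrite normc_expi.
Qed.

(** The characters are orthogonal on the circle: the integrand is expi of (n -
    m) t, whose primitive is periodic. *)
Lemma cintegral_orthogonal (n m : nat) :
  cintegral `[- pi, pi] (fun t => expi t ^+ n * expi (- t) ^+ m) =
  if n == m then (2 * pi)%:C else 0 :> C.
Proof.
have tE t : expi t ^+ n * expi (- t) ^+ m = expi ((n%:R - m%:R) * t).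
  by rewrite -!expiMn -expiD; congr expi; ring.
under eq_cintegral => t _ do rewrite tE.
have [->|nm] := eqVneq n m.
  under eq_cintegral => t _ do rewrite subrr mul0r expi0.
  by rewrite cintegral_itv_cst ?pi_itv// mul1r opprK; congr (_%:C); ring.
set k := (n%:R - m%:R : R).
have k0 : k != 0 by rewrite subr_eq0 eqr_nat.
have ki0 : k *i != 0 :> C by rewrite eq_complex /= eqxx.
apply: (mulfI ki0); rewrite mulr0 -cintegralZ//; last exact: cintegrable_expiM.
rewrite cintegral_expi ?pi_itv// mulrN expiN.
have E : expi (k * pi) = (expi (k * pi))^-1; last by rewrite -E subrr.
have h j : expi (j%:R * pi) = expi (- (j%:R * pi)) :> C.
  by rewrite -mulrN !expiMn expi_pi.
rewrite -expiN.
have -> : - (k * pi) = m%:R * pi + - (n%:R * pi) by rewrite /k; ring.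
have -> : k * pi = n%:R * pi + - (m%:R * pi) by rewrite /k; ring.
by rewrite !expiD -!h mulrC.
Qed.

End circle.

(** * Complex derivatives *)

Section complex_derivative.
Context (R : realType).
Local Notation C := R[i].
Implicit Types (f : C -> C) (z w l : C).

Definition cderiv f z l := forall e, 0 < e -> exists2 d : R, 0 < d &
  forall h, normc h < d -> normc (f (z + h) - f z - l * h) <= e * normc h.

Definition ccont f z := forall e, 0 < e -> exists2 d : R, 0 < d &
  forall w, normc (w - z) < d -> normc (f w - f z) < e.

Lemma cderiv_ccont f z l : cderiv f z l -> ccont f z.
Proof.
move=> fl e e0; have [d d0 Hd] := fl 1 ltr01.
pose k := 1 + normc l + 1.
have k0 : 0 < k by rewrite /k; have := normc_ge0 l; lra.
exists (Num.min d (e / k)); first by rewrite lt_min d0 divr_gt0.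
move=> w; rewrite lt_min => /andP[wd we].
have := Hd _ wd; rewrite subrKC mul1r.
move: we; rewrite ltr_pdivlMr// => we h.
have := normcD (f w - f z - l * (w - z)) (l * (w - z)); rewrite subrK normcM.
have := normc_ge0 (w - z).
rewrite /k in we; lra.
Qed.

Lemma ccont_comp T (F : set_system T) {FF : Filter F} f (g : T -> C) z :
  ccont f z -> normc (g x - z) @[x --> F] --> (0 : R) ->
  normc (f (g x) - f z) @[x --> F] --> (0 : R).
Proof.
move=> fc /cvgrPdist_lt gz; apply/cvgrPdist_lt => e /fc[d d0 Hd].
near=> x; rewrite sub0r normrN ger0_norm ?normc_ge0//; apply: Hd.
have : `|0 - normc (g x - z)| < d by near: x; exact: gz.
by rewrite sub0r normrN ger0_norm ?normc_ge0.
Unshelve. all: by end_near. Qed.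

Lemma cderiv_unique f z l m : cderiv f z l -> cderiv f z m -> l = m.
Proof.
move=> fl fm; apply/eqP; rewrite -subr_eq0 -normc_eq0; apply/eqP/le_anti.
rewrite normc_ge0 andbT; apply/ler_addgt0Pr => e e0; rewrite add0r.
have e20 : 0 < e / 2 by rewrite divr_gt0.
have [d d0 Hd] := fl _ e20; have [d' d'0 Hd'] := fm _ e20.
pose h := Num.min d d' / 2.
have m0 : 0 < Num.min d d' by rewrite lt_min d0.
have h0 : 0 < h by rewrite divr_gt0.
have hlt : h < Num.min d d' by rewrite /h; lra.
move: (hlt); rewrite lt_min => /andP[hd hd'].
have nh : normc h%:C = h by rewrite normcR gtr0_norm.
have := Hd h%:C; have := Hd' h%:C; rewrite nh => /(_ hd') h2 /(_ hd) h1.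
have := normcB (f (z + h%:C) - f z - m * h%:C) (f (z + h%:C) - f z - l * h%:C).
have -> : f (z + h%:C) - f z - m * h%:C - (f (z + h%:C) - f z - l * h%:C) =
  (l - m) * h%:C by ring.
rewrite normcM nh => h3.
rewrite -(ler_pM2r h0) (le_trans h3)//; lra.
Qed.

Lemma derivable_cderiv (f : C^o -> C^o) (z : C) :
  derivable f z (1 : C) -> cderiv f z (derive1 f z).
Proof.
move=> fz.
rewrite derive1E; move: (fz) => /cvg_rnormP/cvgrPdist_lt H.
move=> e e0; have := H e e0; rewrite near_withinE => /nbhs_ballP[_ /= /ltC0P[d d0 ->] Hd].
exists d => // h hd; have [->|h0] := eqVneq h 0.
  by rewrite addr0 subrr mulr0 subr0 normc0 mulr0.
have := Hd h; rewrite -ball_normE /= sub0r normrN normrC ltcR => /(_ hd h0).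
rewrite sub0r normrN ger0_norm ?rnorm_ge0// rnorm_scalar => hlt.
have -> : f (z + h) - f z - 'D_1 f z * h =
    h * (h^-1 *: (f (h *: (1 : C^o) + z) - f z) - 'D_1 f z).
  rewrite -[_ *: (_ - _)]/(h^-1 * (_ - _)) -[h *: 1]/(h * 1) mulr1 mulrBr mulrA.
  by rewrite mulfV// mul1r [z + h]addrC ['D_1 f z * h]mulrC.
by rewrite normcM mulrC ler_wpM2r ?normc_ge0// ltW.
Qed.

Lemma eps_continuous (V W : normedModType C) (h : V -> W) (z : V) :
  (forall e : R, 0 < e -> exists2 d : R, 0 < d &
    forall w : V, rnorm (w - z) < d -> rnorm (h w - h z) < e) ->
  {for z, continuous h}.
Proof.
move=> hc; apply/cvgrPdist_lt => _ /ltC0P[e e0 ->].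
have [d d0 Hd] := hc e e0.
apply/nbhs_ballP; exists d%:C; first by rewrite /= ltcR.
move=> w; rewrite -ball_normE /= !normr_rnorm !ltcR (rdistC z w) (rdistC (h z)).
exact: Hd.
Qed.

Lemma ccont_continuous f (z : C^o) : ccont f z ->
  {for z, continuous (f : C^o -> C^o)}.
Proof.
move=> fc; apply: (@eps_continuous C^o C^o f z) => e e0.
have [d d0 Hd] := fc e e0; exists d => // w; rewrite !rnorm_scalar; exact: Hd.
Qed.

(** Compactness of the closed disc of radius r; only the values on the smaller
    disc are controlled. *)
Lemma ccont_bounded f (r : R) : r < 1 ->
  (forall z, normc z < 1 -> ccont f z) ->
  exists2 M, 0 <= M & forall z, normc z <= r -> normc (f z) <= M.
Proof.
move=> r1 fc; have [r0|r0] := ltP r 0.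
  by exists 0 => // z zr; have := normc_ge0 z; lra.
pose h (z : C^o) : C^o := f (r%:C * z).
pose g (z : C^o) : R := rnorm (h z).
have cg : {within [set z : C^o | normc z <= 1], continuous g}.
  apply: continuous_in_subspaceT => z; rewrite inE /= => z1.
  apply: (@continuous_comp _ _ _ h (@rnorm R C^o)); last exact: continuous_rnorm.
  apply: ccont_continuous => e e0.
  have [|d d0 Hd] := fc (r%:C * z) _ e e0.
    by rewrite normcM normcR ger0_norm// (le_lt_trans _ r1)// ler_piMr.
  exists d => // w wd; apply: Hd; rewrite -mulrBr normcM normcR ger0_norm//.
  by rewrite (le_lt_trans _ wd)// ler_piMl ?normc_ge0// ltW.
have [|c _ Hc] := compact_EVT_max _ (@compact_closed_disc R) cg.
  by exists 0; rewrite /= normc0.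
exists (g c); first exact: rnorm_ge0.
move=> z zr; have [r00|rn0] := eqVneq r 0.
  have -> : z = 0 by apply/eqP; rewrite -normc_eq0; apply/eqP/le_anti; rewrite normc_ge0 -{1}r00 zr.
  have := Hc 0; rewrite /g rnorm_scalar /h mulr0; apply.
  by rewrite inE /= normc0.
have := Hc (r%:C^-1 * z); rewrite /g rnorm_scalar /h mulrA divff ?mul1r//; last first.
  by rewrite -normc_eq0 normcR normr_eq0.
apply; rewrite inE /= normcM normcV normcR ger0_norm// ler_pdivrMl ?mulr1//.
by rewrite lt_def rn0.
Qed.

End complex_derivative.

(** * Goursat's argument on a polar rectangle *)

Section goursat.
Context (R : realType).
Local Notation C := R[i].
Local Notation mu := (@lebesgue_measure R).

Lemma cintegral_split (a m b : R) (g : R -> C) : a <= m <= b ->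
  cintegrable `[a, b] g ->
  cintegral `[a, b] g = cintegral `[a, m] g + cintegral `[m, b] g.
Proof.
move=> /andP[am mb] [g1 g2].
have split_ (k : R -> R) : mu.-integrable `[a, b] (EFin \o k) ->
    \int[mu]_(t in `[a, b]) k t =
    \int[mu]_(t in `[a, m]) k t + \int[mu]_(t in `[m, b]) k t.
  move=> ik; apply/eqP; rewrite addrC -subr_eq; apply/eqP.
  rewrite -(@Rintegral_itv_obnd_cbnd _ m (BRight b) k).
    by apply: (@Rintegral_itvB _ k (BLeft a) (BRight b) m ik); rewrite !bnd_simp.
  apply: integrableS ik => //.
  by apply: subset_itv; rewrite bnd_simp.
by rewrite /cintegral [RHS]/GRing.add /=; congr Complex; exact: split_.
Qed.

Lemma nested_point (a b : nat -> R) : (forall n, a n <= b n) ->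
  (forall n, a n <= a n.+1 /\ b n.+1 <= b n) ->
  exists x, forall n, a n <= x <= b n.
Proof.
move=> ab mono.
have a_mono m n : (m <= n)%N -> a m <= a n.
  by apply: (@homo_leq _ a (fun x y => x <= y)) => [x|y x z|k]; [exact: lexx|exact: le_trans|case: (mono k)].
have b_mono m n : (m <= n)%N -> b n <= b m.
  apply: (@homo_leq _ b (fun x y => y <= x)) => [x|y x z xy yz|k].
  - exact: lexx.
  - exact: le_trans yz xy.
  - by case: (mono k).
have am_bn m n : a m <= b n.
  by rewrite (le_trans (a_mono _ _ (leq_maxl m n)))// (le_trans (ab _))// b_mono ?leq_maxr.
exists (sup (range a)) => n; apply/andP; split.
  by apply: ub_le_sup; [exists (b 0%N) => _ [k _ <-]|exists n].
by apply: ge_sup; [exists (a 0%N), 0%N|move=> _ [k _ <-]].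
Qed.

Lemma four_terms (x x1 x2 x3 x4 : R) : x <= x1 + x2 + (x3 + x4) ->
  [\/ x <= 4 * x1, x <= 4 * x2, x <= 4 * x3 | x <= 4 * x4].
Proof.
move=> h; have [h1|h1] := leP x (4 * x1); first by constructor 1.
have [h2|h2] := leP x (4 * x2); first by constructor 2.
have [h3|h3] := leP x (4 * x3); first by constructor 3.
by constructor 4; lra.
Qed.

Lemma four_errors (A B n n12 n34 e1 e2 e3 e4 : R) :
  e4 <= 2 * A -> e3 <= 2 * A -> e2 <= 2 * B -> e1 <= 2 * B ->
  n12 <= e1 + e2 -> n34 <= e3 + e4 -> n <= n34 + n12 ->
  n <= 2 * (2 * A) + 2 * (2 * B).
Proof. lra. Qed.

Lemma dist_itv (x y a b : R) : a <= x <= b -> a <= y <= b -> `|x - y| <= b - a.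
Proof.
by move=> /andP[? ?] /andP[? ?]; rewrite ler_norml; apply/andP; split; lra.
Qed.

Lemma mul_sum_le (x y u v : R) : 0 <= x -> 0 <= y -> 0 <= u -> 0 <= v ->
  x * v + y * u <= (x + y) * (u + v).
Proof.
by move=> x0 y0 u0 v0; have := mulr_ge0 x0 u0; have := mulr_ge0 y0 v0; lra.
Qed.

Lemma half_itv (x y : R) : x <= y ->
  [/\ x <= (x + y) / 2, (x + y) / 2 <= y, (x + y) / 2 - x = (y - x) / 2 &
    y - (x + y) / 2 = (y - x) / 2].
Proof. by move=> xy; split; lra. Qed.

(** Goursat's bisection, for an arbitrary function of rectangles: an additive
    function that is small of second order at every point vanishes, since one
    of the four quarters always carries a quarter of the value. *)
Lemma additive_rectangle_eq0 (rect : R -> R -> R -> R -> C) (a b c d : R) :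
  a <= b -> c <= d ->
  (forall u0 um u1 v0 vm v1, a <= u0 -> u0 <= um <= u1 -> u1 <= b ->
    v0 <= vm <= v1 -> rect u0 u1 v0 v1 =
      rect u0 um v0 vm + rect um u1 v0 vm + (rect u0 um vm v1 + rect um u1 vm v1)) ->
  (forall us vs, a <= us <= b -> forall e, 0 < e -> exists2 delta : R, 0 < delta &
    forall u0 u1 v0 v1, a <= u0 -> u0 <= us <= u1 -> u1 <= b -> v0 <= vs <= v1 ->
      (u1 - u0) + (v1 - v0) < delta ->
      normc (rect u0 u1 v0 v1) <= e * ((u1 - u0) + (v1 - v0)) ^+ 2) ->
  rect a b c d = 0.
Proof.
move=> ab cd rsplit rsmall; set n0 := normc (rect a b c d).
pose ok (Q : (R * R) * (R * R)) := [/\ a <= Q.1.1, Q.1.1 <= Q.1.2, Q.1.2 <= b &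
  Q.2.1 <= Q.2.2].
pose rc (Q : (R * R) * (R * R)) := rect Q.1.1 Q.1.2 Q.2.1 Q.2.2.
pose sub (Q Q' : (R * R) * (R * R)) :=
  [/\ ok Q', normc (rc Q) <= 4 * normc (rc Q'),
    [/\ Q.1.1 <= Q'.1.1, Q'.1.2 <= Q.1.2, Q.2.1 <= Q'.2.1 & Q'.2.2 <= Q.2.2],
    Q'.1.2 - Q'.1.1 = (Q.1.2 - Q.1.1) / 2 & Q'.2.2 - Q'.2.1 = (Q.2.2 - Q.2.1) / 2].
have next Q : exists Q', ok Q -> sub Q Q'.
  case: (pselect (ok Q)) => [|nok]; last by exists Q.
  case: Q => [[u0 u1] [v0 v1]] [/= au0 u01 u1b v01].
  have [x1 x2 x3 x4] := half_itv u01; have [y1 y2 y3 y4] := half_itv v01.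
  move: ((u0 + u1) / 2) ((v0 + v1) / 2) x1 x2 x3 x4 y1 y2 y3 y4.
  move=> um vm x1 x2 x3 x4 y1 y2 y3 y4.
  have aum := le_trans au0 x1; have umb := le_trans x2 u1b.
  have E := rsplit u0 um u1 v0 vm v1 au0 (introT andP (conj x1 x2)) u1b
    (introT andP (conj y1 y2)).
  have : normc (rect u0 u1 v0 v1) <=
      normc (rect u0 um v0 vm) + normc (rect um u1 v0 vm) +
      (normc (rect u0 um vm v1) + normc (rect um u1 vm v1)).
    by rewrite E (le_trans (normcD _ _))// lerD// normcD.
  case/four_terms => H.
  - by exists ((u0, um), (v0, vm)).
  - by exists ((um, u1), (v0, vm)).
  - by exists ((u0, um), (vm, v1)).
  - by exists ((um, u1), (vm, v1)).
have [nx Hnx] := choice next.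
pose Q n := iter n nx ((a, b), (c, d)).
have okQ n : ok (Q n).
  by elim: n => [|n /Hnx[]//]; split.
have subQ n : sub (Q n) (Q n.+1) by exact: Hnx.
have rcQ n : n0 <= 4 ^+ n * normc (rc (Q n)).
  elim: n => [|n IH]; first by rewrite expr0 mul1r.
  rewrite (le_trans IH)// exprSr -mulrA ler_wpM2l ?exprn_ge0//.
  by have [] := subQ n.
have uQ n : (Q n).1.2 - (Q n).1.1 = (b - a) / 2 ^+ n.
  elim: n => [|n IH]; first by rewrite expr0 divr1.
  by have [_ _ _ -> _] := subQ n; rewrite IH exprSr invfM mulrA.
have vQ n : (Q n).2.2 - (Q n).2.1 = (d - c) / 2 ^+ n.
  elim: n => [|n IH]; first by rewrite expr0 divr1.
  by have [_ _ _ _ ->] := subQ n; rewrite IH exprSr invfM mulrA.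
have [us Hus] : exists x, forall n, (Q n).1.1 <= x <= (Q n).1.2.
  apply: nested_point => n; first by have [] := okQ n.
  by have [_ _ [? ? _ _] _ _] := subQ n.
have [vs Hvs] : exists x, forall n, (Q n).2.1 <= x <= (Q n).2.2.
  apply: nested_point => n; first by have [] := okQ n.
  by have [_ _ [_ _ ? ?] _ _] := subQ n.
pose D := (b - a) + (d - c).
have D0 : 0 <= D by rewrite addr_ge0// subr_ge0.
have small e : 0 < e -> n0 <= e * D ^+ 2.
  move=> e0; have [delta d0 Hd] := rsmall us vs (Hus 0%N) e e0.
  have /nullP-/(_ _ _ d0) : (D * 2^-1 ^+ n) @[n --> \oo] --> (0 : R).
    by apply: nullM; apply: cvg_expr; rewrite ger0_norm ?invr_ge0//; lra.
  case=> [n|N /(_ N (leqnn N))]; first by rewrite mulr_ge0// exprn_ge0// invr_ge0.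
  rewrite exprVn => Nd.
  have [h1 h2 h3 h4] := okQ N.
  have := Hd _ _ _ _ h1 (Hus N) h3 (Hvs N); rewrite uQ vQ -mulrDl => /(_ Nd) hr.
  rewrite (le_trans (rcQ N))// -ler_pdivlMl ?exprn_gt0// (le_trans hr)//.
  rewrite le_eqVlt; apply/orP; left; apply/eqP.
  have -> : 4 ^+ N = 2 ^+ N * 2 ^+ N :> R by rewrite -exprMn; congr (_ ^+ _); ring.
  by rewrite /D; field; rewrite expf_neq0.
apply: eq0_normc; apply/le_anti; rewrite normc_ge0 andbT.
apply/ler_addgt0Pr => e e0; rewrite add0r -/n0.
have K1 : 0 < D ^+ 2 + 1 by rewrite ltr_wpDl ?sqr_ge0.
rewrite (le_trans (small _ (divr_gt0 e0 K1)))// mulrAC ler_pdivrMr//.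
by rewrite ler_wpM2l ?lerDl// ltW.
Qed.

Variables (f : C -> C) (r : R) (z : C).
Hypothesis r_itv : 0 < r < 1.
Hypothesis zr : normc z < r.
Hypothesis fdisc : forall w, normc w < 1 -> exists l, cderiv f w l.

Let w (v : R) : C := r%:C * expi v - z.
Let gam (u v : R) : C := z + u%:C * w v.
Let q (v : R) : C := 'i * (r%:C * expi v) / w v.
Let m : R := r - normc z.

Let m_gt0 : 0 < m. Proof. by rewrite /m subr_gt0. Qed.
Let r_gt0 : 0 < r. Proof. by case/andP: r_itv. Qed.
Let r_lt1 : r < 1. Proof. by case/andP: r_itv. Qed.

Let normc_circle v : normc (r%:C * expi v) = r.
Proof. by rewrite normcM normcR normc_expi mulr1 gtr0_norm. Qed.

Let w_ge v : m <= normc (w v).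
Proof.
have := normcD (r%:C * expi v - z) z; rewrite subrK normc_circle.
by rewrite /w /m; lra.
Qed.

Let w_neq0 v : w v != 0.
Proof. by rewrite -normc_gt0 (lt_le_trans m_gt0). Qed.

Let w_le v : normc (w v) <= 2.
Proof.
rewrite (le_trans (normcB _ _))// normc_circle; have := r_lt1; have := zr; lra.
Qed.

Let gam_le u v : 0 <= u <= 1 -> normc (gam u v) <= r.
Proof.
move=> /andP[u0 u1].
have -> : gam u v = (1 - u)%:C * z + u%:C * (r%:C * expi v).
  by rewrite /gam /w rmorphB rmorph1; ring.
rewrite (le_trans (normcD _ _))// !normcM !normcR normc_expi ger0_norm ?subr_ge0//.
rewrite (ger0_norm u0) gtr0_norm// mulr1.
have : (1 - u) * normc z <= (1 - u) * r by rewrite ler_wpM2l ?subr_ge0// ltW.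
lra.
Qed.

Let gam_lt1 u v : 0 <= u <= 1 -> normc (gam u v) < 1.
Proof. by move=> /gam_le h; rewrite (le_lt_trans (h v)). Qed.

Let f_ccont y : normc y < 1 -> ccont f y.
Proof. by move=> /fdisc[l]; exact: cderiv_ccont. Qed.

Lemma normc_i : normc ('i : C) = 1.
Proof. by rewrite /normc /= expr0n expr1n add0r sqrtr1. Qed.

Let expi_lip (s t : R) : normc (expi s - expi t) <= 2 * `|s - t|.
Proof.
wlog st : s t / t <= s => [hw|].
  by have /orP[st|ts] := le_total t s; [exact: hw|rewrite normc_distC distrC; exact: hw].
rewrite (ger0_norm (_ : 0 <= s - t)) ?subr_ge0//.
have := cintegral_expi 1 st; rewrite !mul1r => <-.
rewrite -[leRHS]/(2 * (s - t)) -[X in 2 * X]mul1r; apply: normc_cintegral_itv => //.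
  apply: (@bounded_cintegrable _ _ _ 1).
    apply: cmeasM; first exact: cmeas_cst.
    by apply: cmeas_sub (cmeas_expiM 1).
  by move=> x _; rewrite normcM normc_expi mulr1 normc_i.
by move=> x _; rewrite normcM normc_expi mulr1 normc_i.
Qed.

Let gam_lip u v u' v' : 0 <= u' <= 1 ->
  normc (gam u v - gam u' v') <= 2 * (`|u - u'| + `|v - v'|).
Proof.
move=> /andP[u0 u1].
have -> : gam u v - gam u' v' = (u - u')%:C * w v + u'%:C * (r%:C * (expi v - expi v')).
  by rewrite /gam /w rmorphB; ring.
rewrite (le_trans (normcD _ _))// !normcM !normcR (gtr0_norm r_gt0) (ger0_norm u0).
have h1 : `|u - u'| * normc (w v) <= `|u - u'| * 2 by rewrite ler_wpM2l.
have h2 : u' * (r * normc (expi v - expi v')) <= 1 * (1 * (2 * `|v - v'|)).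
  apply: ler_pM => //; first by rewrite mulr_ge0 ?normc_ge0// ltW.
  by apply: ler_pM => //; [exact: ltW|exact: normc_ge0|exact: ltW].
lra.
Qed.

Let q_le v : normc (q v) <= m^-1.
Proof.
rewrite /q normcM normcV normcM normc_circle normc_i.
rewrite mul1r ler_pdivrMr ?(lt_le_trans m_gt0)//.
have : m^-1 * m <= m^-1 * normc (w v) by rewrite ler_wpM2l// invr_ge0 ltW.
by rewrite mulVf ?gt_eqF//; have := r_lt1; lra.
Qed.

Let expi_lip_cvg (c t : R) : (c * `|s - t|) @[s --> t] --> (0 : R).
Proof. by apply: nullM; apply: cvg_dist0; exact: cvg_id. Qed.

Let meas_gam_v u : 0 <= u <= 1 -> cmeas setT (fun v => f (gam u v)).
Proof.
move=> u01; apply: cmeas_continuous => v.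
apply: ccont_comp; first by apply: f_ccont; exact: gam_lt1.
apply: (null_le _ _ (@expi_lip_cvg 2 v)) => [s|]; first exact: normc_ge0.
by near=> s; rewrite (le_trans (gam_lip _ _ _ u01))// subrr normr0 add0r.
Unshelve. all: by end_near. Qed.

Let meas_q : cmeas setT q.
Proof.
have -> : q = (fun v => 'i + ('i * z) * (w v)^-1).
  by apply/funext => v; rewrite /q /w; field; exact: w_neq0.
apply: cmeasD; first exact: cmeas_cst.
apply: cmeasM; first exact: cmeas_cst.
apply: cmeas_continuous => v.
apply: (null_le _ _ (@expi_lip_cvg (m^-1 * m^-1 * 2) v)) => [s|]; first exact: normc_ge0.
near=> s.
have -> : (w s)^-1 - (w v)^-1 = r%:C * (expi v - expi s) * ((w s)^-1 * (w v)^-1).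
  by rewrite /w; field; rewrite w_neq0; exact: w_neq0.
rewrite !normcM !normcV normcR gtr0_norm//.
have h1 : r * normc (expi v - expi s) <= 2 * `|s - v|.
  rewrite -[leRHS]mul1r; apply: ler_pM; [exact: ltW|exact: normc_ge0|exact: ltW|].
  by rewrite distrC expi_lip.
have vi t : (normc (w t))^-1 <= m^-1.
  by rewrite lef_pV2 ?posrE// (lt_le_trans m_gt0).
rewrite mulrC -[leRHS]mulrA; apply: ler_pM => //.
- by rewrite mulr_ge0// invr_ge0 normc_ge0.
- by rewrite mulr_ge0 ?normc_ge0// ltW.
- by apply: ler_pM => //; rewrite invr_ge0 normc_ge0.
Unshelve. all: by end_near. Qed.

Let meas_gam_u (a v : R) : 0 < a -> cmeas `[a, 1] (fun u => f (gam u v) * (u^-1)%:C).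
Proof.
move=> a0; apply: cmeasM; apply: cmeas_itv_continuous => t /andP[ta t1].
  apply: ccont_comp.
    by apply: f_ccont; apply: gam_lt1; rewrite t1 andbT; lra.
  apply: (null_le _ _ (@expi_lip_cvg 2 t)) => [s|]; first exact: normc_ge0.
  near=> s; rewrite (le_trans (gam_lip _ _ _ _))//; first by rewrite t1 andbT; lra.
  by rewrite subrr normr0 addr0.
have t0 : t != 0 by rewrite gt_eqF//; lra.
have tV : s^-1 @[s --> t] --> t^-1 by apply: cvgV => //; exact: cvg_id.
apply: (null_le _ _ (cvg_dist0 tV)) => [s|]; first exact: normc_ge0.
by near=> s; rewrite -rmorphB normcR.
Unshelve. all: by end_near. Qed.

Section rectangle.
Variable a : R.
Hypothesis a_gt0 : 0 < a.

Let fM := ccont_bounded r_lt1 f_ccont.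

Let V u v0 v1 := cintegral `[v0, v1] (fun v => f (gam u v) * q v).
Let U v u0 u1 := cintegral `[u0, u1] (fun u => f (gam u v) * (u^-1)%:C).
Let rect u0 u1 v0 v1 := V u1 v0 v1 - V u0 v0 v1 - (U v1 u0 u1 - U v0 u0 u1).

Let int_q v0 v1 : cintegrable `[v0, v1] q.
Proof.
apply: (@bounded_cintegrable _ _ _ m^-1) => [|v _]; last exact: q_le.
exact: cmeas_sub meas_q.
Qed.

Let int_V u v0 v1 : 0 <= u <= 1 ->
  cintegrable `[v0, v1] (fun v => f (gam u v) * q v).
Proof.
move=> u01; have [M M0 HM] := fM.
apply: (@bounded_cintegrable _ _ _ (M * m^-1)) => [|v _].
  by apply: cmeasM; [apply: cmeas_sub (meas_gam_v u01)|apply: cmeas_sub meas_q].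
rewrite normcM ler_pM ?normc_ge0 ?q_le//; apply: HM; exact: gam_le.
Qed.

Let int_U v u0 u1 : a <= u0 -> u1 <= 1 ->
  cintegrable `[u0, u1] (fun u => f (gam u v) * (u^-1)%:C).
Proof.
have a0 := a_gt0; move=> au0 u11; have [M M0 HM] := fM.
apply: (@bounded_cintegrable _ _ _ (M * a^-1)) => [|u /andP[uu0 uu1]].
  apply: cmeas_sub (meas_gam_u v a_gt0) => // x; rewrite /= !in_itv /=.
  by move=> /andP[x0 x1]; rewrite (le_trans au0 x0) (le_trans x1 u11).
have u_gt0 : 0 < u by lra.
rewrite normcM ler_pM ?normc_ge0//; first by apply: HM; apply: gam_le; apply/andP; split; lra.
rewrite normcR gtr0_norm ?invr_gt0// lef_pV2 ?posrE//; lra.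
Qed.

Let int_inv u0 u1 : a <= u0 -> cintegrable `[u0, u1] (fun u => (u^-1)%:C : C).
Proof.
move=> au0; apply: (@bounded_cintegrable _ _ _ a^-1) => [|u /andP[uu0 uu1]].
  apply: cmeas_itv_continuous => t /andP[tu0 _].
  have t0 : t != 0 by rewrite gt_eqF//; have := a_gt0; lra.
  have tV : s^-1 @[s --> t] --> t^-1 by apply: cvgV => //; exact: cvg_id.
  apply: (null_le _ _ (cvg_dist0 tV)) => [s|]; first exact: normc_ge0.
  by near=> s; rewrite -rmorphB normcR.
have a0 := a_gt0; have u_gt0 : 0 < u by lra.
rewrite normcR gtr0_norm ?invr_gt0// lef_pV2 ?posrE//; lra.
Unshelve. all: by end_near. Qed.

Let V_split u v0 vm v1 : 0 <= u <= 1 -> v0 <= vm <= v1 ->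
  V u v0 v1 = V u v0 vm + V u vm v1.
Proof. by move=> u01 vv; rewrite /V (cintegral_split vv)//; exact: int_V. Qed.

Let U_split v u0 um u1 : a <= u0 -> u1 <= 1 -> u0 <= um <= u1 ->
  U v u0 u1 = U v u0 um + U v um u1.
Proof. by move=> au u11 uu; rewrite /U (cintegral_split uu)//; exact: int_U. Qed.

Let rect_split u0 um u1 v0 vm v1 : a <= u0 -> u0 <= um <= u1 -> u1 <= 1 ->
  v0 <= vm <= v1 ->
  rect u0 u1 v0 v1 = rect u0 um v0 vm + rect um u1 v0 vm +
    (rect u0 um vm v1 + rect um u1 vm v1).
Proof.
move=> au0 uu u11 vv; have /andP[u0m um1] := uu.
have u0I : 0 <= u0 <= 1.
  by rewrite (le_trans (ltW a_gt0) au0) (le_trans (le_trans u0m um1) u11).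
have umI : 0 <= um <= 1 by rewrite (le_trans _ u0m) ?(le_trans um1)//; case/andP: u0I.
have u1I : 0 <= u1 <= 1 by rewrite u11 andbT (le_trans _ um1)//; case/andP: umI.
rewrite /rect (U_split v1 au0 u11 uu) (U_split v0 au0 u11 uu).
rewrite (V_split u1I vv) (V_split u0I vv).
set x1 := V u1 v0 vm; set x2 := V u1 vm v1; set x3 := V u0 v0 vm.
set x4 := V u0 vm v1; set x5 := U v1 u0 um; set x6 := U v1 um u1.
set x7 := U v0 u0 um; set x8 := U v0 um u1.
set x9 := V um v0 vm; set y1 := V um vm v1; set y2 := U vm u0 um; set y3 := U vm um u1.
move: x1 x2 x3 x4 x5 x6 x7 x8 x9 y1 y2 y3.
by clear; move=> x1 x2 x3 x4 x5 x6 x7 x8 x9 y1 y2 y3; ring.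
Qed.

Let V_affine u v0 v1 (alpha beta : C) (eta : R) : 0 <= u <= 1 -> v0 <= v1 ->
  (forall v, v0 <= v <= v1 -> normc (f (gam u v) - (alpha + beta * (u%:C * w v))) <= eta) ->
  normc (V u v0 v1 - (alpha * cintegral `[v0, v1] q +
    beta * u%:C * (r%:C * (expi v1 - expi v0)))) <= 2 * (eta * m^-1 * (v1 - v0)).
Proof.
move=> u01 vv feta.
have int_e : cintegrable `[v0, v1] (fun v => 'i * expi v).
  apply: cintegrableZ => //; apply: (@bounded_cintegrable _ _ _ 1).
    exact: cmeas_sub (@cmeas_expi R).
  by move=> v _; rewrite normc_expi.
have aff_q v : (alpha + beta * (u%:C * w v)) * q v =
    alpha * q v + beta * u%:C * r%:C * ('i * expi v).
  by rewrite /q; field; exact: w_neq0.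
have int_aff : cintegrable `[v0, v1] (fun v => (alpha + beta * (u%:C * w v)) * q v).
  by rewrite (funext aff_q); apply: cintegrableD => //; exact: cintegrableZ.
have -> : alpha * cintegral `[v0, v1] q + beta * u%:C * (r%:C * (expi v1 - expi v0)) =
    cintegral `[v0, v1] (fun v => (alpha + beta * (u%:C * w v)) * q v).
  have ZI (c : C) g : cintegrable `[v0, v1] g -> cintegrable `[v0, v1] (fun v => c * g v).
    by move=> ig; exact: cintegrableZ.
  rewrite (funext aff_q) cintegralD//; [|exact: ZI|exact: ZI].
  rewrite (cintegralZ _ _ (int_q _ _))// (cintegralZ _ _ int_e)//.
  congr (_ + _); rewrite -[RHS]mulrA.
  congr (_ * (_ * _)); have := cintegral_expi 1 vv; rewrite !mul1r => <-.
  by apply: eq_cintegral => v _; rewrite mul1r.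
rewrite -cintegralB//; last exact: int_V.
apply: normc_cintegral_itv => //.
  by apply: cintegrableB => //; exact: int_V.
by move=> v vI; rewrite -mulrBl normcM ler_pM ?normc_ge0 ?q_le// feta.
Qed.

Let U_affine v u0 u1 (alpha beta : C) (eta : R) : a <= u0 -> u0 <= u1 -> u1 <= 1 ->
  (forall u, u0 <= u <= u1 -> normc (f (gam u v) - (alpha + beta * (u%:C * w v))) <= eta) ->
  normc (U v u0 u1 - (alpha * cintegral `[u0, u1] (fun u => (u^-1)%:C) +
    beta * w v * (u1 - u0)%:C)) <= 2 * (eta * a^-1 * (u1 - u0)).
Proof.
have a0 := a_gt0; move=> au0 uu u11 feta.
have uI u : u0 <= u <= u1 -> 0 < u by move=> /andP[uu0 _]; lra.
have aff_u u : u \in `[u0, u1] ->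
    alpha * (u^-1)%:C + beta * w v = (alpha + beta * (u%:C * w v)) * (u^-1)%:C.
  rewrite in_itv /= => /uI u_gt0.
  have uV : u%:C * (u^-1)%:C = 1 :> C by rewrite -rmorphM mulfV ?gt_eqF.
  by rewrite mulrDl -[LHS]mulr1 -[in LHS]uV; ring: uV.
have intc (c : C) : cintegrable `[u0, u1] (fun=> c).
  by apply: (@bounded_cintegrable _ _ _ (normc c)) => //; exact: cmeas_cst.
have int_aff : cintegrable `[u0, u1] (fun u => alpha * (u^-1)%:C + beta * w v).
  by apply: cintegrableD => //; apply: cintegrableZ => //; exact: int_inv.
have -> : alpha * cintegral `[u0, u1] (fun u => (u^-1)%:C) + beta * w v * (u1 - u0)%:C =
    cintegral `[u0, u1] (fun u => alpha * (u^-1)%:C + beta * w v).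
  rewrite cintegralD//; last by apply: cintegrableZ => //; exact: int_inv.
  rewrite cintegral_itv_cst// cintegralZ//; exact: int_inv.
rewrite -cintegralB//; last exact: int_U.
apply: normc_cintegral_itv => //.
  by apply: cintegrableB => //; exact: int_U.
move=> u uII; rewrite (aff_u u)// -mulrBl normcM ler_pM ?normc_ge0 ?feta//.
have u_gt0 := uI u uII.
rewrite normcR gtr0_norm ?invr_gt0// lef_pV2 ?posrE//; case/andP: uII; lra.
Qed.

Let rect_small u0 u1 v0 v1 (alpha beta : C) (eta : R) :
  a <= u0 -> u0 <= u1 -> u1 <= 1 -> v0 <= v1 ->
  (forall u v, u0 <= u <= u1 -> v0 <= v <= v1 ->
    normc (f (gam u v) - (alpha + beta * (u%:C * w v))) <= eta) ->
  normc (rect u0 u1 v0 v1) <= 4 * eta * (m^-1 * (v1 - v0) + a^-1 * (u1 - u0)).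
Proof.
have a0 := a_gt0; move=> au0 uu u11 vv feta.
have i0 : u0 <= u0 <= u1 by rewrite lexx.
have i1 : u0 <= u1 <= u1 by rewrite lexx uu.
have j0 : v0 <= v0 <= v1 by rewrite lexx.
have j1 : v0 <= v1 <= v1 by rewrite lexx vv.
have u0I : 0 <= u0 <= 1 by apply/andP; split; lra.
have u1I : 0 <= u1 <= 1 by apply/andP; split; lra.
have := V_affine u0I vv (fun v => feta u0 v i0).
have := V_affine u1I vv (fun v => feta u1 v i1).
have := U_affine au0 uu u11 (fun u uI => feta u v0 uI j0).
have := U_affine au0 uu u11 (fun u uI => feta u v1 uI j1).
set e1 := U v1 u0 u1 - _; set e2 := U v0 u0 u1 - _; set e3 := V u1 v0 v1 - _.
set e4 := V u0 v0 v1 - _ => h1 h2 h3 h4.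
have -> : rect u0 u1 v0 v1 = e3 - e4 - (e1 - e2).
  rewrite /rect /e1 /e2 /e3 /e4 /w rmorphB.
  move: (V _ _ _) (V _ _ _) (U _ _ _) (U _ _ _) (cintegral _ _) (cintegral _ _).
  by clear; move=> *; ring.
have -> : 4 * eta * (m^-1 * (v1 - v0) + a^-1 * (u1 - u0)) =
    2 * (2 * (eta * m^-1 * (v1 - v0))) + 2 * (2 * (eta * a^-1 * (u1 - u0))).
  by move: m^-1 a^-1; clear; move=> *; ring.
exact: (four_errors h4 h3 h2 h1 (normcB e1 e2) (normcB e3 e4) (normcB _ _)).
Qed.

(** The differential form f (gam) d gam / (gam - z), pulled back by gam (u, v)
    = z + u (r expi v - z), becomes f (gam) (du / u + q dv). Its integral over
    the boundary of a parameter rectangle is additive, and it vanishes for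
    affine f, so that it is small of second order at every point where f is
    differentiable. *)
Lemma goursat_rectangle v0 v1 : a <= 1 -> v0 <= v1 -> rect a 1 v0 v1 = 0.
Proof.
move=> a1 vv; apply: additive_rectangle_eq0 => // us vs /andP[aus us1] e e0.
have usI : 0 <= us <= 1 by rewrite us1 (le_trans (ltW a_gt0) aus).
have [l fl] := fdisc (gam_lt1 vs usI).
have mi : 0 < m^-1 by rewrite invr_gt0.
have ai : 0 < a^-1 by rewrite invr_gt0.
(* m^-1 and a^-1 bound the coefficients q and 1 / u of the two terms of the form *)
pose K := 8 * (m^-1 + a^-1).
have K0 : 0 < K by rewrite mulr_gt0// addr_gt0.
have [d d0 Hd] := fl _ (divr_gt0 e0 K0).
exists (d / 2); first by rewrite divr_gt0.
move=> u0 u1 w0 w1 au0 /andP[u0s us1'] u11 /andP[w0s ws1].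
set D := (u1 - u0) + (w1 - w0) => Dd.
have du0 : 0 <= u1 - u0 by rewrite subr_ge0 (le_trans u0s).
have dv0 : 0 <= w1 - w0 by rewrite subr_ge0 (le_trans w0s).
have D0 : 0 <= D by rewrite addr_ge0.
have dist u v : u0 <= u <= u1 -> w0 <= v <= w1 -> normc (gam u v - gam us vs) <= 2 * D.
  move=> uI vI; rewrite (le_trans (gam_lip _ _ _ usI))//.
  by rewrite ler_wpM2l// lerD// dist_itv// ?u0s ?w0s.
pose eta := e / K * (2 * D).
have feta u v : u0 <= u <= u1 -> w0 <= v <= w1 ->
    normc (f (gam u v) - (f (gam us vs) - l * (us%:C * w vs) + l * (u%:C * w v))) <= eta.
  move=> uI vI; have duv := dist u v uI vI.
  have := Hd (gam u v - gam us vs) _; rewrite subrKC.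
  have -> : f (gam u v) - f (gam us vs) - l * (gam u v - gam us vs) =
      f (gam u v) - (f (gam us vs) - l * (us%:C * w vs) + l * (u%:C * w v)).
    have -> : gam u v - gam us vs = u%:C * w v - us%:C * w vs.
      by rewrite /gam opprD addrACA subrr add0r.
    by rewrite mulrBr; set x := l * _; set y := l * _; ring.
  have dlt : normc (gam u v - gam us vs) < d.
    by rewrite (le_lt_trans duv)// mulrC -ltr_pdivlMr.
  move=> /(_ dlt) /le_trans; apply.
  by rewrite /eta ler_wpM2l// ltW// divr_gt0.
rewrite (le_trans (rect_small au0 (le_trans u0s us1') u11 (le_trans w0s ws1) feta))//.
have h : m^-1 * (w1 - w0) + a^-1 * (u1 - u0) <= (m^-1 + a^-1) * D.
  by rewrite mul_sum_le// ltW.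
have eta0 : 0 <= 4 * eta.
  by apply: mulr_ge0 => //; apply: mulr_ge0; [rewrite ltW// divr_gt0|exact: mulr_ge0].
rewrite (le_trans (ler_wpM2l eta0 h))//.
rewrite le_eqVlt; apply/orP; left; apply/eqP; rewrite /eta /K.
have ma0 : m^-1 + a^-1 != 0 by rewrite gt_eqF// addr_gt0.
by move: (m^-1 + a^-1) ma0 => x x0; field.
Qed.

(** The sides v = - pi and v = pi of the rectangle have the same image, so
    that their contributions cancel: the circle may be shrunk towards z. *)
Lemma circle_integral_const : a <= 1 ->
  cintegral `[- pi, pi] (fun v => f (z + (r%:C * expi v - z)) *
    ('i * (r%:C * expi v) / (r%:C * expi v - z))) =
  cintegral `[- pi, pi] (fun v => f (z + a%:C * (r%:C * expi v - z)) *
    ('i * (r%:C * expi v) / (r%:C * expi v - z))).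
Proof.
move=> a1; have := goursat_rectangle a1 (pi_itv R).
have -> : rect a 1 (- pi) pi = V 1 (- pi) pi - V a (- pi) pi.
  rewrite /rect /U /gam /w expi_pi subrr subr0 //.
move/subr0_eq; rewrite /V /gam /w /q => <-.
by apply: eq_cintegral => v _; rewrite rmorph1 mul1r.
Qed.

End rectangle.

(** As the circle shrinks to z, continuity of f replaces f (gam) by f z. The
    integral of the kernel q itself is left for [cintegral_kernel]. *)
Lemma circle_integral_center :
  cintegral `[- pi, pi] (fun v => f (r%:C * expi v) *
    ('i * (r%:C * expi v) / (r%:C * expi v - z))) =
  f z * cintegral `[- pi, pi] (fun v => 'i * (r%:C * expi v) / (r%:C * expi v - z)).
Proof.
have [M M0 HM] := ccont_bounded r_lt1 f_ccont.
have z1 : normc z < 1 by rewrite (lt_trans zr).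
(* radii of the shrinking circles, relative to the original one *)
pose a n : R := n.+1%:R^-1.
have a0 n : 0 < a n by rewrite invr_gt0.
have a1 n : a n <= 1 by rewrite invf_le1// ler1n.
have aI n : 0 <= a n <= 1 by rewrite ltW ?a1.
have int_q : cintegrable `[- pi, pi] q.
  apply: (@bounded_cintegrable _ _ _ m^-1) => [|v _]; last exact: q_le.
  exact: cmeas_sub meas_q.
have [|||||int_fz cvg_fz] := @cintegral_dominated R `[- pi, pi]
    (fun n v => f (gam (a n) v) * q v) (fun v => f z * q v) (fun=> M * m^-1).
- by [].
- by move=> n; apply: cmeasM; [apply: cmeas_sub (meas_gam_v (aI n))|apply: cmeas_sub meas_q].
- exact: integrable_cst_itv.
- by move=> n v _; rewrite normcM ler_pM ?normc_ge0 ?q_le//; apply: HM; exact: gam_le.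
- move=> v _.
  have : normc (gam (a n) v - z) @[n --> \oo] --> (0 : R).
    apply: (@null_leS _ _ (fun n => 2 * a n)) => [n|n|]; first exact: normc_ge0.
      rewrite /gam addrAC subrr add0r normcM normcR gtr0_norm// mulrC.
      by rewrite ler_wpM2r// ltW.
    by apply: nullM; exact: cvg_harmonic.
  move=> /(ccont_comp (f_ccont z1)) h.
  apply: (@null_leS _ _ (fun n => m^-1 * normc (f (gam (a n) v) - f z))) => [n|n|].
  + exact: normc_ge0.
  + by rewrite -mulrBl normcM mulrC ler_wpM2r ?normc_ge0.
  + exact: nullM.
have const n : cintegral `[- pi, pi] (fun v => f (gam (a n) v) * q v) =
    cintegral `[- pi, pi] (fun v => f (r%:C * expi v) * q v).
  rewrite -[LHS](circle_integral_const (a0 n) (a1 n)).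
  by apply: eq_cintegral => v _; rewrite addrC subrK.
rewrite -[LHS]/(cintegral `[- pi, pi] (fun v => f (r%:C * expi v) * q v)).
rewrite -cintegralZ//; apply/eqP; rewrite -subr_eq0 -normc_eq0; apply/eqP.
apply: (null_ge0_eq _ _ cvg_fz); first exact: normc_ge0.
by move=> n; rewrite const.
Qed.

End goursat.

(** * Cauchy's formula and the Taylor expansion on a disc *)

Section taylor.
Context (R : realType).
Local Notation C := R[i].

Lemma cvg_geometric_null (c x : R) : 0 <= x < 1 -> (c * x ^+ n) @[n --> \oo] --> (0 : R).
Proof.
by move=> /andP[x0 x1]; apply: nullM; apply: cvg_expr; rewrite ger0_norm.
Qed.

Lemma cintegral_expi_pow (k : nat) :
  cintegral `[- pi, pi] (fun v => expi (- v) ^+ k) = (if k == 0%N then (2 * pi)%:C else 0) :> C.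
Proof.
have := @cintegral_orthogonal R 0 k; rewrite eq_sym => <-.
by apply: eq_cintegral => v _; rewrite expr0 mul1r.
Qed.

Section kernel.
Variables (r : R) (z : C).
Hypotheses (r_gt0 : 0 < r) (zr : normc z < r).

Let kap (v : R) : C := r%:C * expi v / (r%:C * expi v - z).

Let den_ge v : r - normc z <= normc (r%:C * expi v - z).
Proof.
have := normcD (r%:C * expi v - z) z.
rewrite subrK normcM normcR normc_expi mulr1 gtr0_norm//; lra.
Qed.

Let den_neq0 v : r%:C * expi v - z != 0.
Proof. by rewrite -normc_gt0 (lt_le_trans _ (den_ge v))// subr_gt0. Qed.

Lemma kernel_le v : normc (r%:C * expi v / (r%:C * expi v - z)) <= r / (r - normc z).
Proof.
rewrite normcM normcV normcM normcR normc_expi mulr1 gtr0_norm//.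
rewrite ler_wpM2l ?(ltW r_gt0)// lef_pV2 ?posrE ?subr_gt0//.
by rewrite normc_gt0.
Qed.

Let kap_le v : normc (kap v) <= r / (r - normc z). Proof. exact: kernel_le. Qed.

Let kap_geometric n v : kap v =
  \sum_(k < n) z ^+ k * (r^-1)%:C ^+ k * expi (- v) ^+ k +
  (z * (r^-1)%:C * expi (- v)) ^+ n * kap v.
Proof.
have rC : r%:C != 0 :> C by rewrite -normc_eq0 normcR normr_eq0 gt_eqF.
set y := z * (r^-1)%:C * expi (- v).
have yE : y = z / (r%:C * expi v).
  by rewrite /y expiN invfM fmorphV mulrA.
have kapE : kap v = (1 - y)^-1.
  rewrite /kap yE; have := den_neq0 v; have := expi_neq0 v => e0 d0.
  have -> : 1 - z / (r%:C * expi v) = (r%:C * expi v - z) / (r%:C * expi v).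
    by field; rewrite e0 rC.
  by rewrite invf_div.
have y1 : 1 - y != 0.
  have d := den_neq0 v; rewrite yE.
  have -> : 1 - z / (r%:C * expi v) = (r%:C * expi v - z) / (r%:C * expi v).
    by field; rewrite (expi_neq0 v) rC.
  by rewrite mulf_neq0// invr_eq0 mulf_neq0// expi_neq0.
under eq_bigr => k _ do rewrite -!exprMn -/y.
have g : \sum_(k < n) y ^+ k * (1 - y) = 1 - y ^+ n.
  by rewrite -mulr_suml mulrC -opprB mulNr -subrX1 opprB.
apply: (mulIf y1); rewrite mulrDl kapE mulVf// -mulrA mulVf// mulr1 mulr_suml g.
by rewrite subrK.
Qed.

Lemma cmeas_kernel : cmeas `[- pi, pi] (fun v => r%:C * expi v / (r%:C * expi v - z)).
Proof.
rewrite -/kap; apply: (@cmeas_cvg _ _ (fun n v =>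
  \sum_(k < n) z ^+ k * (r^-1)%:C ^+ k * expi (- v) ^+ k)).
  move=> n; apply: cmeas_sum => k; apply: cmeasM; first exact: cmeas_cst.
  apply: cmeasX; apply: (@cmeas_sub _ _ setT) => //.
  by apply: (@cmeas_comp _ (@expi R) -%R); [exact: oppr_measurable|exact: cmeas_expi].
move=> v _; apply: (@null_leS _ _ (fun n => r / (r - normc z) * (normc z / r) ^+ n)).
- by move=> n; exact: normc_ge0.
- move=> n; rewrite {1}(kap_geometric n v) opprD addrA subrr sub0r normcN.
  move: (kap v) (kap_le v) => kv kvle.
  rewrite normcM normcX !normcM normcR normc_expi mulr1 gtr0_norm ?invr_gt0//.
  by rewrite [leRHS]mulrC ler_wpM2l// exprn_ge0// divr_ge0 ?normc_ge0 ?ltW.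
- apply: cvg_geometric_null.
  by rewrite divr_ge0 ?normc_ge0 ?ltW//= ltr_pdivrMr// mul1r.
Qed.

Let cmeas_kap : cmeas `[- pi, pi] kap. Proof. exact: cmeas_kernel. Qed.

(** The Cauchy kernel is the sum of the geometric series of ratio z / (r expi
    v), with an explicit remainder, which is integrated against g. *)
Lemma kernel_expansion (g : R -> C) (M : R) n : cmeas `[- pi, pi] g ->
  (forall v, normc (g v) <= M) ->
  normc (cintegral `[- pi, pi] (fun v => g v * kap v) -
    \sum_(k < n) z ^+ k * ((r^-1)%:C ^+ k *
      cintegral `[- pi, pi] (fun v => g v * expi (- v) ^+ k))) <=
  2 * (M * ((normc z / r) ^+ n * (r / (r - normc z))) * (2 * pi)).
Proof.
move=> mg gM.
have mexp k : cmeas `[- pi, pi] (fun v : R => expi (- v) ^+ k).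
  apply: cmeasX; apply: (@cmeas_sub _ _ setT) => //.
  by apply: (@cmeas_comp _ (@expi R) -%R); [exact: oppr_measurable|exact: cmeas_expi].
have igk k : cintegrable `[- pi, pi] (fun v => g v * expi (- v) ^+ k).
  apply: (@bounded_cintegrable _ _ _ M); first exact: cmeasM.
  by move=> v _; rewrite normcM normcX normc_expi expr1n mulr1.
have igk' k : cintegrable `[- pi, pi] (fun v => z ^+ k * (r^-1)%:C ^+ k *
    (g v * expi (- v) ^+ k)) by exact: cintegrableZ.
have -> : \sum_(k < n) z ^+ k * ((r^-1)%:C ^+ k *
      cintegral `[- pi, pi] (fun v => g v * expi (- v) ^+ k)) =
    cintegral `[- pi, pi] (fun v => \sum_(k < n) z ^+ k * (r^-1)%:C ^+ k *
      (g v * expi (- v) ^+ k)).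
  rewrite cintegral_sum//; apply: eq_bigr => k _.
  by rewrite cintegralZ// mulrA.
have ikap : cintegrable `[- pi, pi] (fun v => g v * kap v).
  apply: (@bounded_cintegrable _ _ _ (M * (r / (r - normc z)))).
    exact: cmeasM.
  by move=> v _; rewrite normcM ler_pM ?normc_ge0.
rewrite -cintegralB//; last exact: cintegrable_sum.
have -> : 2 * pi = pi - (- pi) :> R by ring.
apply: normc_cintegral_itv; first exact: pi_itv.
  by apply: cintegrableB => //; exact: cintegrable_sum.
move=> v _.
have -> : g v * kap v - \sum_(k < n) z ^+ k * (r^-1)%:C ^+ k * (g v * expi (- v) ^+ k) =
    g v * ((z * (r^-1)%:C * expi (- v)) ^+ n * kap v).
  rewrite {1}(kap_geometric n v) mulrDr mulr_sumr addrAC.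
  under eq_bigr => k _ do rewrite mulrCA.
  by rewrite subrr add0r.
move: (kap v) (kap_le v) => kv kvle.
rewrite normcM ler_pM ?normc_ge0// normcM normcX !normcM normcR normc_expi mulr1.
rewrite gtr0_norm ?invr_gt0// ler_wpM2l// exprn_ge0// divr_ge0 ?normc_ge0 ?ltW//.
Qed.

(** Expansion of the kernel for g = 1, where only the constant term has a
    nonzero integral. *)
Lemma cintegral_kernel : cintegral `[- pi, pi] kap = (2 * pi)%:C.
Proof.
apply/eqP; rewrite -subr_eq0 -normc_eq0; apply/eqP.
have zr1 : 0 <= normc z / r < 1.
  by rewrite divr_ge0 ?normc_ge0 ?ltW//= ltr_pdivrMr// mul1r.
apply: (null_ge0_eq _ _ (cvg_geometric_null (2 * (r / (r - normc z) * (2 * pi))) zr1)).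
  exact: normc_ge0.
(* the n = 0 instance of the expansion has no constant term *)
suff H n : normc (cintegral `[- pi, pi] kap - (2 * pi)%:C) <=
    2 * (r / (r - normc z) * (2 * pi)) * (normc z / r) ^+ n.+1.
  case=> [|n]; last exact: H.
  have den0 : 0 < r - normc z by rewrite subr_gt0.
  have K0 : 0 <= 2 * (r / (r - normc z) * (2 * pi)).
    apply: mulr_ge0 => //; apply: mulr_ge0; last by rewrite mulr_ge0 ?pi_ge0.
    by rewrite divr_ge0 ?(ltW r_gt0) ?(ltW den0).
  rewrite (le_trans (H 0%N))// expr1 expr0 ler_wpM2l//.
  by case/andP: zr1 => _ /ltW.
have one_le (v : R) : normc (1 : C) <= 1 by rewrite normc1.
have := @kernel_expansion (fun=> 1) 1 n.+1 (cmeas_cst _ _) one_le.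
rewrite big_ord_recl big1 => [|i _]; last first.
  under eq_cintegral => v _ do rewrite mul1r.
  by rewrite cintegral_expi_pow /= !mulr0.
rewrite !expr0 !mul1r addr0.
under eq_cintegral => v _ do rewrite mul1r.
under [X in _ - X]eq_cintegral => v _ do rewrite expr0 mul1r.
rewrite cintegral_itv_cst ?pi_itv// mul1r opprK.
have -> : (pi + pi)%:C = (2 * pi)%:C :> C by congr (_%:C); ring.
move=> /le_trans; apply.
by rewrite le_eqVlt; apply/orP; left; apply/eqP; ring.
Qed.

End kernel.

Lemma taylor_circle (f : C -> C) (r : R) : 0 < r < 1 ->
  (forall w, normc w < 1 -> exists l, cderiv f w l) ->
  exists a : nat -> C, (exists K, forall n, normc (a n) * r ^+ n <= K) /\
    forall z, normc z < r ->
      normc (\sum_(k < n) a k * z ^+ k - f z) @[n --> \oo] --> (0 : R).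
Proof.
move=> /andP[r0 r1] fd.
have fc y : normc y < 1 -> ccont f y by move=> /fd[l]; exact: cderiv_ccont.
have [M M0 HM] := ccont_bounded r1 fc.
have ncirc v : normc (r%:C * expi v) = r.
  by rewrite normcM normcR normc_expi mulr1 gtr0_norm.
have fM v : normc (f (r%:C * expi v)) <= M by apply: HM; rewrite ncirc.
have mf : cmeas `[- pi, pi] (fun v => f (r%:C * expi v)).
  apply: (@cmeas_sub _ _ setT) => //; apply: cmeas_continuous => v.
  apply: ccont_comp; first by apply: fc; rewrite ncirc.
  apply: (@null_le _ _ _ _ _ (fun s => r * normc (expi s - expi v))).
  - by move=> s; exact: normc_ge0.
  - by near=> s; rewrite -mulrBr normcM normcR gtr0_norm.
  - by apply: nullM; exact: expi_continuous.
have pi0 := pi_gt0 R.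
have tpi0 : (2 * pi)%:C != 0 :> C.
  by rewrite -normc_eq0 normcR normr_eq0 gt_eqF// mulr_gt0.
pose b k := cintegral `[- pi, pi] (fun v => f (r%:C * expi v) * expi (- v) ^+ k).
pose a k := (2 * pi)%:C^-1 * ((r^-1)%:C ^+ k * b k).
have bM k : normc (b k) <= 2 * (M * (2 * pi)).
  rewrite (_ : 2 * pi = pi - (- pi)); last by ring.
  have mexp : cmeas `[- pi, pi] (fun v : R => expi (- v) ^+ k).
    apply: cmeasX; apply: (@cmeas_sub _ _ setT) => //.
    by apply: (@cmeas_comp _ (@expi R) -%R); [exact: oppr_measurable|exact: cmeas_expi].
  have fk v : normc (f (r%:C * expi v) * expi (- v) ^+ k) <= M.
    by rewrite normcM normcX normc_expi expr1n mulr1.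
  apply: normc_cintegral_itv => //; first exact: pi_itv.
  by apply: (@bounded_cintegrable _ _ _ M) => //; exact: cmeasM.
exists a; split.
  exists ((2 * pi)^-1 * (2 * (M * (2 * pi)))) => n.
  rewrite /a !normcM normcV normcX !normcR ger0_norm ?mulr_ge0 ?pi_ge0//.
  rewrite gtr0_norm ?invr_gt0// -mulrA ler_wpM2l ?invr_ge0 ?mulr_ge0 ?pi_ge0//.
  by rewrite mulrAC -exprMn mulVf ?gt_eqF// expr1n mul1r.
move=> z zr.
have zr1 : 0 <= normc z / r < 1.
  by rewrite divr_ge0 ?normc_ge0 ?ltW//= ltr_pdivrMr// mul1r.
have cauchy : cintegral `[- pi, pi] (fun v => f (r%:C * expi v) *
    (r%:C * expi v / (r%:C * expi v - z))) = f z * (2 * pi)%:C.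
  have r01 : 0 < r < 1 by rewrite r0.
  have i0 : 'i != 0 :> C by rewrite -normc_eq0 normc_i oner_eq0.
  have := circle_integral_center r01 zr fd; rewrite -(cintegral_kernel r0 zr).
  have mk := cmeas_kernel r0 zr.
  rewrite (_ : (fun v => f _ * _) = (fun v => 'i * (f (r%:C * expi v) *
    (r%:C * expi v / (r%:C * expi v - z))))); last by apply/funext => v; ring.
  rewrite (_ : (fun v => 'i * _ / _) = (fun v => 'i *
    (r%:C * expi v / (r%:C * expi v - z)))); last by apply/funext => v; ring.
  rewrite cintegralZ//; last first.
    apply: (@bounded_cintegrable _ _ _ (M * (r / (r - normc z)))).
      exact: cmeasM.
    by move=> v _; rewrite normcM ler_pM ?normc_ge0 ?kernel_le.
  rewrite cintegralZ//; last first.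
    apply: (@bounded_cintegrable _ _ _ (r / (r - normc z))) => //.
    by move=> v _; exact: kernel_le.
  by rewrite mulrCA => /(mulfI i0).
apply: (@null_leS _ _ (fun n => (2 * pi)^-1 *
  (2 * (M * (r / (r - normc z)) * (2 * pi))) * (normc z / r) ^+ n)).
- by move=> n; exact: normc_ge0.
- move=> n; have := kernel_expansion r0 zr n mf fM; rewrite cauchy => h.
  have -> : \sum_(k < n) a k * z ^+ k - f z = - ((2 * pi)%:C^-1 *
    (f z * (2 * pi)%:C - \sum_(k < n) z ^+ k * ((r^-1)%:C ^+ k * b k))).
    rewrite mulrBr mulrC mulfK// opprB mulr_sumr; congr (_ - _).
    by apply: eq_bigr => k _; rewrite /a; ring.
  rewrite normcN normcM normcV normcR ger0_norm ?mulr_ge0 ?pi_ge0//.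
  rewrite -mulrA ler_wpM2l ?invr_ge0 ?mulr_ge0 ?pi_ge0// (le_trans h)//.
  by rewrite le_eqVlt; apply/orP; left; apply/eqP; ring.
- exact: cvg_geometric_null.
Unshelve. all: by end_near. Qed.

End taylor.

(** * Power series *)

Section power_series.
Context (R : realType).
Local Notation C := R[i].

Lemma geometric_tail (V : normedModType C) (c : nat -> V) (K q : R) : 0 <= q < 1 ->
  (forall n, rnorm (c n) <= K * q ^+ n) -> forall m n, (n <= m)%N ->
  rnorm (\sum_(k < m) c k - \sum_(k < n) c k) <= K / (1 - q) * q ^+ n.
Proof.
move=> /andP[q0 q1] cK m n /subnK <-; move: (m - n)%N => {}m.
have K0 : 0 <= K by have := cK 0%N; rewrite expr0 mulr1; apply: le_trans; exact: rnorm_ge0.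
have q1' : 0 < 1 - q by rewrite subr_gt0.
suff : rnorm (\sum_(k < m + n) c k - \sum_(k < n) c k) <=
    K / (1 - q) * (q ^+ n - q ^+ (m + n)).
  move/le_trans; apply; rewrite ler_wpM2l ?divr_ge0// ?(ltW q1')//.
  by rewrite gerBl exprn_ge0.
elim: m => [|m IH]; first by rewrite add0n !subrr rnorm0 mulr0.
rewrite addSn big_ord_recr /= addrAC (le_trans (rnormD _ _))//.
rewrite (le_trans (lerD IH (cK _)))// le_eqVlt; apply/orP; left; apply/eqP.
by rewrite exprS; field; rewrite gt_eqF.
Qed.

Lemma geometric_bound_null (K q : R) : 0 <= q < 1 ->
  (K / (1 - q) * q ^+ n) @[n --> \oo] --> (0 : R).
Proof. exact: cvg_geometric_null. Qed.

Lemma series_exists (V : completeNormedModType C) (c : nat -> V) (K q : R) :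
  0 <= q < 1 -> (forall n, rnorm (c n) <= K * q ^+ n) ->
  exists l, forall n, rnorm (l - \sum_(k < n) c k) <= K / (1 - q) * q ^+ n.
Proof.
move=> q01 cK.
by have [l [lT _]] := Cauchy_rnorm (geometric_bound_null K q01) (geometric_tail q01 cK); exists l.
Qed.

Lemma cseries_exists (c : nat -> C) (K q : R) :
  0 <= q < 1 -> (forall n, normc (c n) <= K * q ^+ n) ->
  exists l, forall n, normc (l - \sum_(k < n) c k) <= K / (1 - q) * q ^+ n.
Proof.
move=> q01 cK.
apply: (Cauchy_normc (geometric_bound_null K q01)) => m n nm.
by rewrite -rnorm_scalar; apply: (@geometric_tail C^o) => // k; rewrite rnorm_scalar.
Qed.

Lemma sum_geometric_le (q : R) n : 0 <= q < 1 ->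
  \sum_(k < n) q ^+ k <= (1 - q)^-1.
Proof.
move=> /andP[q0 q1]; have q1' : 0 < 1 - q by rewrite subr_gt0.
rewrite -[leRHS]mul1r ler_pdivlMr// mulrC -opprB mulNr -subrX1 opprB.
by rewrite gerBl// exprn_ge0.
Qed.

Lemma natmul_geometric_le (q : R) n : 0 <= q < 1 -> n.+1%:R * q ^+ n <= (1 - q)^-1.
Proof.
move=> q01; have /andP[q0 q1] := q01.
apply: le_trans (sum_geometric_le n.+1 q01).
rewrite mulr_natl -[n.+1 in leLHS]card_ord -sumr_const; apply: ler_sum => k _.
by rewrite ler_wiXn2l ?(ltW q1)// -ltnS.
Qed.

Lemma sqr_natmul_geometric_le (q : R) n : 0 <= q < 1 ->
  n.+1%:R ^+ 2 * q ^+ n <= (1 - Num.sqrt q)^-1 ^+ 2.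
Proof.
move=> /andP[q0 q1].
have s01 : 0 <= Num.sqrt q < 1.
  by rewrite sqrtr_ge0 -[ltRHS]sqrtr1 ltr_sqrt.
have -> : q ^+ n = (Num.sqrt q ^+ n) ^+ 2 by rewrite -exprM mulnC exprM sqr_sqrtr.
rewrite -exprMn; apply: lerXn2r; rewrite ?nnegrE.
- by rewrite mulr_ge0// exprn_ge0// sqrtr_ge0.
- by rewrite invr_ge0 subr_ge0; case/andP: s01 => _ /ltW.
- exact: natmul_geometric_le.
Qed.

(** At the first nonzero coefficient e n, the tail of the series is of order
    x^(n+1), so that normc (e n) x^n is at most of order x^(n+1) for small x.
    *)
Lemma power_series_unique (e : nat -> C) (rho K : R) : 0 < rho ->
  (forall n, normc (e n) * rho ^+ n <= K) ->
  (forall z, normc z < rho ->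
    normc (\sum_(k < n) e k * z ^+ k) @[n --> \oo] --> (0 : R)) ->
  forall n, e n = 0.
Proof.
move=> rho0 eK ez; elim/ltn_ind => n IH.
have K0 : 0 <= K.
  by have := eK 0%N; rewrite expr0 mulr1; apply: le_trans; exact: normc_ge0.
have ek k : normc (e k) <= K / rho ^+ k by rewrite ler_pdivlMr ?exprn_gt0.
pose L := 2 * K / rho ^+ n / rho.
have L0 : 0 <= L by rewrite !mulr_ge0// invr_ge0 ?exprn_ge0// ltW.
have key x : 0 < x -> x <= rho / 2 -> normc (e n) <= L * x.
  move=> x0 xr.
  have xrho : x < rho by lra.
  have q01 : 0 <= x / rho < 1.
    by rewrite divr_ge0 ?(ltW x0) ?(ltW rho0)//= ltr_pdivrMr// mul1r.
  have xC : normc (x%:C : C) < rho by rewrite normcR gtr0_norm.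
  have xn0 : 0 < x ^+ n by rewrite exprn_gt0.
  have sumE m : \sum_(k < n.+1 + m) e k * x%:C ^+ k =
      (x ^+ n)%:C * e n + \sum_(k < m) e (n.+1 + k)%N * x%:C ^+ (n.+1 + k).
    rewrite big_split_ord /= big_ord_recr /= big1 ?add0r => [|i _]; last first.
      by rewrite IH ?mul0r.
    by rewrite rmorphXn mulrC.
  have tailE m : normc (\sum_(k < m) e (n.+1 + k)%N * x%:C ^+ (n.+1 + k)) <= L * x * x ^+ n.
    rewrite (le_trans (normc_sum _ _ _))//.
    have : \sum_(k < m) normc (e (n.+1 + k)%N * x%:C ^+ (n.+1 + k)) <=
        \sum_(k < m) K * (x / rho) ^+ n.+1 * (x / rho) ^+ k.
      apply: ler_sum => k _; rewrite normcM normcX normcR gtr0_norm//.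
      rewrite -mulrA -exprD expr_div_n mulrCA [leRHS]mulrC.
      by rewrite ler_wpM2r ?exprn_ge0 ?(ltW x0)//; exact: ek.
    move/le_trans; apply; rewrite -mulr_sumr.
    have s2 : \sum_(k < m) (x / rho) ^+ k <= 2.
      have q2 : x / rho <= 2^-1 by rewrite ler_pdivrMr// mulrC.
      have d0 : 0 < 1 - x / rho by lra.
      rewrite (le_trans (sum_geometric_le m q01))// -[leRHS]invrK.
      by rewrite lef_pV2 ?posrE// ?invr_gt0//; lra.
    have h0 : 0 <= K * (x / rho) ^+ n.+1.
      by rewrite mulr_ge0// exprn_ge0//; case/andP: q01.
    rewrite (le_trans (ler_wpM2l h0 s2))// le_eqVlt; apply/orP; left; apply/eqP.
    rewrite /L exprS exprMn exprVn; field.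
    by rewrite expf_neq0 ?gt_eqF.
  rewrite -subr_ge0 -(pmulr_lge0 _ xn0) mulrBl subr_ge0.
  apply/ler_addgt0Pr => d d0.
  have [N HN] := (nullP (fun m => normc_ge0 _)).1 (ez _ xC) _ d0.
  have := HN (n.+1 + N)%N (leq_addl _ _); rewrite sumE => h.
  have := normcB ((x ^+ n)%:C * e n + \sum_(k < N) e (n.+1 + k)%N * x%:C ^+ (n.+1 + k))
    (\sum_(k < N) e (n.+1 + k)%N * x%:C ^+ (n.+1 + k)).
  rewrite addrK normcM normcR gtr0_norm// mulrC.
  by have := tailE N; lra.
apply: eq0_normc; apply/le_anti; rewrite normc_ge0 andbT.
apply/ler_addgt0Pr => d d0; rewrite add0r.
have L1 : 0 < L + 1 by lra.
pose x := Num.min (rho / 2) (d / (L + 1)).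
have x0 : 0 < x by rewrite lt_min !divr_gt0.
rewrite (le_trans (key _ x0 _)) ?ge_min ?lexx//.
have : x <= d / (L + 1) by rewrite ge_min lexx orbT.
rewrite ler_pdivlMr//; lra.
Qed.

(** The growth of the coefficients is recorded with the convergence, since all
    termwise estimates rest on it. *)
Definition has_power_series (f : C -> C) (a : nat -> C) :=
  (forall r, 0 < r < 1 -> exists K, forall n, normc (a n) * r ^+ n <= K) /\
  (forall z, normc z < 1 ->
    normc (\sum_(k < n) a k * z ^+ k - f z) @[n --> \oo] --> (0 : R)).

(** The expansions obtained on the circles of radius r < 1 have the same
    coefficients by uniqueness, so that one sequence serves on the whole disc.
    *)
Lemma taylor (f : C -> C) :
  (forall w, normc w < 1 -> exists l, cderiv f w l) ->
  exists a, has_power_series f a.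
Proof.
move=> fd.
have h0 : 0 < (2^-1 : R) < 1 by rewrite invr_gt0 ltr0n invf_lt1// ltr1n.
have [a [[K aK] aT]] := taylor_circle h0 fd.
have same r b K' : 0 < r < 1 -> (forall n, normc (b n) * r ^+ n <= K') ->
    (forall z, normc z < r ->
      normc (\sum_(k < n) b k * z ^+ k - f z) @[n --> \oo] --> (0 : R)) ->
    forall n, b n = a n.
  move=> /andP[r0 r1] bK bT n; apply/eqP; rewrite -subr_eq0; apply/eqP.
  pose rho := Num.min r 2^-1.
  have rho0 : 0 < rho by rewrite lt_min r0 invr_gt0 ltr0n.
  apply: (@power_series_unique (fun n => b n - a n) rho (K' + K) rho0) => [k|z].
    rewrite (le_trans (ler_wpM2r _ (normcB _ _)))// ?exprn_ge0 ?(ltW rho0)//.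
    rewrite mulrDl; apply: lerD.
      rewrite (le_trans _ (bK k))// ler_wpM2l ?normc_ge0//.
      by rewrite lerXn2r ?nnegrE ?(ltW rho0) ?(ltW r0)// ge_min lexx.
    rewrite (le_trans _ (aK k))// ler_wpM2l ?normc_ge0//.
    by rewrite lerXn2r ?nnegrE ?(ltW rho0)// ge_min lexx orbT.
  rewrite lt_min => /andP[zr z2].
  apply: (@null_leS _ _ (fun n => normc (\sum_(k < n) b k * z ^+ k - f z) +
    normc (\sum_(k < n) a k * z ^+ k - f z))) => [m|m|].
  - exact: normc_ge0.
  - apply: le_trans (normcB _ _); rewrite opprB addrA subrK -sumrB.
    by under eq_bigr => k _ do rewrite mulrBl.
  - by apply: nullD; [exact: bT|exact: aT].
exists a; split=> [r r01|z z1].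
  have [b [[K' bK] bT]] := taylor_circle r01 fd.
  by exists K' => n; rewrite -(same r b K').
pose r := (normc z + 1) / 2.
have r01 : 0 < r < 1 by have := normc_ge0 z; rewrite /r => ?; apply/andP; split; lra.
have [b [[K' bK] bT]] := taylor_circle r01 fd.
have -> : a = b by apply/funext => n; rewrite -(same r b K').
by apply: bT; rewrite /r; lra.
Qed.

(** The quadratic remainder obeys the recursion d (k+1) = (z + h) d k + k
    z^(k-1) h^2. Multiplying by r^2 avoids negative exponents when k < 2. *)
Lemma monomial_taylor (z h : C) (r : R) k : 0 < r -> normc z <= r ->
  normc (z + h) <= r ->
  normc ((z + h) ^+ k - z ^+ k - k%:R * z ^+ k.-1 * h) * r ^+ 2 <=
  k%:R ^+ 2 * r ^+ k * normc h ^+ 2.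
Proof.
move=> r0 zr zhr.
pose d j := (z + h) ^+ j - z ^+ j - j%:R * z ^+ j.-1 * h.
have dS j : d j.+1 = (z + h) * d j + j%:R * z ^+ j.-1 * h ^+ 2.
  case: j => [|j]; rewrite /d /=; first by rewrite !expr1 !expr0; ring.
  by rewrite -[j.+2%:R]natr1 !exprS; ring.
elim: k => [|k IH].
  by rewrite /= !expr0 subrr !mulr0n !mul0r subr0 normc0 expr0n /= !mul0r.
rewrite -/(d k) in IH; rewrite -/(d k.+1) dS.
rewrite (le_trans (ler_wpM2r _ (normcD _ _)))// ?sqr_ge0// mulrDl.
have t1 : normc ((z + h) * d k) * r ^+ 2 <= r * (k%:R ^+ 2 * r ^+ k * normc h ^+ 2).
  rewrite normcM -mulrA; apply: ler_pM => //; first exact: normc_ge0.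
  by rewrite mulr_ge0 ?normc_ge0 ?sqr_ge0.
have t2 : normc (k%:R * z ^+ k.-1 * h ^+ 2) * r ^+ 2 <= k%:R * r ^+ k.+1 * normc h ^+ 2.
  case: k {IH dS t1} => [|k]; first by rewrite !mul0r normc0 mul0r.
  have kn : normc (k.+1%:R : C) = k.+1%:R.
    by rewrite -(rmorph_nat (real_complex R)) normcR ger0_norm.
  rewrite !normcM !normcX kn /= mulrAC ler_wpM2r ?sqr_ge0//.
  rewrite -mulrA ler_wpM2l//; have -> : r ^+ k.+2 = r ^+ k * r ^+ 2 by rewrite -exprD addn2.
  by rewrite ler_wpM2r ?sqr_ge0// lerXn2r ?nnegrE ?normc_ge0 ?(ltW r0).
rewrite (le_trans (lerD t1 t2))//.
rewrite -subr_ge0.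
have -> : k.+1%:R ^+ 2 * r ^+ k.+1 * normc h ^+ 2 -
   (r * (k%:R ^+ 2 * r ^+ k * normc h ^+ 2) + k%:R * r ^+ k.+1 * normc h ^+ 2) =
   (k%:R + 1) * r ^+ k.+1 * normc h ^+ 2.
  by rewrite -[k.+1%:R]natr1 [r ^+ k.+1]exprS; ring.
by rewrite mulr_ge0 ?sqr_ge0// mulr_ge0 ?exprn_ge0 ?(ltW r0)// addr_ge0.
Qed.

Lemma nat_normc n : normc (n%:R : C) = n%:R.
Proof. by rewrite -(rmorph_nat (real_complex R)) normcR ger0_norm. Qed.

(** Two successive square roots q and p of s are used: q leaves room for the
    growth of the coefficients, and p for the factor (n+1)^2. *)
Lemma sqr_coeff_geometric (a : nat -> C) (s : R) :
  (forall r, 0 < r < 1 -> exists K, forall n, normc (a n) * r ^+ n <= K) ->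
  0 < s < 1 -> exists K q, [/\ 0 <= K, 0 < q < 1 &
    forall n, n.+1%:R ^+ 2 * normc (a n) * s ^+ n <= K * q ^+ n].
Proof.
move=> aK /andP[s0 s1].
pose q := Num.sqrt s.
have q0 : 0 < q by rewrite sqrtr_gt0.
have q1 : q < 1 by rewrite -[ltRHS]sqrtr1 ltr_sqrt.
pose p := Num.sqrt q.
have p0 : 0 < p by rewrite sqrtr_gt0.
have p1 : p < 1 by rewrite -[ltRHS]sqrtr1 ltr_sqrt.
have sE : s = q * q by rewrite -expr2 sqr_sqrtr// ltW.
have qE : q = p * p by rewrite -expr2 sqr_sqrtr// ltW.
have [|K HK] := aK q; first by rewrite q0.
have K0 : 0 <= K by have := HK 0%N; rewrite expr0 mulr1; apply: le_trans; exact: normc_ge0.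
exists (K * (1 - Num.sqrt p)^-1 ^+ 2), p; split.
- by rewrite mulr_ge0// sqr_ge0.
- by rewrite p0.
- move=> n; rewrite {1}sE exprMn {2}qE exprMn.
  have h := sqr_natmul_geometric_le n (_ : 0 <= p < 1).
  rewrite (_ : _ * _ = (n.+1%:R ^+ 2 * p ^+ n) * (normc (a n) * q ^+ n) * p ^+ n); last by ring.
  rewrite ler_wpM2r ?exprn_ge0 ?(ltW p0)// mulrC.
  apply: ler_pM => //.
  + by rewrite mulr_ge0 ?normc_ge0// exprn_ge0// ltW.
  + by rewrite mulr_ge0 ?sqr_ge0// exprn_ge0// ltW.
  + by apply: h; rewrite (ltW p0).
Qed.

End power_series.

(** * Derivatives and pairings of power series *)

Section derived_series.
Context (R : realType).
Local Notation C := R[i].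

Lemma le_null_lim (x c : R) (e : nat -> R) : (forall n, 0 <= e n) ->
  (forall n, x <= c + e n) -> e n @[n --> \oo] --> (0 : R) -> x <= c.
Proof.
move=> e0 xc en; apply/ler_addgt0Pr => d d0.
have [N HN] := (nullP e0).1 en _ d0.
by rewrite (le_trans (xc N))// lerD2l ltW// HN.
Qed.

Lemma deriv_coeff_geometric (a : nat -> C) (s : R) :
  (forall r, 0 < r < 1 -> exists K, forall n, normc (a n) * r ^+ n <= K) ->
  0 < s < 1 -> exists K q, [/\ 0 <= K, 0 < q < 1 &
    forall n, n.+1%:R ^+ 2 * normc (a n.+1) * s ^+ n <= K * q ^+ n].
Proof.
move=> aK s01; have [s0 s1] := andP s01.
have [K [q [K0 q01 HK]]] := sqr_coeff_geometric aK s01; have [q0 q1] := andP q01.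
exists (K / s), q; split=> // [|n]; first by rewrite divr_ge0// ltW.
rewrite [leRHS]mulrAC ler_pdivlMr// -[leLHS]mulrA -exprSr.
have := HK n.+1 => h; rewrite (le_trans _ (le_trans h _))//.
  rewrite !ler_wpM2r ?exprn_ge0 ?normc_ge0 ?(ltW s0)//.
  by rewrite lerXn2r ?nnegrE// ler_nat.
by rewrite ler_wpM2l// exprSr ler_piMr ?exprn_ge0 ?(ltW q0) ?(ltW q1).
Qed.

(** The quadratic remainder of each monomial is summed against the geometric
    majorant of the coefficients, uniformly in the number of terms. *)
Lemma series_derivative (f : C -> C) (a : nat -> C) (z : C) :
  has_power_series f a -> normc z < 1 ->
  exists2 D, cderiv f z D &
    normc (\sum_(k < n) k.+1%:R * a k.+1 * z ^+ k - D) @[n --> \oo] --> (0 : R).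
Proof.
move=> [aK aT] z1; pose s := (normc z + 1) / 2.
have zs : normc z < s by rewrite /s; lra.
have s1 : s < 1 by rewrite /s; lra.
have s0 : 0 < s by rewrite (le_lt_trans _ zs)// normc_ge0.
have s01 : 0 < s < 1 by rewrite s0.
have [K [q [K0 q01 HK]]] := deriv_coeff_geometric aK s01.
have [q0 q1] := andP q01.
have q01' : 0 <= q < 1 by rewrite ltW.
have cK k : normc (k.+1%:R * a k.+1 * z ^+ k) <= K * q ^+ k.
  rewrite (le_trans _ (HK k))// !normcM normcX nat_normc.
  apply: ler_pM; rewrite ?mulr_ge0 ?normc_ge0 ?exprn_ge0 ?normc_ge0//.
    by rewrite ler_wpM2r ?normc_ge0// expr2 ler_peMl// ler1n.
  by rewrite lerXn2r ?nnegrE ?normc_ge0 ?ltW.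
have [D HD] := cseries_exists q01' cK.
have DT : normc (\sum_(k < n) k.+1%:R * a k.+1 * z ^+ k - D) @[n --> \oo] --> (0 : R).
  apply: null_leS (geometric_bound_null K q01') => n; first exact: normc_ge0.
  by rewrite normc_distC.
exists D => //.
pose S := K / (1 - q) / s.
have S0 : 0 <= S.
  by apply: divr_ge0; [apply: divr_ge0 => //; rewrite subr_ge0 ltW|exact: ltW].
(* quadratic remainder, uniformly in the number of terms *)
have rem h n : normc (z + h) <= s ->
    normc (\sum_(k < n.+1) a k * (z + h) ^+ k - \sum_(k < n.+1) a k * z ^+ k -
      (\sum_(k < n) k.+1%:R * a k.+1 * z ^+ k) * h) <= S * normc h ^+ 2.
  move=> zhs.
  have -> : \sum_(k < n.+1) a k * (z + h) ^+ k - \sum_(k < n.+1) a k * z ^+ k -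
      (\sum_(k < n) k.+1%:R * a k.+1 * z ^+ k) * h =
      \sum_(k < n) a k.+1 * ((z + h) ^+ k.+1 - z ^+ k.+1 - k.+1%:R * z ^+ k * h).
    rewrite !big_ord_recl !expr0 mulr_suml opprD addrACA subrr add0r -!sumrB.
    apply: eq_bigr => k _; rewrite !lift0; ring.
  rewrite (le_trans (normc_sum _ _ _))//.
  have : \sum_(k < n) normc (a k.+1 * ((z + h) ^+ k.+1 - z ^+ k.+1 -
      k.+1%:R * z ^+ k * h)) <= \sum_(k < n) K / s * normc h ^+ 2 * q ^+ k.
    apply: ler_sum => k _; rewrite normcM.
    have := monomial_taylor k.+1 s0 (ltW zs) zhs; rewrite /= => h1.
    have s2 : 0 < s ^+ 2 by rewrite exprn_gt0.
    rewrite -(ler_pM2r s2) -[leLHS]mulrA.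
    rewrite (le_trans (ler_wpM2l (normc_ge0 _) h1))// [s ^+ k.+1]exprS.
    have -> : normc (a k.+1) * (k.+1%:R ^+ 2 * (s * s ^+ k) * normc h ^+ 2) =
      (k.+1%:R ^+ 2 * normc (a k.+1) * s ^+ k) * (normc h ^+ 2 * s) by ring.
    have -> : K / s * normc h ^+ 2 * q ^+ k * s ^+ 2 = (K * q ^+ k) * (normc h ^+ 2 * s).
      by field; rewrite gt_eqF.
    by rewrite ler_wpM2r ?HK// mulr_ge0 ?sqr_ge0// ltW.
  move/le_trans; apply; rewrite -mulr_sumr.
  have h0 : 0 <= K / s * normc h ^+ 2 by rewrite mulr_ge0 ?sqr_ge0// divr_ge0// ltW.
  rewrite (le_trans (ler_wpM2l h0 (sum_geometric_le n q01')))//.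
  rewrite le_eqVlt; apply/orP; left; apply/eqP; rewrite /S; ring.
move=> e e0.
have Sp : 0 < S + 1 by lra.
exists (Num.min (s - normc z) (e / (S + 1))).
  by rewrite lt_min subr_gt0 zs divr_gt0.
move=> h; rewrite lt_min ltr_pdivlMr// => /andP[hs he].
have zhs : normc (z + h) <= s by have := normcD z h; lra.
have zh1 : normc (z + h) < 1 by rewrite (le_lt_trans zhs).
have main : normc (f (z + h) - f z - D * h) <= S * normc h ^+ 2.
  have T1 := aT _ zh1; have T2 := aT _ z1.
  have sh (u : nat -> R) : u n @[n --> \oo] --> (0 : R) -> u n.+1 @[n --> \oo] --> (0 : R).
    by move=> uT; rewrite (cvg_shiftS u).
  apply: (le_null_lim _ _ (nullD (nullD (sh _ T1) (sh _ T2)) (nullM (normc h) DT))) => n.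
    by rewrite !addr_ge0 ?normc_ge0// mulr_ge0 ?normc_ge0.
  have := rem h n zhs.
  set u1 := \sum_(k < n.+1) _; set u2 := \sum_(k < n.+1) _; set u3 := \sum_(k < n) _.
  move=> hr.
  have -> : f (z + h) - f z - D * h = (u1 - u2 - u3 * h) - (u1 - f (z + h)) +
     (u2 - f z) + (u3 - D) * h by ring.
  have n1 := normcD (u1 - u2 - u3 * h - (u1 - f (z + h)) + (u2 - f z)) ((u3 - D) * h).
  have n2 := normcD (u1 - u2 - u3 * h - (u1 - f (z + h))) (u2 - f z).
  have n3 := normcB (u1 - u2 - u3 * h) (u1 - f (z + h)).
  rewrite normcM in n1; lra.
rewrite (le_trans main)// expr2 mulrA ler_wpM2r ?normc_ge0//.
have := normc_ge0 h; lra.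
Qed.

Section pairing.
Variables (a t : nat -> C) (fd gd : C -> C) (Kt : R).
Hypothesis aK : forall r, 0 < r < 1 -> exists K, forall n, normc (a n) * r ^+ n <= K.
Hypothesis tK : forall n, normc (t n) <= Kt.
Hypothesis fdE : forall z, normc z < 1 ->
  normc (\sum_(k < n) k.+1%:R * a k.+1 * z ^+ k - fd z) @[n --> \oo] --> (0 : R).
Hypothesis gdE : forall z, normc z < 1 ->
  normc (\sum_(k < n) k.+1%:R * t k.+1 * z ^+ k - gd z) @[n --> \oo] --> (0 : R).

Lemma bounded_coeff (r : R) : 0 < r < 1 -> exists K, forall n, normc (t n) * r ^+ n <= K.
Proof.
move=> /andP[r0 r1]; exists Kt => n; rewrite (le_trans _ (tK n))//.
by rewrite ler_piMr ?normc_ge0// exprn_ile1// ltW.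
Qed.

Lemma partial_sum_bound (b : nat -> C) (K q s : R) : 0 <= K -> 0 < q < 1 ->
  (forall n, n.+1%:R ^+ 2 * normc (b n.+1) * s ^+ n <= K * q ^+ n) ->
  forall z n, normc z = s ->
  normc (\sum_(k < n) k.+1%:R * b k.+1 * z ^+ k) <= K / (1 - q).
Proof.
move=> K0 /andP[q0 q1] bK z n zs; rewrite (le_trans (normc_sum _ _ _))//.
have q01' : 0 <= q < 1 by rewrite ltW.
rewrite (le_trans _ (ler_wpM2l K0 (sum_geometric_le n q01')))// mulr_sumr.
apply: ler_sum => k _; rewrite (le_trans _ (bK k))// !normcM normcX nat_normc zs.
have s0 : 0 <= s by rewrite -zs normc_ge0.
by rewrite !ler_wpM2r ?exprn_ge0 ?normc_ge0// expr2 ler_peMl// ler1n.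
Qed.

Let cmeas_poly (b : nat -> C) (g : R -> C) D n : cmeas D g ->
  cmeas D (fun v => \sum_(k < n) k.+1%:R * b k.+1 * g v ^+ k).
Proof.
move=> mg; apply: cmeas_sum => k; apply: cmeasM; first exact: cmeas_cst.
exact: cmeasX.
Qed.

(** The inner integral in the definition of the functional calculus, with f'
    replaced by fd and the resolvent term by gd. *)
Definition pairing (s : R) : C :=
  cintegral `[- pi, pi] (fun v => fd (polar s v) * gd (polar s (- v))).

(** Parseval's formula for the series of fd and gd on the circle of radius s.
    It turns the pairing into a series in the products a (k+1) t (k+1), in
    which the two functions no longer occur. *)
Lemma pairing_series (s : R) : 0 < s < 1 ->
  cintegrable `[- pi, pi] (fun v => fd (polar s v) * gd (polar s (- v))) /\
  normc ((2 * pi)%:C * (\sum_(k < n) k.+1%:R ^+ 2 * (a k.+1 * t k.+1) * (s ^+ (2 * k))%:C)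
    - pairing s) @[n --> \oo] --> (0 : R).
Proof.
move=> s01; have [s0 s1] := andP s01.
have [K [q [K0 q01 HK]]] := deriv_coeff_geometric aK s01.
have [K' [q' [K'0 q'01 HK']]] := deriv_coeff_geometric bounded_coeff s01.
have ps v : normc (polar s v) = s by rewrite normc_polar gtr0_norm.
pose u n v := \sum_(k < n) k.+1%:R * a k.+1 * polar s v ^+ k.
pose w n v := \sum_(k < n) k.+1%:R * t k.+1 * polar s (- v) ^+ k.
have ub n v : normc (u n v) <= K / (1 - q) by exact: (partial_sum_bound K0 q01 HK).
have wb n v : normc (w n v) <= K' / (1 - q') by exact: (partial_sum_bound K'0 q'01 HK').
have mp : cmeas `[- pi, pi] (polar s) by exact: cmeas_sub (cmeas_polar s).
have mpN : cmeas `[- pi, pi] (fun v => polar s (- v)) by exact: cmeas_sub (cmeas_polarN s).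
have [|||||ii cc] := @cintegral_dominated R `[- pi, pi] (fun n v => u n v * w n v)
  (fun v => fd (polar s v) * gd (polar s (- v))) (fun=> K / (1 - q) * (K' / (1 - q'))).
- by [].
- by move=> n; apply: cmeasM; exact: cmeas_poly.
- exact: integrable_cst_itv.
- by move=> n v _; rewrite normcM ler_pM ?normc_ge0.
- move=> v _.
  have T1 := fdE (_ : normc (polar s v) < 1); have T2 := gdE (_ : normc (polar s (- v)) < 1).
  apply: (@null_leS _ _ (fun n => K' / (1 - q') * normc (u n v - fd (polar s v)) +
    normc (fd (polar s v)) * normc (w n v - gd (polar s (- v))))) => [n|n|].
  + exact: normc_ge0.
  + have -> : u n v * w n v - fd (polar s v) * gd (polar s (- v)) =
      (u n v - fd (polar s v)) * w n v + fd (polar s v) * (w n v - gd (polar s (- v))).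
      by ring.
    rewrite (le_trans (normcD _ _))// !normcM lerD2r mulrC.
    by rewrite ler_wpM2r ?normc_ge0.
  + by apply: nullD; apply: nullM; [apply: T1|apply: T2]; rewrite ps.
split => //; apply: null_eq cc => n; congr (normc (_ - _)).
have sC : s%:C != 0 :> C by rewrite -normc_eq0 normcR normr_eq0 gt_eqF.
have expand v : u n v * w n v = \sum_(k < n) \sum_(l < n)
    (k.+1%:R * a k.+1 * (l.+1%:R * t l.+1) * s%:C ^+ (k + l)) *
    (expi v ^+ k * expi (- v) ^+ l).
  rewrite /u /w mulr_suml; apply: eq_bigr => k _; rewrite mulr_sumr.
  apply: eq_bigr => l _; rewrite !polarE !exprMn exprD; ring.
have iE k l : cintegrable `[- pi, pi] (fun v : R => expi v ^+ k * expi (- v) ^+ l).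
  apply: (@bounded_cintegrable _ _ _ 1) => [|v _].
    apply: cmeasM; apply: cmeasX; apply: (@cmeas_sub _ _ setT) => //.
      exact: cmeas_expi.
    by apply: (@cmeas_comp _ (@expi R) -%R); [exact: oppr_measurable|exact: cmeas_expi].
  by rewrite normcM !normcX !normc_expi !expr1n mulr1.
rewrite (funext expand) cintegral_sum//; last first.
  by move=> k; apply: cintegrable_sum => // l; exact: cintegrableZ.
rewrite mulr_sumr; apply: eq_bigr => k _.
rewrite cintegral_sum//; last by move=> l; exact: cintegrableZ.
rewrite (bigD1 k)//= big1 => [|l lk]; last first.
  rewrite cintegralZ// cintegral_orthogonal.
  by rewrite eq_sym (negbTE (_ : (l : nat) != k))// mulr0.
rewrite cintegralZ// cintegral_orthogonal eqxx addr0 rmorphXn /= mul2n -addnn.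
ring.
Qed.

End pairing.

End derived_series.

(** * The logarithmic weight *)

Section log_weight.
Context (R : realType).
Local Notation C := R[i].
Local Notation mu := (@lebesgue_measure R).

(** s log^+ (sg / s): for sg = 1 it is the weight s log (1/s) of the calculus,
    and for sg < 1 it vanishes near the boundary of the disc. *)
Definition logw (sg s : R) : R := s * Num.max 0 (ln sg - ln s).

Lemma logw_in sg s : 0 < s <= sg -> logw sg s = s * (ln sg - ln s).
Proof.
move=> /andP[s0 ssg]; rewrite /logw max_r// subr_ge0 ler_ln ?posrE//.
exact: lt_le_trans ssg.
Qed.

Lemma logw_out sg s : 0 < sg -> sg <= s -> logw sg s = 0.
Proof.
move=> sg0 sgs; rewrite /logw max_l ?mulr0// subr_le0 ler_ln ?posrE//.
exact: lt_le_trans sgs.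
Qed.

Lemma logw1 s : 0 < s < 1 -> logw 1 s = s * ln s^-1.
Proof. by move=> /andP[s0 s1]; rewrite logw_in ?s0 ?ltW// ln1 sub0r lnV. Qed.

Lemma logw_ge0 sg s : 0 <= s -> 0 <= logw sg s.
Proof. by move=> s0; rewrite mulr_ge0// le_max lexx. Qed.

Lemma logw_mono sg tau s : 0 < sg -> sg <= tau -> 0 <= s -> logw sg s <= logw tau s.
Proof.
move=> sg0 st s0; rewrite ler_wpM2l// ge_max le_max lexx /= le_max lerB ?orbT//.
by rewrite ler_ln ?posrE// (lt_le_trans sg0).
Qed.

Lemma logw1_le s : 0 < s < 1 -> logw 1 s <= 1 - s.
Proof.
move=> s01; have /andP[s0 s1] := s01; rewrite logw1//.
have := @le_ln1Dx R (s^-1 - 1); rewrite [1 + _]addrC subrK => h.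
have sV : -1 < s^-1 - 1 by have : 0 < s^-1 by [rewrite invr_gt0]; lra.
rewrite (le_trans (ler_wpM2l (ltW s0) (h sV)))// mulrBr mulfV ?gt_eqF// mulr1//.
Qed.

Lemma logw_le sg s : 0 < sg <= 1 -> 0 < s < 1 -> logw sg s <= 1 - s.
Proof.
move=> /andP[sg0 sg1] s01; rewrite (le_trans _ (logw1_le s01))// logw_mono//.
by case/andP: s01 => /ltW.
Qed.

Lemma measurable_logw sg : measurable_fun setT (logw sg).
Proof.
apply: measurable_funM; first exact: measurable_id.
apply: measurable_maxr; first exact: measurable_cst.
by apply: measurable_funB; [exact: measurable_cst|exact: measurable_ln].
Qed.

Lemma logw_cvg (tau : nat -> R) s : 0 < s < 1 -> (forall n, 0 < tau n) ->
  tau n @[n --> \oo] --> (1 : R) -> logw (tau n) s @[n --> \oo] --> logw 1 s.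
Proof.
move=> s01 tau0 tau1; apply: cvgMr.
have lt : ln (tau n) @[n --> \oo] --> ln (1 : R).
  by apply: continuous_cvg => //; exact: continuous_ln.
have h : ln (tau n) - ln s @[n --> \oo] --> ln 1 - ln s.
  by apply: cvgB => //; exact: cvg_cst.
apply/cvgrPdist_lt => e e0; have /cvgrPdist_lt/(_ e e0) := h.
apply: filterS => n; apply: le_lt_trans.
have maxE (x : R) : Num.max 0 x = (x + `|x|) / 2.
  have [x0|x0] := leP 0 x; [rewrite ger0_norm//; lra|rewrite ltr0_norm//; lra].
rewrite !maxE -mulrBl normrM (gtr0_norm (_ : 0 < 2^-1 :> R)) ?invr_gt0//.
rewrite ler_pdivrMr// opprD addrACA (le_trans (ler_normD _ _))//.
have := ler_dist_dist (ln 1 - ln s) (ln (tau n) - ln s); lra.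
Qed.

Let L (sg s : R) : R := s * (ln sg - ln s).

Let L0 sg : L sg 0 = 0. Proof. by rewrite /L mul0r. Qed.

(** Since ln x <= x for x = 1 / sqrt s. *)
Lemma sln_le (s : R) : 0 < s <= 1 -> `|s * ln s| <= 2 * Num.sqrt s.
Proof.
move=> /andP[s0 s1]; pose r := Num.sqrt s.
have r0 : 0 < r by rewrite sqrtr_gt0.
have sE : s = r ^+ 2 by rewrite sqr_sqrtr ?ltW.
have := @ln_sublinear R r^-1; rewrite invr_gt0 => /(_ r0); rewrite lnV// => h.
have lnr : ln s = 2 * ln r by rewrite sE lnXn// mulr_natl.
have lns : ln s <= 0 by exact: ln_le0.
rewrite -/r normrM (gtr0_norm s0) ler0_norm// lnr sE.
have : r ^+ 2 * - (2 * ln r) = 2 * r * (r * - ln r) by ring.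
move=> ->; rewrite -[leRHS]mulr1 ler_wpM2l ?mulr_ge0 ?(ltW r0)//.
have := ltW h; rewrite -(ler_pM2l r0) mulfV ?gt_eqF//.
Qed.

Lemma sln_continuous_at0 : (s * ln s : R) @[s --> (0 : R)] --> (0 : R).
Proof.
have sq : (2 * Num.sqrt `|s|) @[s --> (0 : R)] --> (0 : R).
  apply: nullM; rewrite -[X in _ --> X](sqrtr0 R) -[X in Num.sqrt X](normr0 R).
  apply: continuous_cvg; first exact: sqrt_continuous.
  by apply: cvg_norm; exact: cvg_id.
apply/norm_cvg0P; apply: null_le sq => [s|] //.
near=> s; have [s0|s0] := leP s 0.
  by rewrite (ln0 s0) mulr0 normr0 mulr_ge0// sqrtr_ge0.
rewrite (gtr0_norm s0) sln_le// s0 ltW//.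
near: s; exact: lt_nbhsl.
Unshelve. all: by end_near. Qed.

Let L_continuous sg s : 0 <= s -> {for s, continuous (L sg)}.
Proof.
move=> s0; have [->|sn0] := eqVneq s 0.
  suff : L sg x @[x --> 0] --> L sg 0 by [].
  rewrite L0.
  have -> : L sg = (fun x => x * ln sg - x * ln x).
    by apply/funext => x; rewrite /L mulrBr.
  rewrite -[X in _ --> X](subr0 0); apply: cvgB; last exact: sln_continuous_at0.
  by rewrite -[X in _ --> X](mul0r (ln sg)); apply: cvgMl; exact: cvg_id.
have sgt0 : 0 < s by rewrite lt_def sn0.
apply: cvgM; first exact: cvg_id.
by apply: cvgB; [exact: cvg_cst|exact: continuous_ln].
Qed.

Lemma Rintegral_split (a m b : R) (k : R -> R) : a <= m <= b ->
  mu.-integrable `[a, b] (EFin \o k) ->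
  \int[mu]_(t in `[a, b]) k t =
  \int[mu]_(t in `[a, m]) k t + \int[mu]_(t in `[m, b]) k t.
Proof.
move=> amb ik; have ik' : cintegrable `[a, b] (fun t => (k t)%:C).
  by split => //=; exact: integrable0.
exact: (congr1 (@complex.Re R) (cintegral_split amb ik')).
Qed.

Lemma Rintegral_oo_cc (a b : R) (k : R -> R) : mu.-integrable `[a, b] (EFin \o k) ->
  \int[mu]_(t in `]a, b[) k t = \int[mu]_(t in `[a, b]) k t.
Proof.
move=> ik; rewrite -(@Rintegral_itv_obnd_cbnd _ a (BRight b)).
  rewrite -Rintegral_itv_bndo_bndc//; apply: integrableS ik => //.
  by apply: subset_itv; rewrite bnd_simp.
by apply: integrableS ik => //; apply: subset_itv; rewrite bnd_simp.
Qed.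

(** The value sg^(2 n + 2) / (4 (n+1)^2) is exactly what cancels the factor
    (n+1)^2 of [pairing_series]: the weight with parameter sg multiplies the
    n-th Taylor coefficient by sg^(2n). The primitive F is found by
    integrating by parts; it extends continuously to 0. *)
Lemma Rintegral_logw_pow (sg : R) (n : nat) : 0 < sg < 1 ->
  \int[mu]_(s in `]0, 1[) (logw sg s * s ^+ (2 * n)) =
  sg ^+ (2 * n.+1) / (4 * n.+1%:R ^+ 2).
Proof.
move=> /andP[sg0 sg1].
have mf : measurable_fun `[(0 : R), 1] (fun s => logw sg s * s ^+ (2 * n)).
  apply: (@measurable_funS _ _ _ _ setT) => //.
  by apply: measurable_funM; [exact: measurable_logw|exact: exprn_measurable].
have ii : mu.-integrable `[(0 : R), 1] (EFin \o (fun s => logw sg s * s ^+ (2 * n))).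
  apply: (@le_integrable _ _ _ mu _ _ _ (EFin \o (fun=> 1))) => //.
  - exact/measurable_EFinP.
  - move=> s; rewrite /= in_itv /= => /andP[s0 s1]; rewrite lee_fin normr1.
    have wp := logw_ge0 sg s0; have ep := exprn_ge0 (2 * n) s0.
    rewrite (ger0_norm (mulr_ge0 wp ep)).
    have [->|sn0] := eqVneq s 0; first by rewrite /logw !mul0r.
    have [->|sn1] := eqVneq s 1; first by rewrite logw_out ?mul0r// ltW.
    have s01 : 0 < s < 1 by rewrite !lt_def sn0 s0 s1 eq_sym sn1.
    rewrite -[leRHS]mulr1; apply: (ler_pM wp ep); last exact: exprn_ile1.
    rewrite (le_trans (logw_le _ s01)) ?sg0 ?(ltW sg1)//.
    by rewrite gerBl.
  - exact: integrable_cst_itv.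
rewrite Rintegral_oo_cc//.
rewrite (@Rintegral_split 0 sg 1)//; last by rewrite !ltW.
have -> : \int[mu]_(t in `[sg, 1]) (logw sg t * t ^+ (2 * n)) = 0.
  transitivity (\int[mu]_(t in `[sg, 1]) (0 : R)).
    apply: eq_Rintegral => s; rewrite inE /= in_itv /= => /andP[s0 _].
    by rewrite logw_out// mul0r.
  by rewrite Rintegral_itv_cst ?mul0r// ltW.
rewrite addr0.
pose m : R := (2 * n.+1)%:R.
have m0 : m != 0 by rewrite pnatr_eq0.
pose F s := s ^+ (2 * n).+1 * (L sg s / m + s / m ^+ 2).
have -> : \int[mu]_(t in `[0, sg]) (logw sg t * t ^+ (2 * n)) =
    \int[mu]_(t in `[0, sg]) (L sg t * t ^+ (2 * n)).
  apply: eq_Rintegral => s; rewrite inE /= in_itv /= => /andP[s0 s1].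
  have [->|sn0] := eqVneq s 0; first by rewrite /logw /L !mul0r.
  by rewrite logw_in// lt_def sn0 s0.
have Xc k s : {for s, continuous (fun x : R => x ^+ k)} by exact: exprn_continuous.
have Fc s : 0 <= s -> {for s, continuous F}.
  move=> s0; apply: cvgM; first exact: Xc.
  apply: cvgD; first by apply: cvgMl; exact: L_continuous.
  by apply: cvgMl; exact: cvg_id.
have dF (s : R) : 0 < s -> is_derive s (1 : R) F (L sg s * s ^+ (2 * n)).
  move=> s0; have d := is_derive1_ln s0.
  have -> : F = (@id R) ^+ (2 * n).+1 *
      (m^-1 *: ((@id R) * (cst (ln sg) - @ln R)) + (m ^+ 2)^-1 *: (@id R)).
    apply/funext => x; rewrite /F /L !fctE /GRing.scale /=.
    by congr (_ * (_ + _)); rewrite mulrC.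
  apply: is_derive_eq; rewrite /L !fctE /GRing.scale /= exprS.
  have mE : m = (2 * n).+1%:R + 1 by rewrite /m natr1; congr (_%:R); rewrite mulnS.
  have -> : (2 * n).+1%:R = m - 1 by rewrite mE addrK.
  field; apply/andP; split; [by rewrite nat1r pnatr_eq0|by rewrite gt_eqF].
rewrite /Rintegral (@continuous_FTC2 _ (fun s => L sg s * s ^+ (2 * n)) F)//.
- have F0 : F 0 = 0 by rewrite /F expr0n mul0r.
  have Lsg : L sg sg = 0 by rewrite /L subrr mulr0.
  rewrite F0 -EFinB subr0 /= /F Lsg mul0r add0r mulrA -exprSr /m natrM exprMn.
  by congr (_ / (_ * _)); [congr (_ ^+ _); rewrite mulnS|ring].
- apply: continuous_in_subspaceT => s; rewrite inE /= in_itv /= => /andP[s0 _].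
  by apply: cvgM; [exact: L_continuous|exact: Xc].
- split.
  + by move=> s; rewrite in_itv /= => /andP[s0 _]; case: (dF s s0).
  + by apply: cvg_at_right_filter; exact: Fc.
  + by apply: cvg_at_left_filter; apply: Fc; exact: ltW.
- move=> s; rewrite in_itv /= => /andP[s0 _].
  by rewrite derive1E; case: (dF s s0).
Qed.

End log_weight.

(** * Convergence of the cut-off pairings *)

Section cut_off_pairing.
Context (R : realType).
Local Notation C := R[i].
Local Notation mu := (@lebesgue_measure R).
Local Notation I01 := (`]0%R, 1%R[%classic : set R).

Lemma cmeas_real (D : set R) (g : R -> R) : measurable_fun D g ->
  cmeas D (fun s => (g s)%:C).
Proof. by move=> mg; split => //=; exact: measurable_cst. Qed.

Lemma cintegral_real (D : set R) (g : R -> R) :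
  cintegral D (fun s => (g s)%:C) = (\int[mu]_(s in D) g s)%:C.
Proof. by rewrite /cintegral /= [X in _ +i* X](_ : _ = 0)// /Rintegral integral0. Qed.

Variables (a : nat -> C) (fd : C -> C) (h : R -> R).
Hypothesis aK : forall r, 0 < r < 1 -> exists K, forall n, normc (a n) * r ^+ n <= K.
Hypothesis fdE : forall z, normc z < 1 ->
  normc (\sum_(k < n) k.+1%:R * a k.+1 * z ^+ k - fd z) @[n --> \oo] --> (0 : R).
Hypothesis h_int : mu.-integrable I01 (EFin \o h).
Hypothesis h_ge0 : forall s, 0 < s < 1 -> 0 <= h s.
Hypothesis fd_le : forall s v, 0 < s < 1 -> normc (fd (polar s v)) <= 2 * h s.

(** This measures the loss caused by replacing the weight logw 1 by logw tau;
    it depends on f only, through the majorant h, and neither on the operator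
    nor on the vectors x and xs. *)
Definition log_defect (tau : R) : R :=
  \int[mu]_(s in I01) ((logw 1 s - logw tau s) / (1 - s) * h s).

Let defect_itv (tau s : R) : 0 < tau < 1 -> 0 < s < 1 ->
  0 <= (logw 1 s - logw tau s) / (1 - s) <= 1.
Proof.
move=> /andP[t0 t1] s01; have /andP[s0 s1] := s01.
have d0 : 0 < 1 - s by rewrite subr_gt0.
rewrite ler_pdivlMr// mul0r ler_pdivrMr// mul1r subr_ge0 logw_mono ?(ltW t1) ?(ltW s0)//=.
by rewrite (le_trans _ (logw1_le s01))// gerBl logw_ge0 ?(ltW s0).
Qed.

Let meas_h : measurable_fun I01 h.
Proof. by case/integrableP: h_int => /measurable_EFinP. Qed.

Let meas_defect (tau : R) : measurable_fun I01 (fun s => (logw 1 s - logw tau s) / (1 - s)).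
Proof.
have mD : measurable_fun I01 (fun s => logw 1 s - logw tau s).
  by apply: measurable_funB; apply: (@measurable_funS _ _ _ _ setT) => //; exact: measurable_logw.
apply: measurable_funM => //.
apply: (@eq_measurable_fun _ _ _ _ I01 (fun s => (1 - s) `^ (-1))).
  by move=> s; rewrite inE /= in_itv /= => /andP[_ s1]; rewrite powR_inv1// subr_ge0 ltW.
apply: (@measurable_funS _ _ _ _ setT) => //.
apply: (measurableT_comp (measurable_powR (-1))).
by apply: measurable_funB; [exact: measurable_cst|exact: measurable_id].
Qed.

(** The quotient lies between 0 and 1 because logw 1 s <= 1 - s, so that h
    dominates and the limit can be taken under the integral. *)
Lemma log_defect_cvg (tau : nat -> R) : (forall n, 0 < tau n < 1) ->
  tau n @[n --> \oo] --> (1 : R) -> log_defect (tau n) @[n --> \oo] --> (0 : R).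
Proof.
move=> t01 tT.
have [|||||_ cc] := @cintegral_dominated R I01
  (fun n s => ((logw 1 s - logw (tau n) s) / (1 - s) * h s)%:C) (fun=> 0) h.
- by [].
- by move=> n; apply: cmeas_real; apply: measurable_funM.
- exact: h_int.
- move=> n s; rewrite /= in_itv /= => s01; have /andP[d0 d1] := defect_itv (t01 n) s01.
  by rewrite normcR (ger0_norm (mulr_ge0 d0 (h_ge0 s01))) ler_piMl ?h_ge0.
- move=> s; rewrite /= in_itv /= => s01.
  have tau0 n : 0 < tau n by case/andP: (t01 n).
  have := logw_cvg s01 tau0 tT => /cvg_dist0.
  move=> /(nullM (`|h s| / `|1 - s|)); apply: null_eq => n.
  by rewrite subr0 normcR !normrM normfV [`|logw (tau n) s - _|]distrC; ring.
move: cc; rewrite cintegral0 => cc.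
apply/norm_cvg0P; apply: null_leS cc => n //=.
by rewrite subr0 cintegral_real normcR.
Qed.

Variables (t : nat -> C) (gd : C -> C) (Kt Cg : R).
Hypothesis tK : forall n, normc (t n) <= Kt.
Hypothesis gdE : forall z, normc z < 1 ->
  normc (\sum_(k < n) k.+1%:R * t k.+1 * z ^+ k - gd z) @[n --> \oo] --> (0 : R).
Hypothesis gd_int : forall s, 0 < s < 1 ->
  \int[mu]_(v in `[- pi, pi]) normc (gd (polar s v)) <= Cg / (1 - s).

Let Kt0 : 0 <= Kt. Proof. by rewrite (le_trans _ (tK 0%N))// normc_ge0. Qed.

Let gd_series : has_power_series gd (fun k => k.+1%:R * t k.+1).
Proof.
split => // r /andP[r0 r1]; exists (Kt * (1 - r)^-1) => n.
rewrite normcM nat_normc mulrAC [leRHS]mulrC ler_pM ?normc_ge0//.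
  by rewrite mulr_ge0// exprn_ge0// ltW.
by apply: natmul_geometric_le; rewrite ltW.
Qed.

Let gd_continuous (s : R) : 0 < s < 1 ->
  continuous (fun v : R => normc (gd (polar s v))).
Proof.
move=> /andP[s0 s1] v.
have p1 : normc (polar s v) < 1 by rewrite normc_polar gtr0_norm.
have [D /cderiv_ccont gc _] := series_derivative gd_series p1.
have : normc (gd (polar s w) - gd (polar s v)) @[w --> v] --> (0 : R).
  apply: ccont_comp gc _.
  apply: (null_le _ _ (nullM s (expi_continuous v))) => [w|]; first exact: normc_ge0.
  by near=> w; rewrite !polarE -mulrBr normcM normcR gtr0_norm.
move=> /cvgrPdist_lt gl; apply/cvgrPdist_lt => e e0.
have := gl e e0; apply: filterS => w; rewrite sub0r normrN ger0_norm ?normc_ge0//.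
apply: le_lt_trans; rewrite ler_norml; apply/andP; split.
  by rewrite lerNl opprB lerBlDr (le_trans _ (normcD _ _))// subrK.
by rewrite lerBlDr normc_distC (le_trans _ (normcD _ _))// subrK.
Unshelve. all: by end_near. Qed.

Let gd_int_refl (s : R) : 0 < s < 1 ->
  mu.-integrable `[- pi, pi] (EFin \o (fun v => normc (gd (polar s (- v))))) /\
  \int[mu]_(v in `[- pi, pi]) normc (gd (polar s (- v))) <= Cg / (1 - s).
Proof.
move=> s01; have gc := gd_continuous s01; split.
  apply: continuous_compact_integrable; first exact: segment_compact.
  apply: continuous_subspaceT => v.
  apply: (@continuous_comp _ _ _ -%R (fun v => normc (gd (polar s v)))).
    exact: opp_continuous.
  exact: gc.
have := @integration_by_substitution_oppr R (fun v => normc (gd (polar s v))) (- pi) pi (pi_itv R).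
rewrite opprK => sub; apply: le_trans (gd_int s01).
rewrite le_eqVlt; apply/orP; left; apply/eqP.
by rewrite /Rintegral sub//; exact: continuous_subspaceT.
Qed.

Local Notation pr := (pairing fd gd).

(** The radial supremum of f' and the L1 bound on the circle for gd are
    multiplied: this is where the two hypotheses, on f and on T, meet. *)
Lemma pairing_le (s : R) : 0 < s < 1 -> normc (pr s) <= 4 * Cg * (h s / (1 - s)).
Proof.
move=> s01; have [ig le_g] := gd_int_refl s01.
have [ip _] := pairing_series aK tK fdE gdE s01.
have := @normc_cintegral_le R `[- pi, pi] _
  (fun v => 2 * h s * normc (gd (polar s (- v)))) _ ip _ _.
rewrite RintegralZl// => H.
rewrite (le_trans (H _ _ _))//.
- have := integrableZl _ (2 * h s) ig; apply => //.
- by move=> v _; rewrite normcM ler_wpM2r ?normc_ge0// fd_le.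
- have h2 : 0 <= 2 * h s by rewrite mulr_ge0// h_ge0.
  have := ler_wpM2l h2 le_g.
  have -> : 4 * Cg * (h s / (1 - s)) = 2 * (2 * h s * (Cg / (1 - s))) by ring.
  by move=> H2; rewrite ler_wpM2l.
Qed.

Let cmeas_pr : cmeas I01 pr.
Proof.
apply: (@cmeas_cvg _ _ (fun n s => (2 * pi)%:C *
    (\sum_(k < n) k.+1%:R ^+ 2 * (a k.+1 * t k.+1) * (s ^+ (2 * k))%:C))).
  move=> n; apply: cmeasM; first exact: cmeas_cst.
  apply: cmeas_sum => k; apply: cmeasM; first exact: cmeas_cst.
  by apply: cmeas_real; apply: (@measurable_funS _ _ _ _ setT) => //; exact: exprn_measurable.
by move=> s; rewrite /= in_itv /= => s01; have [] := pairing_series aK tK fdE gdE s01.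
Qed.

Let Cg0 : 0 <= Cg.
Proof.
have h2 : 0 < (2^-1 : R) < 1 by rewrite invr_gt0 ltr0n invf_lt1// ltr1n.
have := gd_int h2.
have : 0 <= \int[mu]_(v in `[- pi, pi]) normc (gd (polar 2^-1 v)).
  by apply: Rintegral_ge0 => v _; exact: normc_ge0.
have -> : (1 - 2^-1 : R) = 2^-1 by field.
rewrite invrK; lra.
Qed.

Let int_weighted (tau : R) : 0 < tau <= 1 ->
  cintegrable I01 (fun s => (logw tau s)%:C * pr s).
Proof.
move=> tau01.
have ih : mu.-integrable I01 (EFin \o (fun s => 4 * Cg * h s)).
  by have := integrableZl _ (4 * Cg) h_int; apply.
apply: le_cintegrable ih => //.
  apply: cmeasM => //; apply: cmeas_real.
  by apply: (@measurable_funS _ _ _ _ setT) => //; exact: measurable_logw.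
move=> s; rewrite /= in_itv /= => s01; have /andP[s0 s1] := s01.
have d0 : 0 < 1 - s by rewrite subr_gt0.
rewrite normcM normcR ger0_norm ?logw_ge0 ?(ltW s0)//.
rewrite (le_trans (ler_pM _ _ (logw_le tau01 s01) (pairing_le s01)))//.
- by rewrite logw_ge0 ?(ltW s0).
- exact: normc_ge0.
- by rewrite le_eqVlt; apply/orP; left; apply/eqP; field; rewrite gt_eqF.
Qed.

(** With the cut-off weight the series of [pairing_series] converges uniformly
    on [0, tau], so that it may be integrated term by term. *)
Lemma weighted_pairing (tau : R) : 0 < tau < 1 ->
  normc (\sum_(k < n) a k.+1 * t k.+1 * (tau ^+ (2 * k.+1))%:C -
    (2 / pi)%:C * cintegral I01 (fun s => (logw tau s)%:C * pr s)) @[n --> \oo] --> (0 : R).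
Proof.
move=> tau01; have [tau0 tau1] := andP tau01.
have [K [q [K0 q01 HK]]] := deriv_coeff_geometric aK tau01.
have [q0 q1] := andP q01; have q01' : 0 <= q < 1 by rewrite ltW.
pose S n (s : R) := \sum_(k < n) k.+1%:R ^+ 2 * (a k.+1 * t k.+1) * (s ^+ (2 * k))%:C.
have pi0 := pi_gt0 R.
pose B := 2 * pi * (Kt * (K / (1 - q))).
have B0 : 0 <= B.
  have p1 : 0 <= K / (1 - q) by apply: divr_ge0 => //; rewrite subr_ge0 ltW.
  by apply: mulr_ge0; [rewrite mulr_ge0// ltW|exact: mulr_ge0].
have SB n s : 0 <= s <= tau -> normc (S n s) <= Kt * (K / (1 - q)).
  move=> /andP[s0 st]; rewrite (le_trans (normc_sum _ _ _))//.
  rewrite mulrA (le_trans _ (ler_wpM2l _ (sum_geometric_le n q01')))//; last exact: mulr_ge0.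
  rewrite mulr_sumr; apply: ler_sum => k _.
  rewrite normcM normcR ger0_norm ?exprn_ge0//.
  rewrite normcM normcX nat_normc normcM.
  have h1 : s ^+ (2 * k) <= tau ^+ k.
    have s1 : s <= 1 by rewrite (le_trans st)// ltW.
    rewrite (le_trans (_ : _ <= s ^+ k))//; last by rewrite lerXn2r ?nnegrE// ltW.
    by rewrite ler_wiXn2l// mul2n -addnn leq_addr.
  have h2 := HK k.
  have h3 : k.+1%:R ^+ 2 * normc (a k.+1) * s ^+ (2 * k) <= K * q ^+ k.
    by rewrite (le_trans _ h2)// ler_wpM2l// mulr_ge0 ?sqr_ge0 ?normc_ge0.
  rewrite -[leRHS]mulrA.
  have -> : k.+1%:R ^+ 2 * (normc (a k.+1) * normc (t k.+1)) * s ^+ (2 * k) =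
    normc (t k.+1) * (k.+1%:R ^+ 2 * normc (a k.+1) * s ^+ (2 * k)) by ring.
  apply: (ler_pM (normc_ge0 _) _ (tK _) h3).
  by rewrite mulr_ge0 ?exprn_ge0// mulr_ge0 ?sqr_ge0 ?normc_ge0.
have [|||||_ cc] := @cintegral_dominated R I01
  (fun n s => (logw tau s)%:C * ((2 * pi)%:C * S n s))
  (fun s => (logw tau s)%:C * pr s) (fun=> B).
- by [].
- move=> n; apply: cmeasM.
    by apply: cmeas_real; apply: (@measurable_funS _ _ _ _ setT) => //; exact: measurable_logw.
  apply: cmeasM; first exact: cmeas_cst.
  apply: cmeas_sum => k; apply: cmeasM; first exact: cmeas_cst.
  by apply: cmeas_real; apply: (@measurable_funS _ _ _ _ setT) => //; exact: exprn_measurable.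
- exact: integrable_cst_itv.
- move=> n s; rewrite /= in_itv /= => s01; have /andP[s0 s1] := s01.
  have [ts|st] := leP tau s; first by rewrite logw_out// rmorph0 mul0r normc0.
  rewrite normcM normcR ger0_norm ?logw_ge0 ?(ltW s0)// -[B]mul1r.
  apply: ler_pM; rewrite ?normc_ge0 ?logw_ge0 ?(ltW s0)//.
    rewrite (le_trans (logw_le _ s01)) ?tau0 ?(ltW tau1)//.
    by rewrite gerBl ltW.
  rewrite normcM normcR ger0_norm ?mulr_ge0 ?(ltW pi0)// ler_wpM2l ?mulr_ge0 ?(ltW pi0)//.
  by apply: SB; rewrite !ltW.
- move=> s; rewrite /= in_itv /= => s01.
  have [_ /(nullM (normc (logw tau s)%:C))] := pairing_series aK tK fdE gdE s01.
  by apply: null_eq => n; rewrite -normcM mulrBr.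
apply: (null_eq _ (nullM (normc (2 / pi)%:C) cc)) => n; rewrite -normcM mulrBr.
congr (normc (_ - _)).
have ek k : cintegrable I01 (fun s => (logw tau s * s ^+ (2 * k))%:C : C).
  apply: (@bounded_cintegrable _ _ _ 1).
    apply: cmeas_real; apply: (@measurable_funS _ _ _ _ setT) => //.
    by apply: measurable_funM; [exact: measurable_logw|exact: exprn_measurable].
  move=> s /andP[s0 s1].
  have [s0'|sn0] := eqVneq s 0.
    by rewrite s0' /logw !mul0r rmorph0 normc0.
  have [s1'|sn1] := eqVneq s 1.
    by rewrite s1' logw_out ?mul0r ?rmorph0 ?normc0// ltW.
  have s01 : 0 < s < 1 by rewrite !lt_def sn0 s0 s1 eq_sym sn1.
  have wp := logw_ge0 tau s0; have ep := exprn_ge0 (2 * k) s0.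
  rewrite normcR (ger0_norm (mulr_ge0 wp ep)) -[leRHS]mulr1.
  apply: (ler_pM wp ep); last exact: exprn_ile1.
  by rewrite (le_trans (logw_le _ s01)) ?tau0 ?(ltW tau1)// gerBl.
transitivity ((2 / pi)%:C * cintegral I01 (fun s => \sum_(k < n)
   ((2 * pi)%:C * (k.+1%:R ^+ 2 * (a k.+1 * t k.+1))) * (logw tau s * s ^+ (2 * k))%:C)).
  congr (_ * _); apply: eq_cintegral => s _; rewrite /S !mulr_sumr.
  by apply: eq_bigr => k _; rewrite [(logw tau s * _)%:C]rmorphM /=; ring.
rewrite cintegral_sum//; last by move=> k; exact: cintegrableZ.
rewrite mulr_sumr; apply: eq_bigr => k _.
rewrite cintegralZ// cintegral_real Rintegral_logw_pow//.
have n0 : k.+1%:R != 0 :> R by rewrite pnatr_eq0.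
have -> : k.+1%:R ^+ 2 = (k.+1%:R ^+ 2)%:C :> C by rewrite rmorphXn /= rmorph_nat.
move: (tau ^+ (2 * k.+1)) (a k.+1 * t k.+1) => T A.
move: (k.+1%:R : R) n0 => N n0.
transitivity ((2 / pi * (2 * pi) * N ^+ 2 * (T / (4 * N ^+ 2)))%:C * A).
  by rewrite !rmorphM /=; ring.
have -> : 2 / pi * (2 * pi) * N ^+ 2 * (T / (4 * N ^+ 2)) = T.
  have pn : pi != 0 :> R by rewrite gt_eqF.
  by move: (pi : R) pn => P pn; field; rewrite n0 pn.
by rewrite mulrC.
Qed.

Lemma pairing_defect (tau : R) : 0 < tau < 1 ->
  normc ((2 / pi)%:C * cintegral I01 (fun s => (s * ln s^-1)%:C * pr s) -
    (2 / pi)%:C * cintegral I01 (fun s => (logw tau s)%:C * pr s)) <=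
  16 / pi * Cg * log_defect tau.
Proof.
move=> tau01; have [tau0 tau1] := andP tau01.
have i1 : cintegrable I01 (fun s => (logw 1 s)%:C * pr s).
  by apply: int_weighted; rewrite ltr01 lexx.
have i2 : cintegrable I01 (fun s => (logw tau s)%:C * pr s).
  by apply: int_weighted; rewrite tau0 ltW.
have -> : cintegral I01 (fun s => (s * ln s^-1)%:C * pr s) =
    cintegral I01 (fun s => (logw 1 s)%:C * pr s).
  by apply: eq_cintegral => s; rewrite /= in_itv /= => s01; rewrite logw1.
rewrite -mulrBr -cintegralB// normcM normcR.
have pi0 := pi_gt0 R.
rewrite gtr0_norm ?divr_gt0//.
have id : mu.-integrable I01 (EFin \o (fun s => (logw 1 s - logw tau s) / (1 - s) * h s)).
  apply: (@le_integrable _ _ _ mu _ _ _ (EFin \o h)) => //.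
    apply/measurable_EFinP; apply: measurable_funM; [exact: meas_defect|exact: meas_h].
  move=> s; rewrite /= in_itv /= => s01; have /andP[d0 d1] := defect_itv tau01 s01.
  rewrite lee_fin (ger0_norm (mulr_ge0 d0 (h_ge0 s01))) ger0_norm ?h_ge0//.
  by rewrite ler_piMl ?h_ge0.
have := @normc_cintegral_le R I01 (fun s => (logw 1 s)%:C * pr s - (logw tau s)%:C * pr s)
  (fun s => 4 * Cg * ((logw 1 s - logw tau s) / (1 - s) * h s)) _ _ _ _.
rewrite RintegralZl// => H.
rewrite -/(log_defect tau) in H.
have {}H : normc (cintegral I01 (fun s => (logw 1 s)%:C * pr s - (logw tau s)%:C * pr s)) <=
    2 * (4 * Cg * log_defect tau).
  apply: H => //.
  - exact: cintegrableB.
  - by have := integrableZl _ (4 * Cg) id; apply.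
  - move=> s; rewrite /= in_itv /= => s01; have /andP[s0 s1] := s01.
    rewrite -mulrBl -rmorphB normcM normcR ger0_norm ?subr_ge0; last first.
      by rewrite logw_mono// ltW.
    have := ler_wpM2l (_ : 0 <= logw 1 s - logw tau s) (pairing_le s01).
    rewrite subr_ge0 logw_mono ?(ltW s0) ?(ltW tau1)// => /(_ isT) /le_trans; apply.
    by rewrite le_eqVlt; apply/orP; left; apply/eqP; ring.
have p2 : 0 <= 2 / pi :> R by rewrite divr_ge0// ltW.
rewrite (le_trans (ler_wpM2l p2 H))// le_eqVlt; apply/orP; left; apply/eqP; ring.
Qed.

End cut_off_pairing.

(** * A measurable majorant of the derivative *)

Section nonmeasurable_monotony.
Context d (T : measurableType d) (R : realType).
Variable nu : {measure set T -> \bar R}.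
Local Open Scope ereal_scope.

(** The supremum over the angle in the definition of the seminorm is not known
    to be measurable. The integral of a nonnegative function is a supremum
    over simple functions, so it is monotone in any case. *)
Lemma le_integral_any (D : set T) (f1 f2 : T -> \bar R) :
  (forall x, D x -> 0 <= f1 x) -> (forall x, D x -> f1 x <= f2 x) ->
  \int[nu]_(x in D) f1 x <= \int[nu]_(x in D) f2 x.
Proof.
move=> f10 f12; rewrite !ge0_integralE//; last by move=> x Dx; rewrite (le_trans (f10 _ Dx)) ?f12.
apply: le_ereal_sup => _ [h hf <-]; exists h => // x.
by rewrite (le_trans (hf x))//; apply: lee_restrict.
Qed.

End nonmeasurable_monotony.

Section dominator.
Context (R : realType).
Local Notation C := R[i].
Local Notation mu := (@lebesgue_measure R).
Local Notation I01 := (`]0%R, 1%R[%classic : set R).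

Lemma derived_power_series (f fd : C -> C) (a : nat -> C) : has_power_series f a ->
  (forall z, normc z < 1 -> cderiv f z (fd z)) ->
  has_power_series fd (fun k => k.+1%:R * a k.+1).
Proof.
move=> fa fdE; split=> [r r01|z z1].
  have [K [q [K0 /andP[q0 q1] HK]]] := deriv_coeff_geometric fa.1 r01.
  exists K => n; rewrite normcM nat_normc (le_trans _ (le_trans (HK n) _))//.
    have [r0 _] := andP r01.
    by rewrite !ler_wpM2r ?exprn_ge0 ?normc_ge0 ?(ltW r0)// expr2 ler_peMl// ler1n.
  by rewrite ler_piMr// exprn_ile1 ?ltW.
have [D HD] := series_derivative fa z1.
by rewrite (cderiv_unique (fdE z z1) HD).
Qed.

Variable fd : C -> C.
Variable b : nat -> C.
Hypothesis fdb : has_power_series fd b.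

Let qk (k : nat) : R := ratr (odflt 0 (unpickle k)).
Let hq (k : nat) (s : R) : R :=
  (`|complex.Re (fd (polar s (qk k)))| + `|complex.Im (fd (polar s (qk k)))|) / 2.

(** The supremum of (|Re| + |Im|) / 2 over the rational angles is measurable,
    as a countable supremum. It lies below the supremum of the modulus, hence
    it is integrable, and twice its value bounds the modulus at all angles, by
    density. *)
Definition ray_sup (s : R) : R := sups (hq ^~ s) 0.

Let fd_cont z : normc z < 1 -> ccont fd z.
Proof. by move=> z1; have [D /cderiv_ccont] := series_derivative fdb z1. Qed.

Let hq_le k s : hq k s <= normc (fd (polar s (qk k))).
Proof.
rewrite /hq; have := Re_le_normc (fd (polar s (qk k))).
have := Im_le_normc (fd (polar s (qk k))); lra.
Qed.

Let hq_ubound s : 0 < s < 1 -> has_ubound (range (hq ^~ s)).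
Proof.
move=> /andP[s0 s1]; have [M M0 HM] := ccont_bounded s1 fd_cont.
exists M => _ [k _ <-]; rewrite (le_trans (hq_le _ _))// HM// normc_polar.
by rewrite gtr0_norm.
Qed.

Let sdrop0 (u : nat -> R) : sdrop u 0 = range u.
Proof. by apply/seteqP; split=> _ [k _ <-]; exists k. Qed.

Let hq_sup s k : 0 < s < 1 -> hq k s <= ray_sup s.
Proof.
move=> s01; rewrite /ray_sup /sups /= sdrop0; apply: ub_le_sup; first exact: hq_ubound.
by exists k.
Qed.

Lemma ray_sup_ge0 s : 0 < s < 1 -> 0 <= ray_sup s.
Proof. by move=> s01; rewrite (le_trans _ (hq_sup 0 s01))// divr_ge0// addr_ge0. Qed.

Lemma measurable_ray_sup : measurable_fun I01 ray_sup.
Proof.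
apply: measurable_fun_sups; first by move=> s; rewrite /= in_itv /=; exact: hq_ubound.
move=> k.
have [mRe mIm] : cmeas I01 (fun s => fd (polar s (qk k))).
  apply: (@cmeas_cvg _ _ (fun n s => \sum_(j < n) b j * polar s (qk k) ^+ j)).
    move=> n; apply: cmeas_sum => j; apply: cmeasM; first exact: cmeas_cst.
    apply: cmeasX; rewrite (_ : (fun s : R => polar s (qk k)) = (fun s : R => s%:C * expi (qk k))).
      apply: cmeasM; last exact: cmeas_cst.
      by apply: cmeas_real; exact: measurable_id.
    by apply/funext => s; exact: polarE.
  move=> s; rewrite /= in_itv /= => /andP[s0 s1]; apply: fdb.2.
  by rewrite normc_polar gtr0_norm.
apply: measurable_funM; last exact: measurable_cst.
apply: measurable_funD.
  exact: (measurableT_comp (@normr_measurable R setT) mRe).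
exact: (measurableT_comp (@normr_measurable R setT) mIm).
Qed.

Lemma fd_le_ray_sup s v : 0 < s < 1 -> normc (fd (polar s v)) <= 2 * ray_sup s.
Proof.
move=> s01; have [s0 s1] := andP s01; apply/ler_addgt0Pr => e e0.
have pv : normc (polar s v) < 1 by rewrite normc_polar gtr0_norm.
have : normc (fd (polar s w) - fd (polar s v)) @[w --> v] --> (0 : R).
  apply: ccont_comp (fd_cont pv) _.
  apply: (null_le _ _ (nullM s (expi_continuous v))) => [w|]; first exact: normc_ge0.
  by near=> w; rewrite !polarE -mulrBr normcM normcR gtr0_norm.
move=> /cvgrPdist_lt/(_ e e0)/nbhs_ballP[d /= d0 Hd].
have [|q] := @rat_in_itvoo R (v - d) (v + d).
  by rewrite ltrBlDr -addrA ltrDl addr_gt0.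
rewrite in_itv /= => /andP[q1 q2].
have := Hd (ratr q); rewrite /ball /= ltr_norml => /(_ _)/wrap[].
  by apply/andP; split; lra.
rewrite sub0r normrN ger0_norm ?normc_ge0// => He.
have : hq (pickle q) s <= ray_sup s by exact: hq_sup.
rewrite /hq /qk pickleK /= => Hh.
have n1 := normc_le_ReIm (fd (polar s (ratr q))).
have n2 := normc_distD (fd (polar s (ratr q))) (fd (polar s v)) 0.
rewrite !subr0 normc_distC in n2; lra.
Unshelve. all: by end_near. Qed.

Lemma ray_sup_le s : 0 < s < 1 -> ((ray_sup s)%:E <=
  ereal_sup [set (normc (fd (polar s t)))%:E | t in `[(- pi)%R, pi%R]])%E.
Proof.
move=> s01; have [s0 s1] := andP s01.
set E := ereal_sup _.
have HE k : ((hq k s)%:E <= E)%E.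
  have [t tpi tE] := polar_exists (polar s (qk k)).
  rewrite (@le_trans _ _ (normc (fd (polar s (qk k))))%:E) ?lee_fin ?hq_le//.
  apply: ereal_sup_ubound; exists t => //; rewrite tE normc_polar gtr0_norm//.
case: E HE => [E HE| |HE]; last by have := HE 0%N.
  rewrite lee_fin /ray_sup /sups /= sdrop0; apply: ge_sup; first by exists (hq 0 s); exists 0%N.
  by move=> _ [k _ <-]; have := HE k; rewrite lee_fin.
by rewrite leey.
Qed.

Lemma ray_sup_integrable :
  (\int[mu]_(s in I01) ereal_sup [set (normc (fd (polar s t)))%:E | t in `[(- pi)%R, pi%R]]
    < +oo)%E -> mu.-integrable I01 (EFin \o ray_sup).
Proof.
move=> fin; apply/integrableP; split; first by apply/measurable_EFinP; exact: measurable_ray_sup.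
apply: le_lt_trans fin; apply: le_integral_any => // s; rewrite /= in_itv /= => s01.
by rewrite ger0_norm ?ray_sup_ge0// ray_sup_le.
Qed.

End dominator.

(** * The Poisson kernel and the approximating polynomials *)

Section scalar_kernel.
Context (R : realType).
Local Notation C := R[i].
Local Notation mu := (@lebesgue_measure R).
Local Notation I01 := (`]0%R, 1%R[%classic : set R).

Lemma null_shift N (u : nat -> R) : u n @[n --> \oo] --> (0 : R) ->
  u (n + N)%N @[n --> \oo] --> (0 : R).
Proof. by rewrite (cvg_shiftn N u). Qed.

Lemma natmul_geometric_null (q : R) : 0 <= q < 1 ->
  (n.+1%:R * q ^+ n) @[n --> \oo] --> (0 : R).
Proof.
move=> /andP[q0 q1]; set p := Num.sqrt q.
have p0 : 0 <= p by exact: sqrtr_ge0.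
have p1 : p < 1 by rewrite -sqrtr1 ltr_sqrt.
have pq n : q ^+ n = p ^+ n * p ^+ n by rewrite -exprMn -expr2 sqr_sqrtr.
have p01 : 0 <= p < 1 by rewrite p0.
have n1 : `|p| < 1 by rewrite ger0_norm.
apply: null_leS (nullM ((1 - p)^-1) (cvg_expr n1)) => n.
  by rewrite mulr_ge0// exprn_ge0.
by rewrite pq mulrA ler_wpM2r ?exprn_ge0// natmul_geometric_le.
Qed.

Lemma geometric_series (u : C) : normc u < 1 ->
  normc (\sum_(k < n) u ^+ k - (1 - u)^-1) @[n --> \oo] --> (0 : R).
Proof.
move=> u1; have u0 : 1 - u != 0.
  by rewrite subr_eq0; apply: contraTneq u1 => <-; rewrite normc1 ltxx.
have n1 : 0 <= normc u < 1 by rewrite normc_ge0.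
apply: (null_eq _ (cvg_geometric_null (normc (1 - u)^-1) n1)) => n.
rewrite -normcX -normcM -[RHS]normcN; congr normc.
apply: (mulfI u0); rewrite mulVKf// mulrN mulrBr mulfV//.
by rewrite -[1 - u in RHS]opprB mulNr -subrX1; ring.
Qed.

Lemma deriv_geometric_sum (A : comNzRingType) (u : A) n :
  (1 - u) ^+ 2 * \sum_(k < n) k.+1%:R * u ^+ k = 1 - n.+1%:R * u ^+ n + n%:R * u ^+ n.+1.
Proof.
elim: n => [|n IH]; first by rewrite big_ord0 expr0; ring.
by rewrite big_ord_recr /= mulrDr IH -!natr1 !exprS; ring.
Qed.

Lemma deriv_geometric_series (u : C) : normc u < 1 ->
  normc (\sum_(k < n) k.+1%:R * u ^+ k - (1 - u)^-1 ^+ 2) @[n --> \oo] --> (0 : R).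
Proof.
move=> u1; have u0 : 1 - u != 0.
  by rewrite subr_eq0; apply: contraTneq u1 => <-; rewrite normc1 ltxx.
have u01 : 0 <= normc u < 1 by rewrite normc_ge0.
have uu0 : (1 - u) ^+ 2 != 0 by rewrite expf_neq0.
apply: (null_leS _ _ (nullM (2 * normc ((1 - u) ^+ 2)^-1) (natmul_geometric_null u01))) => n.
  exact: normc_ge0.
have -> : \sum_(k < n) k.+1%:R * u ^+ k - (1 - u)^-1 ^+ 2 =
    ((1 - u) ^+ 2)^-1 * (n%:R * u ^+ n.+1 - n.+1%:R * u ^+ n).
  apply: (mulfI uu0); rewrite mulrBr deriv_geometric_sum mulVKf// exprVn mulfV//; ring.
rewrite normcM [leRHS]mulrAC [leRHS]mulrC ler_wpM2l ?normc_ge0//.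
rewrite (le_trans (normcB _ _))// !normcM !nat_normc !normcX.
have x0 : 0 <= normc u ^+ n by rewrite exprn_ge0 ?normc_ge0.
have h1 : n%:R * normc u ^+ n.+1 <= n.+1%:R * normc u ^+ n.
  apply: ler_pM; rewrite ?exprn_ge0 ?normc_ge0 ?ler_nat//.
  by rewrite exprS ler_piMl// ltW.
by move: (n%:R * normc u ^+ n.+1) (n.+1%:R * normc u ^+ n) h1 => A B; lra.
Qed.

Lemma mul_conjc_normc (z : C) : z * conjc z = (normc z ^+ 2)%:C.
Proof.
case: z => x y; rewrite /normc sqr_sqrtr ?addr_ge0 ?sqr_ge0//.
by rewrite [LHS]/GRing.mul /=; apply/eqP; rewrite eq_complex /=; apply/andP; split; apply/eqP; ring.
Qed.

Lemma normc_conjc (z : C) : normc (conjc z) = normc z.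
Proof. by case: z => x y; rewrite /normc /= sqrrN. Qed.

(** By the Parseval formula of [pairing_series], with fd w = 1 / (1 - z w) and
    gd w = 1 / (1 - conjc z * w), the integral of |1 - z s e^iv|^-2 is 2 pi
    times the sum of |z s|^(2k). *)
Lemma poisson_bound (z : C) (s : R) : normc z <= 1 -> 0 < s < 1 ->
  \int[mu]_(v in `[- pi, pi]) normc (z * (1 - z * polar s v)^-1 ^+ 2) <= 2 * pi / (1 - s).
Proof.
move=> z1 s01; have [s0 s1] := andP s01.
have zw (x w : C) : normc x <= 1 -> normc w < 1 -> normc (x * w) < 1.
  by move=> x1; rewrite normcM; apply: le_lt_trans; rewrite ler_piMl ?normc_ge0.
(* coefficients whose derived series is the geometric one *)
pose c (x : C) (k : nat) : C := x ^+ k.-1 / k%:R.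
have cE (x w : C) k : k.+1%:R * c x k.+1 * w ^+ k = (x * w) ^+ k.
  rewrite /c [k.+1%:R * _]mulrC divfK ?pnatr_eq0//; by rewrite exprMn.
have c1 x k : normc x <= 1 -> normc (c x k) <= 1.
  move=> x1; rewrite /c normcM normcV nat_normc normcX -[leRHS]mulr1.
  apply: ler_pM; rewrite ?exprn_ge0 ?normc_ge0 ?invr_ge0// ?exprn_ile1 ?normc_ge0//.
  case: k => [|k]; first by rewrite invr0.
  by rewrite invf_le1 ?ltr0n// ler1n.
have gE (x w : C) : normc x <= 1 -> normc w < 1 ->
    normc (\sum_(k < n) k.+1%:R * c x k.+1 * w ^+ k - (1 - x * w)^-1) @[n --> \oo] --> (0 : R).
  move=> x1 w1; apply: null_eq (geometric_series (zw _ _ x1 w1)) => n.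
  by congr (normc (_ - _)); apply: eq_bigr => k _; rewrite cE.
have z1' : normc (conjc z) <= 1 by rewrite normc_conjc.
have [|||| ip cc] := @pairing_series R (c z) (c (conjc z)) (fun w => (1 - z * w)^-1)
  (fun w => (1 - conjc z * w)^-1) 1 _ _ _ _ s s01.
- by move=> r /andP[r0 r1]; exists 1 => n; rewrite mulr_ile1 ?normc_ge0 ?c1 ?exprn_ge0 ?exprn_ile1// ltW.
- by move=> n; exact: c1.
- by move=> w; exact: gE.
- by move=> w; exact: gE.
pose phi (v : R) : R := normc (1 - z * polar s v)^-1 ^+ 2.
have phiE v : (1 - z * polar s v)^-1 * (1 - conjc z * polar s (- v))^-1 = (phi v)%:C.
  rewrite /phi -mul_conjc_normc; congr (_ * _).
  rewrite conjc_inv rmorphB rmorphM rmorph1; congr ((1 - _ * _)^-1).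
  by rewrite /polar /= cosN sinN mulrN.
move: ip cc; rewrite /pairing (funext phiE) cintegral_real => -[ip _] cc.
have pi0 := pi_gt0 R.
have I0 : 0 <= \int[mu]_(v in `[- pi, pi]) phi v.
  by apply: Rintegral_ge0 => v _; exact: sqr_ge0.
apply: (@le_trans _ _ (\int[mu]_(v in `[- pi, pi]) phi v)).
  have -> : \int[mu]_(v in `[- pi, pi]) normc (z * (1 - z * polar s v)^-1 ^+ 2) =
      \int[mu]_(v in `[- pi, pi]) (normc z * phi v).
    by apply: eq_Rintegral => v _; rewrite normcM normcX.
  by rewrite RintegralZl// ler_piMl.
apply: (le_null_lim _ _ cc) => n; first exact: normc_ge0.
set S := _ * \sum_(k < n) _.
have SB : normc S <= 2 * pi / (1 - s).
  have p2 : 0 <= 2 * pi :> R by rewrite mulr_ge0// ltW.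
  rewrite /S normcM normcR ger0_norm// ler_wpM2l//.
  have s2 : 0 <= s < 1 by rewrite (ltW s0).
  rewrite (le_trans (normc_sum _ _ _))// (le_trans _ (sum_geometric_le n s2))//.
  apply: ler_sum => k _.
  have -> : k.+1%:R ^+ 2 * (c z k.+1 * c (conjc z) k.+1) * (s ^+ (2 * k))%:C =
      (z * s%:C) ^+ k * (conjc z * s%:C) ^+ k.
    by rewrite -!cE mul2n -addnn exprD rmorphM !rmorphXn /=; ring.
  rewrite normcM !normcX !normcM normc_conjc normcR gtr0_norm// -exprMn.
  rewrite lerXn2r ?nnegrE ?mulr_ge0 ?normc_ge0 ?(ltW s0)//.
  have h : normc z * s <= s by rewrite ler_piMl ?(ltW s0).
  have h0 : 0 <= normc z * s by rewrite mulr_ge0 ?normc_ge0 ?(ltW s0).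
  have h1 : normc z * s <= 1 by rewrite (le_trans h)// ltW.
  by rewrite (le_trans _ h)// ler_piMl.
have n1 := normc_distD S (\int[mu]_(v in `[- pi, pi]) phi v)%:C 0.
rewrite !subr0 normcR (ger0_norm I0) normc_distC in n1; lra.
Qed.

(** The right-hand side of the definition of the calculus, as a functional of
    an abstract g. It is used for the resolvent of T and also for the scalar
    kernel z / (1 - z w)^2, which represents the values of f on the closed
    disc. *)
Definition calculus_form (f : C -> C) (t0 : C) (gd : C -> C) : C :=
  f 0 * t0 + (2 / pi)%:C * cintegral I01 (fun s => (s * ln s^-1)%:C *
    pairing (derive1 (f : C^o -> C^o)) gd s).

Lemma besov_power_series (f : C^o -> C^o) : besov f -> exists a : nat -> C,
  [/\ f 0 = a 0%N, has_power_series f a &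
      has_power_series (derive1 f) (fun k => k.+1%:R * a k.+1)].
Proof.
move=> [hol _].
have fD z : normc z < 1 -> cderiv f z (derive1 f z).
  by move=> z1; apply: derivable_cderiv; apply: hol; rewrite /unit_disc /= normrC ltcR.
have [|a fa] := @taylor R f; first by move=> w w1; exists (derive1 f w); exact: fD.
exists a; split => //; last exact: derived_power_series fa fD.
have n0 : normc (0 : C) < 1 by rewrite normc0 ltr01.
have := fa.2 _ n0; rewrite -(cvg_shiftS (fun n => normc (\sum_(k < n) a k * 0 ^+ k - f 0))).
move=> /null_ge0_eq h; apply/eqP; rewrite eq_sym -subr_eq0 -normc_eq0; apply/eqP.
apply: h => [|n]; first exact: normc_ge0.
rewrite big_ord_recl expr0 mulr1 big1 ?addr0// => k _.
by rewrite lift0 expr0n mulr0.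
Qed.

(** The monomial d X^n is appended so that the polynomial is not constant. A
    constant polynomial could vanish identically after subtraction of one of
    its values, and would then say nothing about the spectrum. *)
Lemma truncation (c : nat -> C) (K q d : R) : 0 <= q < 1 -> 0 < d ->
  (forall n, normc (c n) <= K * q ^+ n) ->
  exists p : {poly C}, exists N, (1 < size p)%N /\
    forall (t : nat -> C) Kt, (forall n, normc (t n) <= Kt) ->
    forall m, (N <= m)%N ->
    normc (\sum_(j < m) c j * t j - \sum_(j < size p) p`_j * t j) <= 2 * d * Kt.
Proof.
move=> q01 d0 cK; have [q0 q1] := andP q01.
have tail0 n : 0 <= K / (1 - q) * q ^+ n.
  have K0 : 0 <= K by have := cK 0%N; rewrite expr0 mulr1; apply: le_trans; exact: normc_ge0.
  by rewrite mulr_ge0 ?exprn_ge0// divr_ge0// subr_ge0 ltW.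
have [N HN] := (nullP tail0).1 (geometric_bound_null K q01) _ d0.
pose n := N.+1.
exists (\poly_(j < n.+1) (if j == n then d%:C else c j)), n.
have sz : size (\poly_(j < n.+1) (if j == n then d%:C else c j)) = n.+1.
  by rewrite size_poly_eq //= eqxx -normc_eq0 normcR normr_eq0 gt_eqF.
rewrite sz; split => // t Kt tK m nm.
have Kt0 : 0 <= Kt by rewrite (le_trans (normc_ge0 _) (tK 0%N)).
rewrite big_ord_recr /= coef_poly ltnSn eqxx.
under [in X in _ - X]eq_bigr => j _ do rewrite coef_poly ltnS (ltnW (ltn_ord j)) (ltn_eqF (ltn_ord j)).
rewrite opprD addrA (le_trans (normcB _ _))//.
have -> : 2 * d * Kt = Kt * d + d * Kt by ring.
apply: lerD; last by rewrite normcM normcR gtr0_norm// ler_wpM2l// ltW.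
have := @geometric_tail R C^o (fun j => c j * t j : C^o) (Kt * K) q q01 _ m n nm.
rewrite rnorm_scalar => H; rewrite (le_trans (H _))//.
  move=> j; rewrite rnorm_scalar normcM mulrC -[leRHS]mulrA.
  by apply: ler_pM; rewrite ?normc_ge0.
rewrite -mulrA -mulrA ler_wpM2l// [leLHS]mulrA ltW// HN//.
Qed.

(** The Abel means of the Taylor series, cut off at a finite degree. The same
    polynomials and the same rate serve for every pair (t, gd): bounded
    coefficients and the L1 bound on circles are all that is asked of gd.
    Applied to t n = xs (T^n x) and to t n = z^n, this approximates f(T) and
    the boundary values of f at once. *)
Lemma besov_polynomials (f : C^o -> C^o) : besov f ->
  exists (p : nat -> {poly C}) (e : nat -> R),
  [/\ e k @[k --> \oo] --> (0 : R), forall k, 0 < e k, forall k, (1 < size (p k))%N,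
     forall z, normc z < 1 -> normc ((p k).[z] - f z) @[k --> \oo] --> (0 : R) &
     forall (t : nat -> C) (gd : C -> C) (Kt Cg : R),
       (forall n, normc (t n) <= Kt) ->
       (forall z, normc z < 1 ->
         normc (\sum_(k < n) k.+1%:R * t k.+1 * z ^+ k - gd z) @[n --> \oo] --> (0 : R)) ->
       0 <= Cg -> (forall s, 0 < s < 1 ->
         \int[mu]_(v in `[- pi, pi]) normc (gd (polar s v)) <= Cg / (1 - s)) ->
       forall k, normc (calculus_form f (t 0%N) gd - \sum_(j < size (p k)) (p k)`_j * t j)
         <= (Kt + Cg) * e k].
Proof.
move=> bf; have [a [fa0 fa fda]] := besov_power_series bf.
have [_ fin] := bf; have pi0 := pi_gt0 R.
pose h := ray_sup (derive1 f).
have h_int : mu.-integrable I01 (EFin \o h).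
  exact: (ray_sup_integrable fda fin).
have h0 s : 0 < s < 1 -> 0 <= h s by exact: ray_sup_ge0 fda _.
have fdh s v : 0 < s < 1 -> normc (derive1 f (polar s v)) <= 2 * h s by exact: fd_le_ray_sup fda _ _.
pose d (k : nat) : R := k.+1%:R^-1; pose tau k := 1 - d k.+1.
have d0 k : 0 < d k by rewrite invr_gt0 ltr0n.
have dS k : d k.+1 < 1 by rewrite invf_lt1 ?ltr0n// ltr1n.
have dle k : d k.+1 <= d k by rewrite lef_pV2 ?posrE ?ltr0n// ler_nat.
have dT : d k @[k --> \oo] --> (0 : R) by exact: cvg_harmonic.
have tau01 k : 0 < tau k < 1 by rewrite /tau subr_gt0 dS gtrBl d0.
have tauT : tau k @[k --> \oo] --> (1 : R).
  rewrite -[X in _ --> X]subr0; apply: cvgB; first exact: cvg_cst.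
  by rewrite (cvg_shiftS d).
pose c k j : C := a j * (tau k ^+ (2 * j))%:C.
have cK k : exists K, forall n, normc (c k n) <= K * tau k ^+ n.
  have [t0 _] := andP (tau01 k).
  have [K HK] := fa.1 _ (tau01 k); exists K => n.
  rewrite /c normcM normcR ger0_norm ?exprn_ge0 ?(ltW t0)// mul2n -addnn exprD mulrA.
  by rewrite ler_wpM2r ?exprn_ge0 ?(ltW t0).
have exP k : exists pN : {poly C} * nat, (1 < size pN.1)%N /\
    forall (t : nat -> C) Kt, (forall n, normc (t n) <= Kt) ->
    forall m, (pN.2 <= m)%N ->
    normc (\sum_(j < m) c k j * t j - \sum_(j < size pN.1) pN.1`_j * t j) <= 2 * d k * Kt.
  have [K HK] := cK k; have t1 : 0 <= tau k < 1 by have [/ltW -> ->] := andP (tau01 k).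
  by have [p [N HN]] := truncation t1 (d0 k) HK; exists (p, N).
have [pN HpN] := choice exP.
pose Nk k := log_defect h (tau k).
have NT : Nk k @[k --> \oo] --> (0 : R).
  exact: (log_defect_cvg h_int h0 tau01 tauT).
exists (fun k => (pN k).1), (fun k => 16 / pi * `|Nk k| + 2 * d k); split.
- by apply: nullD; apply: nullM => //; apply/norm_cvg0P.
- move=> k; rewrite ltr_wpDl ?mulr_gt0//; apply: mulr_ge0 => //; apply: divr_ge0 => //.
  exact: ltW.
- by move=> k; have [] := HpN k.
- move=> z z1.
  have tz n : normc (z ^+ n) <= 1 by rewrite normcX exprn_ile1 ?normc_ge0// ltW.
  have zT : normc ((tau k ^+ 2)%:C * z - z) @[k --> \oo] --> (0 : R).
    apply: (null_leS _ _ (nullM 2 dT)) => k; first exact: normc_ge0.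
    have [t0 t1] := andP (tau01 k).
    rewrite -[X in _ - X]mul1r -mulrBl normcM -(rmorph1 (real_complex R)) -rmorphB normcR.
    rewrite -[leRHS]mulr1; apply: ler_pM; rewrite ?normc_ge0 ?(ltW z1)//.
    rewrite ler0_norm ?subr_le0 ?expr_le1 ?(ltW t0) ?(ltW t1)//.
    have := dle k; move: (d k) t0 t1 => dk; rewrite /tau; move: (d k.+1) => dk'; nra.
  have [D /cderiv_ccont fc _] := series_derivative fa z1.
  apply: (null_leS _ _ (nullD (nullM 2 dT) (ccont_comp fc zT))) => k; first exact: normc_ge0.
  have [t0 t1] := andP (tau01 k).
  have w1 : normc ((tau k ^+ 2)%:C * z) < 1.
    rewrite normcM normcR ger0_norm ?sqr_ge0//.
    by rewrite (le_lt_trans _ z1)// ler_piMl ?normc_ge0// expr_le1 ?(ltW t0) ?(ltW t1).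
  have [N HN] := HpN k.
  have cT := fa.2 _ w1.
  apply: (@le_null_lim _ _ _ (fun n => normc (\sum_(j < n + (pN k).2) a j *
     ((tau k ^+ 2)%:C * z) ^+ j - f ((tau k ^+ 2)%:C * z)))) => [n|n|].
  + exact: normc_ge0.
  + have := HN _ _ tz _ (leq_addl n (pN k).2).
    rewrite mulr1 horner_coef; set P := \sum_(j < size _) _; set S := \sum_(j < _) _ => hS.
    have -> : \sum_(j < n + (pN k).2) a j * ((tau k ^+ 2)%:C * z) ^+ j = S.
      apply: eq_bigr => j _; rewrite /c exprMn exprM mulrA; congr (_ * _ * _).
      by rewrite -rmorphXn.
    move: (f _) (f z) hS => f1 f2 hS.
    have n1 := normc_distD S P f2; have n2 := normc_distD f1 S f2.
    rewrite [normc (P - S)]normc_distC in n1; lra.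
  + by have := null_shift (pN k).2 cT; apply.
- move=> t gd Kt Cg tK gdE Cg0 gdi k.
  have Kt0 : 0 <= Kt by rewrite (le_trans (normc_ge0 _) (tK 0%N)).
  have [_ HN] := HpN k; have tk := tau01 k.
  have W := weighted_pairing fa.1 fda.2 tK gdE tk.
  have Dk := pairing_defect fa.1 fda.2 h_int h0 fdh tK gdE gdi tk.
  have -> : (Kt + Cg) * (16 / pi * `|Nk k| + 2 * d k) =
    (16 / pi * Cg * `|Nk k| + 2 * d k * Kt) + (16 / pi * (Kt * `|Nk k|) + 2 * (Cg * d k)) by ring.
  apply: ler_wpDr.
    apply: addr_ge0; apply: mulr_ge0 => //; first by rewrite divr_ge0// ltW.
      exact: mulr_ge0.
    by rewrite mulr_ge0// ltW.
  apply: (le_null_lim _ _ (null_shift (pN k).2 W)) => n; first exact: normc_ge0.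
  have := HN _ _ tK _ (leqW (leq_addl n (pN k).2)).
  rewrite big_ord_recl /c muln0 expr0 rmorph1 mulr1 /calculus_form fa0.
  set P := \sum_(j < size _) _; set S := \sum_(j < _) _ => hS.
  have -> : \sum_(j < n + (pN k).2) a j.+1 * t j.+1 * (tau k ^+ (2 * j.+1))%:C = S.
    by apply: eq_bigr => j _; rewrite lift0 mulrAC.
  move: Dk; rewrite -/(Nk k); set L := (2 / pi)%:C * _; set L' := (2 / pi)%:C * _ => Dk.
  have Nle : 16 / pi * Cg * Nk k <= 16 / pi * Cg * `|Nk k|.
    by rewrite ler_wpM2l ?ler_norm// mulr_ge0// divr_ge0// ltW.
  move: (a 0%N * t 0%N) hS => A hS.
  have -> : A + L - P = (L - L') + (A + S - P) - (S - L') by ring.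
  have n1 := normcB (L - L' + (A + S - P)) (S - L'); have n2 := normcD (L - L') (A + S - P).
  move: (2 * d k * Kt) (16 / pi * Cg * `|Nk k|) (16 / pi * Cg * Nk k) hS Dk Nle => x y w hS Dk Nle.
  lra.
Qed.

End scalar_kernel.

(** * Boundary values *)

Section disc_extension.
Context (R : realType).
Local Notation C := R[i].
Local Notation mu := (@lebesgue_measure R).
Local Notation I01 := (`]0%R, 1%R[%classic : set R).

Lemma poly_lipschitz (p : {poly C}) : exists L B, [/\ 0 <= L, 0 <= B &
  forall w z, normc w <= 1 -> normc z <= 1 ->
    normc p.[z] <= B /\ normc (p.[w] - p.[z]) <= L * normc (w - z)].
Proof.
elim/poly_ind: p => [|q c [L [B [L0 B0 H]]]].
  by exists 0, 0; split => // w z _ _; rewrite !horner0 subr0 normc0 mul0r.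
exists (L + B), (B + normc c); split; rewrite ?addr_ge0 ?normc_ge0// => w z w1 z1.
have [Hz _] := H z z z1 z1; have [_ Hwz] := H w z w1 z1.
rewrite !hornerMXaddC; split.
  rewrite (le_trans (normcD _ _))// lerD2r normcM (le_trans _ Hz)//.
  by rewrite ler_piMr ?normc_ge0.
have -> : q.[w] * w + c - (q.[z] * z + c) = (q.[w] - q.[z]) * w + q.[z] * (w - z) by ring.
rewrite (le_trans (normcD _ _))// !normcM mulrDl lerD//.
  by rewrite (le_trans _ Hwz)// ler_piMr ?normc_ge0.
by rewrite ler_wpM2r ?normc_ge0.
Qed.

Lemma within_eps_cvg (V W : normedModType C) (A : set V) (h : V -> W) (z : V) (l : W) :
  (forall e : R, 0 < e -> exists2 d : R, 0 < d &
    forall w : V, A w -> rnorm (w - z) < d -> rnorm (h w - l) < e) ->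
  h @ within A (nbhs z) --> l.
Proof.
move=> hc; apply/cvgrPdist_lt => _ /ltC0P[e e0 ->].
have [d d0 Hd] := hc e e0.
apply/nbhs_ballP; exists d%:C; first by rewrite /= ltcR.
move=> w; rewrite -ball_normE /= !normr_rnorm !ltcR (rdistC z w) (rdistC l) => wz Aw.
exact: Hd.
Qed.

Lemma unit_discE (w : C) : unit_disc w = (normc w < 1) :> Prop.
Proof. by rewrite /unit_disc /= normrC -[1]/(1%:C) ltcR. Qed.

(** Points of the closed disc are limits of the points s z with s < 1. *)
Lemma radial_within_proper (V : normedModType C) (A : set V) (z : V) :
  (forall s : R, 0 < s < 1 -> A (s%:C *: z)) -> ProperFilter (within A (nbhs z)).
Proof.
move=> Az; apply: within_nbhs_proper => B /nbhs_ballP[_ /= /ltC0P[d d0 ->]] HB.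
pose c := rnorm z + 1; have c0 : 0 < c by rewrite ltr_wpDl ?rnorm_ge0.
pose r := Num.min (2^-1) (d / (2 * c)).
have r0 : 0 < r by rewrite lt_min divr_gt0 ?mulr_gt0// invr_gt0 ltr0n.
have r1 : r < 1 by rewrite gt_min invf_lt1 ?ltr1n.
exists ((1 - r)%:C *: z); split; first by apply: Az; rewrite subr_gt0 r1 gtrBl.
apply: HB; rewrite -ball_normE /= normr_rnorm ltcR.
rewrite rmorphB rmorph1 scalerBl scale1r opprB addrC subrK rnormZ normcR gtr0_norm//.
have rd : r <= d / (2 * c) by rewrite ge_min lexx orbT.
have zc : rnorm z < c by rewrite ltrDl.
rewrite (le_lt_trans (ler_wpM2l (ltW r0) (ltW zc)))//.
rewrite (le_lt_trans (ler_wpM2r (ltW c0) rd))//.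
have -> : d / (2 * c) * c = d / 2 by field; rewrite gt_eqF.
by rewrite ltr_pdivrMr// ltr_pMr// ltr1n.
Qed.

(** The values given by [calculus_form] for the scalar kernel agree with f
    inside the disc and are uniform limits of polynomials on its closure,
    hence they are the limits from inside. *)
Lemma besov_approximation (f : C^o -> C^o) : besov f ->
  exists (p : nat -> {poly C}) (e : nat -> R),
  [/\ e k @[k --> \oo] --> (0 : R), forall k, 0 < e k, forall k, (1 < size (p k))%N,
     forall z, normc z <= 1 -> forall k, normc (disc_ext f z - (p k).[z]) <= e k &
     forall (t : nat -> C) (gd : C -> C) (Kt Cg : R),
       (forall n, normc (t n) <= Kt) ->
       (forall z, normc z < 1 ->
         normc (\sum_(k < n) k.+1%:R * t k.+1 * z ^+ k - gd z) @[n --> \oo] --> (0 : R)) ->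
       0 <= Cg -> (forall s, 0 < s < 1 ->
         \int[mu]_(v in `[- pi, pi]) normc (gd (polar s v)) <= Cg / (1 - s)) ->
       forall k, normc (calculus_form f (t 0%N) gd - \sum_(j < size (p k)) (p k)`_j * t j)
         <= (Kt + Cg) * e k].
Proof.
move=> bf; have [p [e [eT e0 psz pf He]]] := besov_polynomials bf.
pose g z := calculus_form f 1 (fun w => z * (1 - z * w)^-1 ^+ 2).
pose c : R := 1 + 2 * pi; have pi0 := pi_gt0 R.
have c1 : 1 <= c by rewrite lerDl mulr_ge0// ltW.
have gp z k : normc z <= 1 -> normc (g z - (p k).[z]) <= c * e k.
  move=> z1; rewrite horner_coef.
  apply: (He (fun n => z ^+ n) (fun w => z * (1 - z * w)^-1 ^+ 2)).
  - by move=> n; rewrite normcX exprn_ile1 ?normc_ge0.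
  - move=> w w1; have zw1 : normc (z * w) < 1.
      by rewrite normcM; apply: le_lt_trans w1; rewrite ler_piMl ?normc_ge0.
    apply: (null_eq _ (nullM (normc z) (deriv_geometric_series zw1))) => n.
    rewrite -normcM mulrBr mulr_sumr; congr (normc (_ - _)).
    by apply: eq_bigr => k' _; rewrite exprS exprMn; ring.
  - by rewrite mulr_ge0// ltW.
  - by move=> s s01; exact: poisson_bound.
have gf z : normc z < 1 -> g z = f z.
  move=> z1; apply/eqP; rewrite -subr_eq0 -normc_eq0; apply/eqP.
  apply: (null_ge0_eq _ _ (nullD (nullM c eT) (pf z z1))) => [|k]; first exact: normc_ge0.
  rewrite (le_trans (normc_distD (p k).[z] _ _))// lerD2r.
  by apply: gp; exact: ltW.
have gE z : normc z <= 1 -> disc_ext f z = g z.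
  move=> z1; rewrite /disc_ext.
  have PF : ProperFilter (within (@unit_disc R) (nbhs (z : C^o))).
    apply: (@radial_within_proper C^o) => s /andP[s0 s1].
    rewrite unit_discE -[_ *: _]/(s%:C * z) normcM normcR gtr0_norm//.
    by rewrite (le_lt_trans _ s1)// ler_piMr// ltW.
  apply: cvg_lim; first exact: norm_hausdorff.
  apply: (@within_eps_cvg C^o C^o) => d d0.
  have cn : 0 <= c by rewrite (le_trans _ c1).
  have [N HN] := (nullP (fun k => mulr_ge0 cn (ltW (e0 k)))).1 (nullM c eT) (d / 3) (divr_gt0 d0 (ltr0Sn _ _)).
  have [L [B [L0 _ HL]]] := poly_lipschitz (p N).
  have L1 : 0 < L + 1 by rewrite ltr_wpDl.
  exists (d / (3 * (L + 1))); first by rewrite divr_gt0// mulr_gt0.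
  move=> w; rewrite unit_discE !rnorm_scalar => w1 wz; rewrite -gf//.
  have [_ Hp] := HL w z (ltW w1) z1.
  have h1 := gp _ N (ltW w1); have h2 := gp _ N z1; have h3 := HN _ (leqnn N).
  have h4 : L * normc (w - z) < d / 3.
    have : (L + 1) * normc (w - z) < d / 3.
      rewrite mulrC -ltr_pdivlMr// (lt_le_trans wz)//.
      by rewrite le_eqVlt; apply/orP; left; apply/eqP; field; rewrite gt_eqF.
    apply: le_lt_trans; rewrite ler_wpM2r ?normc_ge0//; lra.
  have n1 := normc_distD (p N).[w] (g w) (g z).
  have n2 := normc_distD (p N).[z] (p N).[w] (g z).
  rewrite [normc (_.[z] - g z)]normc_distC in n2.
  move: (c * e N) (L * normc (w - z)) h1 h2 h3 h4 Hp => x y h1 h2 h3 h4 Hp.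
  lra.
exists p, (fun k => c * e k); split => //.
- exact: nullM.
- by move=> k; rewrite mulr_gt0// (lt_le_trans _ c1).
- by move=> z z1 k; rewrite gE//; exact: gp.
- move=> t gd Kt Cg tK gdE Cg0 gdi k; rewrite (le_trans (He _ _ _ _ tK gdE Cg0 gdi k))//.
  have Kt0 : 0 <= Kt by rewrite (le_trans (normc_ge0 _) (tK 0%N)).
  by rewrite ler_wpM2l ?addr_ge0// ler_peMl// ltW.
Qed.

(** The continuous image of a compact set is closed. *)
Lemma image_gap (A : set C^o) (h : C^o -> C^o) (m : C) : closed A ->
  (forall z, A z -> normc z <= 1) ->
  (forall z : C, normc z <= 1 -> forall e : R, 0 < e -> exists2 d : R, 0 < d &
     forall w : C, normc w <= 1 -> normc (w - z) < d -> normc (h w - h z) < e) ->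
  ~ (h @` A) m -> exists2 d : R, 0 < d & forall z, A z -> d <= normc (m - h z).
Proof.
move=> cA A1 hc nm.
have cpA : compact A by apply: (subclosed_compact cA (@compact_closed_disc R)).
have hA : {within A, continuous h}.
  apply/subspace_continuousP => z Az; apply: (@within_eps_cvg C^o C^o) => e e0.
  have [d d0 Hd] := hc z (A1 z Az) e e0; exists d => // w Aw; rewrite !rnorm_scalar.
  by apply: Hd; exact: A1.
have cl := compact_closed (@norm_hausdorff _ C^o) (continuous_compact hA cpA).
have : open (~` (h @` A)) by exact: closed_openC.
rewrite openE => /(_ m nm); rewrite /interior => /nbhs_ballP[_ /= /ltC0P[d d0 ->] Hd].
exists d => // z Az; rewrite leNgt; apply/negP => mz.
apply: (Hd (h z)); last by exists z.
by rewrite -ball_normE /= normrC ltcR.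
Qed.

End disc_extension.

(** * Bounded operators and Neumann series *)

Section bounded_operators.
Context (R : realType).
Local Notation C := R[i].

(** Kept as a property of plain functions, so that sums, compositions and
    limits can be formed without bundling continuity at each step. *)
Definition bounded_linear (V W : normedModType C) (f : V -> W) :=
  linear f /\ exists2 c : R, 0 <= c & forall x, rnorm (f x) <= c * rnorm x.

Section maps.
Variables (V W : normedModType C).
Implicit Types f g : V -> W.

Lemma blinear_bounded_linear (T : blinear V W) : bounded_linear T.
Proof.
split; first by move=> a u v; rewrite linearP.
by have [c c0 cT] := blinear_bounded T; exists c => //; exact: ltW.
Qed.

Lemma bounded_linear_blinear f : bounded_linear f -> exists B : blinear V W, B =1 f.
Proof. by move=> [lf [c _ cf]]; exact: bounded_blinear lf cf. Qed.

Lemma blP f : bounded_linear f -> forall a u v, f (a *: u + v) = a *: f u + f v.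
Proof. by case. Qed.

Lemma blD f : bounded_linear f -> forall u v, f (u + v) = f u + f v.
Proof. by move=> bf u v; have := blP bf 1 u v; rewrite !scale1r. Qed.

Lemma bl0 f : bounded_linear f -> f 0 = 0.
Proof. by move=> bf; apply: (@addrI _ (f 0)); rewrite -blD// !addr0. Qed.

Lemma blZ f : bounded_linear f -> forall a u, f (a *: u) = a *: f u.
Proof. by move=> bf a u; have := blP bf a u 0; rewrite bl0// !addr0. Qed.

Lemma blN f : bounded_linear f -> forall u, f (- u) = - f u.
Proof. by move=> bf u; rewrite -scaleN1r blZ// scaleN1r. Qed.

Lemma blB f : bounded_linear f -> forall u v, f (u - v) = f u - f v.
Proof. by move=> bf u v; rewrite blD// blN. Qed.

Lemma bl_sum f : bounded_linear f -> forall I (r : seq I) (F : I -> V),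
  f (\sum_(i <- r) F i) = \sum_(i <- r) f (F i).
Proof. by move=> bf I r F; elim/big_rec2: _ => [|i y x _ <-]; [exact: bl0|exact: blD]. Qed.

Lemma bl_eq f g : f =1 g -> bounded_linear f -> bounded_linear g.
Proof. by move=> /funext ->. Qed.

Lemma bl_zero : bounded_linear (fun _ : V => 0 : W).
Proof.
split; first by move=> a u v; rewrite scaler0 addr0.
by exists 0 => // x; rewrite rnorm0 mul0r.
Qed.

Lemma bl_add f g : bounded_linear f -> bounded_linear g ->
  bounded_linear (fun x => f x + g x).
Proof.
move=> [lf [c c0 cf]] [lg [d d0 dg]]; split.
  by move=> a u v; rewrite lf lg scalerDr addrACA.
exists (c + d) => [|x]; first exact: addr_ge0.
by rewrite (le_trans (rnormD _ _))// mulrDl lerD.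
Qed.

Lemma bl_scale f a : bounded_linear f -> bounded_linear (fun x => a *: f x).
Proof.
move=> [lf [c c0 cf]]; split.
  by move=> b u v; rewrite lf scalerDr !scalerA mulrC.
exists (normc a * c) => [|x]; first by rewrite mulr_ge0 ?normc_ge0.
by rewrite rnormZ -mulrA ler_wpM2l ?normc_ge0.
Qed.

Lemma bl_sub f g : bounded_linear f -> bounded_linear g ->
  bounded_linear (fun x => f x - g x).
Proof.
move=> bf bg; apply: bl_eq (bl_add bf (bl_scale (-1) bg)) => x.
by rewrite scaleN1r.
Qed.

End maps.

Lemma bl_id (V : normedModType C) : bounded_linear (fun x : V => x).
Proof. by split => //; exists 1 => // x; rewrite mul1r. Qed.

Lemma bl_comp (U V W : normedModType C) (f : V -> W) (g : U -> V) :
  bounded_linear f -> bounded_linear g -> bounded_linear (fun x => f (g x)).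
Proof.
move=> [lf [c c0 cf]] [lg [d d0 dg]]; split; first by move=> a u v; rewrite lg lf.
exists (c * d) => [|x]; first exact: mulr_ge0.
by rewrite (le_trans (cf _))// -mulrA ler_wpM2l.
Qed.

Lemma bl_iter (V : normedModType C) (f : V -> V) n : bounded_linear f ->
  bounded_linear (iter n f).
Proof. by move=> bf; elim: n => [|n IH]; [exact: bl_id|exact: bl_comp]. Qed.

Lemma bl_big (V W : normedModType C) n (F : nat -> V -> W) :
  (forall j, bounded_linear (F j)) -> bounded_linear (fun x => \sum_(j < n) F j x).
Proof.
move=> bF; elim: n => [|n IH].
  by apply: bl_eq (@bl_zero _ _) => x; rewrite big_ord0.
by apply: bl_eq (bl_add IH (bF n)) => x; rewrite big_ord_recr.
Qed.

Lemma iter_bound (V : normedModType C) (f : V -> V) (c : R) : 0 <= c ->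
  (forall x, rnorm (f x) <= c * rnorm x) ->
  forall n x, rnorm (iter n f x) <= c ^+ n * rnorm x.
Proof.
move=> c0 cf; elim=> [|n IH] x; first by rewrite mul1r.
by rewrite iterS (le_trans (cf _))// exprS -mulrA ler_wpM2l.
Qed.

Lemma iter_scale (V : normedModType C) (f : V -> V) a n x : bounded_linear f ->
  iter n (fun y => a *: f y) x = a ^+ n *: iter n f x.
Proof.
move=> bf; elim: n => [|n IH]; first by rewrite scale1r.
by rewrite !iterS IH blZ// scalerA -exprS.
Qed.

Lemma iter_commute (V : Type) (f g : V -> V) : (forall x, f (g x) = g (f x)) ->
  forall n x, iter n f (g x) = g (iter n f x).
Proof. by move=> fg; elim=> // n IH x; rewrite !iterS IH fg. Qed.

Lemma iter_comp (V : Type) (f g : V -> V) : (forall x, f (g x) = g (f x)) ->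
  forall n x, iter n (fun y => f (g y)) x = iter n f (iter n g x).
Proof.
move=> fg; elim=> // n IH x; rewrite !iterS IH; congr (f _).
by rewrite (iter_commute fg).
Qed.

Section invertibility.
Variable V : normedModType C.
Implicit Types S : V -> V.

Definition invertible S := exists B, [/\ bounded_linear B, cancel S B & cancel B S].

Lemma invertibleP S : invertible S <-> exists B : blinear V V, is_op_inverse S B.
Proof.
split=> [[B [bB SB BS]]|[B [SB BS]]]; last first.
  by exists B; split => //; exact: blinear_bounded_linear.
have [B' B'E] := bounded_linear_blinear bB; exists B'.
by split=> x; rewrite B'E.
Qed.

Lemma invertible_eq S S' : S =1 S' -> invertible S -> invertible S'.
Proof. by move=> /funext ->. Qed.

Lemma invertible_comp S S' : invertible S -> invertible S' ->
  invertible (fun x => S (S' x)).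
Proof.
move=> [B [bB SB BS]] [B' [bB' SB' BS']]; exists (fun x => B' (B x)); split.
- exact: bl_comp.
- by move=> x; rewrite SB SB'.
- by move=> x; rewrite BS' BS.
Qed.

Lemma invertible_scale (a : C) : a != 0 -> invertible (fun x => a *: x).
Proof.
move=> a0; exists (fun x => a^-1 *: x); split.
- exact: bl_scale (bl_id _).
- by move=> x; rewrite scalerA mulVf// scale1r.
- by move=> x; rewrite scalerA mulfV// scale1r.
Qed.

(** The map U^-1 Q is a left inverse of S and Q U^-1 is a right inverse. *)
Lemma invertible_factor S Q U : bounded_linear Q ->
  (forall x, U x = Q (S x)) -> (forall x, U x = S (Q x)) ->
  invertible U -> invertible S.
Proof.
move=> bQ UQS USQ [B [bB UB BU]]; exists (fun x => Q (B x)); split.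
- exact: bl_comp.
- move=> x; apply: (can_inj UB); rewrite !UQS; congr (Q _).
  by rewrite -USQ BU.
- by move=> x; rewrite -USQ BU.
Qed.

Lemma op_inv_invertible S : invertible S -> is_op_inverse S (op_inv S).
Proof. by move=> /invertibleP[B SB]; apply: (@getPex _ (is_op_inverse S)); exists B. Qed.

End invertibility.
End bounded_operators.

Section neumann_series.
Context (R : realType) (X : completeNormedModType R[i]).
Local Notation C := R[i].
Implicit Types A S E : X -> X.

Lemma sub_sub_sub (V : zmodType) (b s b' s' : V) : (b - s) - (b' - s') = (b - b') - (s - s').
Proof. by rewrite !opprB addrACA [RHS]addrACA [- s - b']addrC. Qed.

Lemma neumann_telescope A n x : bounded_linear A ->
  \sum_(k < n) iter k A x - A (\sum_(k < n) iter k A x) = x - iter n A x.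
Proof.
move=> bA; elim: n => [|n IH]; first by rewrite big_ord0 bl0// !subrr.
rewrite big_ord_recr /= blD// opprD addrACA IH.
by rewrite addrA subrK.
Qed.

Lemma limit_bounded_linear (V W : normedModType C) (F : nat -> V -> W) (L : V -> W) (e : nat -> R) :
  (forall n, bounded_linear (F n)) -> e n @[n --> \oo] --> (0 : R) ->
  (forall n x, rnorm (L x - F n x) <= e n * rnorm x) -> bounded_linear L.
Proof.
move=> bF eT LF; split.
  move=> a u v; apply/eqP; rewrite -subr_eq0; apply/eqP/rnorm0_eq0.
  apply: (null_ge0_eq _ _ (nullM (rnorm (a *: u + v) + normc a * rnorm u + rnorm v) eT)) => [|n]; first exact: rnorm_ge0.
  pose d w := L w - F n w; have LE w : L w = F n w + d w by rewrite addrC subrK.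
  rewrite !LE (blP (bF n)) scalerDr [X in rnorm (_ - X)]addrACA opprD addrACA subrr add0r.
  rewrite (le_trans (rnormB _ _))// !mulrDl -addrA.
  apply: lerD; first by rewrite mulrC; exact: LF.
  rewrite (le_trans (rnormD _ _))// lerD//; last by rewrite mulrC; exact: LF.
  by rewrite rnormZ -mulrA ler_wpM2l ?normc_ge0// mulrC; exact: LF.
have [_ [c c0 cF]] := bF 0%N.
exists (c + `|e 0%N|) => [|x]; first by rewrite addr_ge0.
rewrite -[L x](subrK (F 0%N x)) addrC (le_trans (rnormD _ _))// mulrDl lerD//.
by rewrite (le_trans (LF 0%N x))// ler_wpM2r ?rnorm_ge0// ler_norm.
Qed.

(** The bound K q^n on the powers, rather than a bound on the norm of A
    itself, is what power-bounded operators and products of commuting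
    operators provide. *)
Lemma neumann A (K q : R) : bounded_linear A -> 0 <= q < 1 ->
  (forall n x, rnorm (iter n A x) <= K * q ^+ n * rnorm x) ->
  exists B, [/\ bounded_linear B, cancel (fun x => x - A x) B, cancel B (fun x => x - A x) &
    forall n x, rnorm (B x - \sum_(k < n) iter k A x) <= K / (1 - q) * q ^+ n * rnorm x].
Proof.
move=> bA q01 AK.
have exB x : exists l, forall n,
    rnorm (l - \sum_(k < n) iter k A x) <= K / (1 - q) * q ^+ n * rnorm x.
  have [|l Hl] := @series_exists R X (fun k => iter k A x) (K * rnorm x) q q01.
    by move=> n; rewrite mulrAC; exact: AK.
  exists l => n; rewrite (le_trans (Hl n))// le_eqVlt; apply/orP; left; apply/eqP; ring.
have [B HB] := choice exB.
have gT := geometric_bound_null K q01.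
have bS n : bounded_linear (fun x => \sum_(k < n) iter k A x).
  by apply: (@bl_big _ X X n (fun k => iter k A)) => k; exact: bl_iter.
have bB : bounded_linear B by exact: (limit_bounded_linear bS gT (fun n x => HB x n)).
have [_ [a a0 cA]] := bA.
have iT x : rnorm (iter n A x) @[n --> \oo] --> (0 : R).
  apply: (null_leS _ _ (cvg_geometric_null (K * rnorm x) q01)) => n; first exact: rnorm_ge0.
  by rewrite mulrAC.
have Bid x : B x - A (B x) = x.
  apply/eqP; rewrite -subr_eq0; apply/eqP/rnorm0_eq0.
  apply: (null_ge0_eq _ _ (nullD (nullM ((1 + a) * rnorm x) gT) (iT x))) => [|n]; first exact: rnorm_ge0.
  pose S := \sum_(k < n) iter k A x.
  have -> : B x - A (B x) - x = ((B x - S) - A (B x - S)) - iter n A x.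
    rewrite (blB bA) sub_sub_sub (neumann_telescope n x bA).
    by rewrite -[RHS]addrA -opprD subrK.
  rewrite (le_trans (rnormB _ _))// lerD2r (le_trans (rnormB _ _))//.
  have h := HB x n; rewrite -/S in h; have h2 := cA (B x - S).
  rewrite (le_trans (lerD h (le_trans h2 (ler_wpM2l a0 h))))//.
  rewrite le_eqVlt; apply/orP; left; apply/eqP; ring.
exists B; split => // x.
have AB y : A (B y) = B (A y).
  apply/eqP; rewrite -subr_eq0; apply/eqP/rnorm0_eq0.
  apply: (null_ge0_eq _ _ (nullM (a * rnorm y + rnorm (A y)) gT)) => [|n]; first exact: rnorm_ge0.
  have -> : A (B y) - B (A y) = A (B y - \sum_(k < n) iter k A y) -
      (B (A y) - \sum_(k < n) iter k A (A y)).
    rewrite (blB bA) (bl_sum bA).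
    have -> : \sum_(k < n) A (iter k A y) = \sum_(k < n) iter k A (A y).
      by apply: eq_bigr => k _; rewrite (iter_commute (fun=> erefl)).
    by rewrite opprB addrA subrK.
  rewrite (le_trans (rnormB _ _))// mulrDl lerD//.
    rewrite (le_trans (cA _))// -mulrA ler_wpM2l// mulrC; exact: HB.
  by rewrite mulrC; exact: HB.
by rewrite (blB bB) -AB Bid.
Qed.

End neumann_series.

(** * Polynomials in an operator *)

Section spectral_theory.
Context (R : realType) (X : completeNormedModType R[i]).
Local Notation C := R[i].
Local Notation mu := (@lebesgue_measure R).
Implicit Types A S E B : X -> X.

Lemma small_invertible A (a : R) : bounded_linear A -> 0 <= a < 1 ->
  (forall x, rnorm (A x) <= a * rnorm x) -> invertible (fun x => x - A x).
Proof.
move=> bA a01 Aa; have [a0 _] := andP a01.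
have [|B [bB AB BA _]] := @neumann R X A 1 a bA a01.
  by move=> n x; rewrite mul1r; exact: iter_bound.
by exists B.
Qed.

(** Invertible operators form an open set, quantitatively: S - E = S (1 - B
    E). *)
Lemma perturbation S E B (b e : R) : bounded_linear S -> bounded_linear E ->
  bounded_linear B -> cancel S B -> cancel B S -> 0 <= b -> 0 <= e ->
  (forall x, rnorm (B x) <= b * rnorm x) -> (forall x, rnorm (E x) <= e * rnorm x) ->
  b * e < 1 -> invertible (fun x => S x - E x).
Proof.
move=> bS bE bB SB BS b0 e0 cB cE be.
have : invertible (fun x => S (x - B (E x))).
  apply: invertible_comp; first by exists B.
  apply: (@small_invertible (fun x => B (E x)) (b * e)); first exact: bl_comp.
    by rewrite mulr_ge0.
  by move=> x; rewrite (le_trans (cB _))// -mulrA ler_wpM2l.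
by apply: invertible_eq => x; rewrite (blB bS) BS.
Qed.

Variable T : X -> X.
Hypothesis bT : bounded_linear T.

Definition poly_op (p : {poly C}) (x : X) : X := \sum_(j < size p) p`_j *: iter j T x.

Implicit Types p q : {poly C}.

Lemma bl_poly_op p : bounded_linear (poly_op p).
Proof.
apply: (@bl_big _ X X (size p) (fun j x => p`_j *: iter j T x)) => j.
by apply: bl_scale; exact: bl_iter.
Qed.

Lemma poly_op_widen p n x : (size p <= n)%N -> poly_op p x = \sum_(j < n) p`_j *: iter j T x.
Proof.
move=> pn; rewrite /poly_op (big_ord_widen n (fun j => p`_j *: iter j T x))//.
rewrite big_mkcond /=; apply: eq_bigr => j _; case: ltnP => // /(nth_default 0) ->.
by rewrite scale0r.
Qed.

Lemma poly_opD p q x : poly_op (p + q) x = poly_op p x + poly_op q x.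
Proof.
set n := maxn (size p) (size q).
rewrite (@poly_op_widen _ n) ?size_polyD// (@poly_op_widen p n) ?leq_maxl//.
rewrite (@poly_op_widen q n) ?leq_maxr// -big_split; apply: eq_bigr => j _.
by rewrite coefD scalerDl.
Qed.

Lemma poly_opZ a p x : poly_op (a *: p) x = a *: poly_op p x.
Proof.
rewrite (@poly_op_widen _ (size p)) ?size_scale_leq// scaler_sumr.
by apply: eq_bigr => j _; rewrite coefZ scalerA.
Qed.

Lemma poly_opN p x : poly_op (- p) x = - poly_op p x.
Proof. by rewrite -scaleN1r poly_opZ scaleN1r. Qed.

Lemma poly_opC a x : poly_op a%:P x = a *: x.
Proof. by rewrite (@poly_op_widen _ 1) ?size_polyC_leq1// big_ord1 coefC. Qed.

Lemma poly_opMX p x : poly_op (p * 'X) x = poly_op p (T x).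
Proof.
rewrite (@poly_op_widen _ (size p).+1); last first.
  by rewrite (leq_trans (size_polyMleq _ _))// size_polyX addn2.
rewrite big_ord_recl coefMX eqxx scale0r add0r; apply: eq_bigr => j _.
by rewrite lift0 coefMX /= -iterSr.
Qed.

Lemma poly_op_comm S p x : bounded_linear S -> (forall y, S (T y) = T (S y)) ->
  poly_op p (S x) = S (poly_op p x).
Proof.
move=> bS ST; rewrite /poly_op (bl_sum bS); apply: eq_bigr => j _.
by rewrite (blZ bS) (iter_commute (fun y => esym (ST y))).
Qed.

Lemma poly_opT p x : poly_op p (T x) = T (poly_op p x).
Proof. exact: poly_op_comm. Qed.

Lemma poly_opM p q x : poly_op (p * q) x = poly_op p (poly_op q x).
Proof.
elim/poly_ind: p x => [|p c IH] x.
  by rewrite mul0r /poly_op size_poly0 !big_ord0.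
rewrite mulrDl poly_opD mul_polyC poly_opZ mulrAC poly_opMX IH poly_opD poly_opC poly_opMX.
by rewrite poly_opT.
Qed.

Lemma poly_opX x : poly_op 'X x = T x.
Proof. by rewrite -['X]mul1r poly_opMX poly_opC scale1r. Qed.

(** X - l divides p - p(l); this gives eigenvectors, approximate eigenvectors
    and one inclusion of the spectral mapping theorem for polynomials. *)
Lemma poly_op_horner p l : exists q, forall x,
  p.[l] *: x - poly_op p x = poly_op q (l *: x - T x) /\
  p.[l] *: x - poly_op p x = l *: poly_op q x - T (poly_op q x).
Proof.
have /factor_theorem[q qE] : root (p - p.[l]%:P) l by rewrite rootE !hornerE subrr.
exists q => x.
have qx : p.[l] *: x - poly_op p x = poly_op q (l *: x - T x).
  rewrite -(poly_opC p.[l]) -poly_opN -poly_opD -[_ - p]opprB qE -mulrN opprB poly_opM.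
  by rewrite poly_opD poly_opN poly_opC poly_opX.
by split=> //; rewrite qx (blB (bl_poly_op q)) (blZ (bl_poly_op q)) poly_opT.
Qed.

(** The polynomial splits into linear factors over the complex numbers. *)
Lemma poly_op_invertible p : p != 0 ->
  (forall l, root p l -> invertible (fun x => l *: x - T x)) -> invertible (poly_op p).
Proof.
move=> p0 rp; have [rs pE] := closed_field_poly_normal p.
have {}rp l : l \in rs -> invertible (fun x => l *: x - T x).
  move=> lrs; apply: rp; rewrite pE rootZ ?lead_coef_eq0// root_prod_XsubC//.
have lc : lead_coef p != 0 by rewrite lead_coef_eq0.
rewrite pE; have : invertible (fun x => lead_coef p *: poly_op (\prod_(z <- rs) ('X - z%:P)) x).
  apply: invertible_comp; first exact: invertible_scale.
  elim: rs rp {pE} => [|z rs IH] rp.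
    rewrite big_nil; apply: invertible_eq (invertible_scale X (oner_neq0 C)) => x.
    by rewrite -(polyC1 C) poly_opC.
  rewrite big_cons.
  have h1 : invertible (fun x => (-1 : C) *: (z *: x - T x)).
    apply: invertible_comp; first by apply: invertible_scale; rewrite oppr_eq0 oner_eq0.
    by apply: rp; rewrite mem_head.
  have h2 : invertible (poly_op (\prod_(z <- rs) ('X - z%:P))).
    by apply: IH => l lrs; apply: rp; rewrite in_cons lrs orbT.
  apply: invertible_eq (invertible_comp h1 h2) => x.
  by rewrite poly_opM poly_opD poly_opN poly_opC poly_opX scaleN1r opprB.
by apply: invertible_eq => x; rewrite poly_opZ.
Qed.

(** This is what confines eigenvalues of power-bounded operators to the closed
    disc. *)
Lemma le1_of_powers_bounded (r M : R) : 0 <= r -> (forall n, r ^+ n <= M) -> r <= 1.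
Proof.
move=> r0 rM; rewrite leNgt; apply/negP => r1.
have M0 : 0 < M by rewrite (lt_le_trans ltr01)// (le_trans _ (rM 1%N))// ltW.
have ri : 0 <= r^-1 < 1 by rewrite invr_ge0 r0 invf_lt1// (lt_trans ltr01).
have p0 n : 0 <= M * r^-1 ^+ n by rewrite mulr_ge0 ?exprn_ge0// ?(ltW M0)// invr_ge0.
have [N HN] := (nullP p0).1 (cvg_geometric_null M ri) _ ltr01.
have := HN _ (leqnn N); rewrite exprVn ltr_pdivrMr ?exprn_gt0 ?(lt_trans ltr01)// mul1r.
by rewrite ltNge rM.
Qed.

Variable M : R.
Hypothesis TM : forall n x, rnorm (iter n T x) <= M * rnorm x.

Lemma resolvent_outside_disc (l : C) : 1 < normc l -> invertible (fun x => l *: x - T x).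
Proof.
move=> l1; have l0 : l != 0 by rewrite -normc_gt0 (lt_trans ltr01).
have bA : bounded_linear (fun x => l^-1 *: T x) by exact: bl_scale.
have q01 : 0 <= (normc l)^-1 < 1 by rewrite invr_ge0 normc_ge0 invf_lt1// (lt_trans ltr01).
have [|B [bB AB BA _]] := @neumann R X _ M (normc l)^-1 bA q01.
  move=> n x; rewrite iter_scale// rnormZ normcX normcV mulrAC mulrC.
  by rewrite ler_wpM2r// exprn_ge0// invr_ge0 normc_ge0.
have h : invertible (fun x => x - l^-1 *: T x) by exists B.
apply: invertible_eq (invertible_comp (invertible_scale X l0) h) => x.
by rewrite scalerBr scalerA mulfV// scale1r.
Qed.

Lemma resolvent_disc (z : C) : normc z < 1 -> invertible (fun x => x - z *: T x).
Proof.
move=> z1; have [||B [bB AB BA _]] := @neumann R X _ M (normc z) (bl_scale z bT).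
- by rewrite normc_ge0.
- move=> n x; rewrite iter_scale// rnormZ normcX mulrAC mulrC.
  by rewrite ler_wpM2r// exprn_ge0// normc_ge0.
- by exists B.
Qed.

Lemma resolvent_set_open (l : C) : invertible (fun x => l *: x - T x) ->
  exists2 d : R, 0 < d & forall m : C, normc (l - m) < d -> invertible (fun x => m *: x - T x).
Proof.
move=> [B [bB SB BS]]; have [_ [b b0 cB]] := bB.
exists (b + 1)^-1 => [|m lm]; first by rewrite invr_gt0 ltr_wpDl.
have : invertible (fun x => (l *: x - T x) - (l - m) *: x).
  apply: (perturbation _ _ bB SB BS b0 (normc_ge0 (l - m)) cB).
  - by apply: bl_sub => //; apply: bl_scale; exact: bl_id.
  - by apply: bl_scale; exact: bl_id.
  - by move=> x; rewrite rnormZ.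
  - have b1 : 0 < b + 1 by rewrite ltr_wpDl.
    move: lm; rewrite -[(b + 1)^-1]mul1r ltr_pdivlMr// => lm.
    have := normc_ge0 (l - m); nra.
by apply: invertible_eq => x; rewrite scalerBl opprB addrC addrA subrK.
Qed.

Lemma poly_op_sum n (F : nat -> {poly C}) x :
  poly_op (\sum_(k < n) F k) x = \sum_(k < n) poly_op (F k) x.
Proof.
elim: n => [|n IH]; first by rewrite !big_ord0 /poly_op size_poly0 big_ord0.
by rewrite !big_ord_recr /= poly_opD IH.
Qed.

Lemma poly_op_monomial (c : C) n x : poly_op (c%:P * 'X^n) x = c *: iter n T x.
Proof.
elim: n x => [|n IH] x; first by rewrite expr0 mulr1 poly_opC.
by rewrite exprSr mulrA poly_opMX IH -iterSr.
Qed.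

(** Here y - z T y - z T (y - z T y) is (1 - z T)^2 y; the identity is
    [deriv_geometric_sum] for polynomials, evaluated at T. *)
Lemma resolvent_sq_sum (z : C) n y :
  \sum_(k < n) (k.+1%:R * z ^+ k) *: iter k T (y - z *: T y - z *: T (y - z *: T y)) =
  y - (n.+1%:R * z ^+ n) *: iter n T y + (n%:R * z ^+ n.+1) *: iter n.+1 T y.
Proof.
pose u : {poly C} := z%:P * 'X.
have uE x : poly_op (1 - u) x = x - z *: T x.
  by rewrite /u poly_opD poly_opN mul_polyC poly_opZ poly_opX -(polyC1 C) poly_opC scale1r.
have mE k : (k.+1%:R * u ^+ k : {poly C}) = (k.+1%:R * z ^+ k)%:P * 'X^k.
  by rewrite /u exprMn polyCM rmorph_nat rmorphXn mulrA.
transitivity (poly_op ((1 - u) ^+ 2 * \sum_(k < n) k.+1%:R * u ^+ k) y).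
  rewrite mulrC poly_opM expr2 poly_opM !uE (poly_op_sum n (fun k => k.+1%:R * u ^+ k)); apply: eq_bigr => k _.
  by rewrite mE poly_op_monomial.
rewrite deriv_geometric_sum !poly_opD poly_opN -(polyC1 C) poly_opC scale1r; congr (_ - _ + _).
  by rewrite mE poly_op_monomial.
by rewrite /u exprMn -polyC_natr -rmorphXn mulrA -polyCM poly_op_monomial.
Qed.

Lemma resolvent_sq_series (z : C) y : normc z < 1 ->
  rnorm (\sum_(k < n) (k.+1%:R * z ^+ k) *: iter k T (y - z *: T y - z *: T (y - z *: T y)) - y)
    @[n --> \oo] --> (0 : R).
Proof.
move=> z1; have z01 : 0 <= normc z < 1 by rewrite normc_ge0.
apply: (null_leS _ _ (nullM (2 * (M * rnorm y)) (natmul_geometric_null z01))) => n.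
  exact: rnorm_ge0.
rewrite resolvent_sq_sum addrAC [y - _]addrC addrK addrC.
rewrite (le_trans (rnormB _ _))// !rnormZ !normcM !nat_normc !normcX.
have t1 := TM n.+1 y; have t2 := TM n y; have x0 := exprn_ge0 n (normc_ge0 z).
have h1 : n%:R * normc z ^+ n.+1 <= n.+1%:R * normc z ^+ n.
  apply: ler_pM; rewrite ?exprn_ge0 ?normc_ge0 ?ler_nat//.
  by rewrite exprS ler_piMl// ltW.
have x1 : 0 <= n%:R * normc z ^+ n.+1 by rewrite mulr_ge0 ?exprn_ge0 ?normc_ge0.
have x2 : 0 <= n.+1%:R * normc z ^+ n by rewrite mulr_ge0.
have MY : 0 <= M * rnorm y by rewrite (le_trans _ t2) ?rnorm_ge0.
have g1 := ler_pM x1 (rnorm_ge0 _) h1 t1; have g2 := ler_wpM2l x2 t2.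
rewrite (le_trans (lerD g1 g2))// le_eqVlt; apply/orP; left; apply/eqP; ring.
Qed.

End spectral_theory.

(** * Power-bounded operators and growth of powers *)

Section power_bounded_operators.
Context (R : realType) (X : completeNormedModType R[i]).
Local Notation C := R[i].
Local Notation mu := (@lebesgue_measure R).

Lemma power_boundedP (T : blinear X X) : power_bounded T ->
  exists2 M : R, 0 <= M & forall n x, rnorm (iter n T x) <= M * rnorm x.
Proof.
rewrite /power_bounded => pT; set s := ereal_sup _ in pT.
have sup_le n x : rnorm x <= 1 -> ((rnorm (iter n T x))%:E <= s)%E.
  move=> x1; apply: (@le_trans _ _ (opnorm (iter n T))).
    by apply: ereal_sup_ubound; exists x.
  by apply: ereal_sup_ubound; exists n.
have [M sM] : exists M : R, s = M%:E.
  case: s pT sup_le => [M _ _|//|_ h]; first by exists M.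
  by have := h 0%N 0; rewrite rnorm0 => /(_ ler01).
rewrite {}sM in sup_le.
have M0 : 0 <= M.
  by have := sup_le 0%N 0; rewrite rnorm0 lee_fin => /(_ ler01).
exists M => // n x; have [->|x0] := eqVneq x 0.
  by rewrite (bl0 (bl_iter n (blinear_bounded_linear T))) rnorm0 mulr0.
have xp : 0 < rnorm x.
  by rewrite lt_def rnorm_ge0 andbT; apply: contra_neq x0 => /rnorm0_eq0.
have := sup_le n ((rnorm x)^-1%:C *: x).
rewrite (blZ (bl_iter n (blinear_bounded_linear T))) !rnormZ normcR gtr0_norm ?invr_gt0//.
rewrite mulVf ?gt_eqF// lee_fin => /(_ (lexx _)).
by rewrite mulrC ler_pdivrMr.
Qed.

Lemma spectrumP (T : blinear X X) (l : C) :
  spectrum T l <-> ~ invertible (fun x => l *: x - T x).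
Proof. by rewrite /spectrum /=; split=> h i; apply: h; apply/invertibleP. Qed.

Lemma spectrum_closed (T : blinear X X) : closed (spectrum T : set C^o).
Proof.
rewrite -[spectrum T]setCK; apply: open_closedC.
rewrite openE => l /= lT.
have inv : invertible (fun x => l *: x - T x).
  by apply: contrapT => h; apply: lT; apply/spectrumP.
have [d d0 Hd] := resolvent_set_open (blinear_bounded_linear T) inv.
apply/nbhs_ballP; exists d%:C; first by rewrite /= ltcR.
move=> m; rewrite -ball_normE /= normrC ltcR => lm /spectrumP; apply.
exact: Hd.
Qed.

Variables (T : blinear X X) (M : R).
Hypothesis M0 : 0 <= M.
Hypothesis TM : forall n x, rnorm (iter n T x) <= M * rnorm x.
Let bT := blinear_bounded_linear T.

Lemma spectrum_in_disc l : spectrum T l -> normc l <= 1.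
Proof.
move=> /spectrumP sl; rewrite leNgt; apply/negP => l1; apply: sl.
exact: resolvent_outside_disc bT _ TM _ l1.
Qed.

(** The scalar functions of the resolvent in the definition of the calculus
    have coefficients (n+1) t (n+1) with t n = xs (T^n x), as required by
    [besov_approximation]. *)
Lemma T_resolvent_sq_series (xs : dual X) x (z : C) : normc z < 1 ->
  normc (\sum_(k < n) k.+1%:R * xs (iter k.+1 T x) * z ^+ k - xs (T_resolvent_sq T z x))
    @[n --> \oo] --> (0 : R).
Proof.
move=> z1; rewrite /T_resolvent_sq.
have [_ BI] := op_inv_invertible (resolvent_disc bT TM z1).
set B := op_inv _ in BI *; set y := B (B x).
have xE : x = y - z *: T y - z *: T (y - z *: T y) by rewrite !BI.
have bxs := blinear_bounded_linear xs; have [_ [c c0 cxs]] := bxs.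
have [_ [d d0 cT]] := bT.
apply: (null_leS _ _ (nullM (c * d) (resolvent_sq_series bT TM y z1))) => n.
  exact: normc_ge0.
rewrite -xE -rnorm_scalar.
have -> : \sum_(k < n) k.+1%:R * xs (iter k.+1 T x) * z ^+ k - xs (T y) =
    xs (T (\sum_(k < n) (k.+1%:R * z ^+ k) *: iter k T x - y)).
  rewrite (blB bT) (blB bxs) (bl_sum bT) (bl_sum bxs); congr (_ - _).
  apply: eq_bigr => k _; rewrite (blZ bT) (blZ bxs) iterS.
  by rewrite -[RHS]/(_ * _) mulrAC.
rewrite (le_trans (cxs _))// -mulrA ler_wpM2l//.
Qed.

Lemma dGSF_bound (xs : dual X) x : dGSF T -> exists2 Cg : R, 0 <= Cg &
  forall s, 0 < s < 1 ->
    \int[mu]_(v in `[- pi, pi]) normc (xs (T_resolvent_sq T (polar s v) x)) <= Cg / (1 - s).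
Proof.
move=> /(_ x xs); set S := ereal_sup _ => Sfin.
have Sle s : 0 < s < 1 -> ((1 - s)%:E * \int[mu]_(v in `[(- pi)%R, pi%R])
    (normc (xs (T_resolvent_sq T (polar s v) x)))%:E <= S)%E.
  by move=> s01; apply: ereal_sup_ubound; exists s.
have [Cg SE] : exists Cg : R, S = Cg%:E.
  case: S Sfin Sle => [Cg _ _|//|_ h]; first by exists Cg.
  have h2 : 0 < (2^-1 : R) < 1 by rewrite invr_gt0 ltr0n invf_lt1// ltr1n.
  have := h _ h2; rewrite leeNy_eq => /eqP h3.
  have : (0 <= (1 - 2^-1)%:E * \int[mu]_(v in `[(- pi)%R, pi%R])
    (normc (xs (T_resolvent_sq T (polar 2^-1 v) x)))%:E)%E.
    apply: mule_ge0; first by rewrite lee_fin subr_ge0 ltW//; case/andP: h2.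
    by apply: integral_ge0 => v _; rewrite lee_fin normc_ge0.
  by rewrite h3.
rewrite {}SE in Sle; exists `|Cg| => // s s01; have [s0 s1] := andP s01.
have d0 : 0 < 1 - s by rewrite subr_gt0.
rewrite ler_pdivlMr// mulrC (le_trans _ (ler_norm Cg))//.
have := Sle s s01; rewrite /Rintegral.
set I := integral _ _ _; have I0 : (0 <= I)%E by apply: integral_ge0 => v _; rewrite lee_fin normc_ge0.
case: I I0 => [r _|_|//].
- by rewrite -EFinM lee_fin.
- by rewrite gt0_muley ?lte_fin.
Qed.

End power_bounded_operators.

Section growth.
Context (R : realType) (X : completeNormedModType R[i]).
Local Notation C := R[i].

(** The function w |-> xs ((1 - w A)^-1 x) is holomorphic on the unit disc,
    with Taylor coefficients xs (A^n x), as seen near 0. These coefficients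
    times r^n are bounded for r < 1, and uniform boundedness makes the bound
    independent of x and xs. *)
Lemma resolvent_power_growth (A : X -> X) (r : R) : bounded_linear A ->
  (forall w : C, normc w < 1 -> invertible (fun x => x - w *: A x)) -> 0 < r < 1 ->
  exists2 K : R, 0 <= K & forall n x, rnorm (iter n A x) * r ^+ n <= K * rnorm x.
Proof.
move=> bA invA r01; have [_ [a a0 cA]] := bA; have [r0 r1] := andP r01.
pose Rw (w : C) : X -> X := op_inv (fun x => x - w *: A x).
have RwE w : normc w < 1 -> cancel (fun x => x - w *: A x) (Rw w) /\
    cancel (Rw w) (fun x => x - w *: A x).
  by move=> w1; exact: op_inv_invertible (invA w w1).
have bRw w : bounded_linear (Rw w) by exact: blinear_bounded_linear.
(* the resolvent at w + h is at most twice as large as at w, and its difference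
   quotient converges with a quadratic remainder *)
have quad w x : normc w < 1 -> exists2 d : R, 0 < d & exists2 Q : R, 0 <= Q &
    forall h, normc h < d -> rnorm (Rw (w + h) x - Rw w x - h *: Rw w (A (Rw w x))) <=
      Q * normc h ^+ 2.
  move=> w1; have [_ [b b0 cR]] := bRw w.
  have [d1 d10 d1w] : exists2 d1 : R, 0 < d1 & normc w + d1 <= 1.
    by exists (1 - normc w); rewrite ?subr_gt0// addrC subrK.
  have ab1 : 0 < 2 * (a * b + 1) by rewrite mulr_gt0// ltr_wpDl// mulr_ge0.
  exists (Num.min d1 (2 * (a * b + 1))^-1); first by rewrite lt_min d10 invr_gt0.
  exists (2 * b * (a * (b * (a * (b * rnorm x))))) => [|h].
    by rewrite !mulr_ge0// rnorm_ge0.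
  rewrite lt_min => /andP[h1]; rewrite -[_^-1]mul1r ltr_pdivlMr// => h2.
  have wh1 : normc (w + h) < 1 by have := normcD w h; lra.
  have [RA AR] := RwE w w1; have [RhA ARh] := RwE (w + h) wh1.
  have whb y : rnorm (Rw (w + h) y) <= 2 * b * rnorm y.
    set v := Rw (w + h) y.
    have vE : v = Rw w (y + h *: A v).
      rewrite -[LHS](RA v); congr (Rw w _).
      by have := ARh y; rewrite -/v => {1}<-; rewrite scalerDl opprD addrA subrK.
    have : rnorm v <= b * (rnorm y + normc h * (a * rnorm v)).
      rewrite {1}vE (le_trans (cR _))// ler_wpM2l// (le_trans (rnormD _ _))// lerD2l rnormZ.
      by rewrite ler_wpM2l ?normc_ge0.
    have hab : normc h * (a * b) <= 2^-1 by have := normc_ge0 h; lra.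
    have := ler_wpM2r (rnorm_ge0 v) hab; move: (normc h) (rnorm v) (rnorm y) => H V Y; lra.
  have -> : Rw (w + h) x - Rw w x - h *: Rw w (A (Rw w x)) =
      (h ^+ 2) *: Rw (w + h) (A (Rw w (A (Rw w x)))).
    have first y : Rw (w + h) y - Rw w y = h *: Rw (w + h) (A (Rw w y)).
      set u := Rw w y; have uE : u - w *: A u = y by exact: AR.
      have {1}-> : y = (u - (w + h) *: A u) + h *: A u.
        by rewrite scalerDl opprD addrA subrK.
      by rewrite (blD (bRw _)) (blZ (bRw _)) [Rw _ (u - _)]RhA addrAC subrr add0r.
    rewrite first -scalerBr first scalerA.
    by rewrite expr2.
  rewrite rnormZ normcX mulrC ler_wpM2r ?sqr_ge0// (le_trans (whb _))//.
  rewrite ler_wpM2l ?mulr_ge0// (le_trans (cA _))// ler_wpM2l// (le_trans (cR _))// ler_wpM2l//.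
  by rewrite (le_trans (cA _))// ler_wpM2l.
have weak x (xs : dual X) : exists K, forall n, normc (xs (iter n A x)) * r ^+ n <= K.
  have bxs := blinear_bounded_linear xs; have [_ [c c0 cxs]] := bxs.
  have phiD w : normc w < 1 -> exists l, cderiv (fun w => xs (Rw w x)) w l.
    move=> w1; have [d d0 [Q Q0 HQ]] := quad w x w1.
    exists (xs (Rw w (A (Rw w x)))) => e e0.
    have cQ : 0 < c * Q + 1 by rewrite ltr_wpDl// mulr_ge0.
    exists (Num.min d (e / (c * Q + 1))); first by rewrite lt_min d0 divr_gt0.
    move=> h; rewrite lt_min ltr_pdivlMr// => /andP[hd he].
    have -> : xs (Rw (w + h) x) - xs (Rw w x) - xs (Rw w (A (Rw w x))) * h =
        xs (Rw (w + h) x - Rw w x - h *: Rw w (A (Rw w x))).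
      by rewrite !(blB bxs) (blZ bxs) -[h *: xs _]/(h * _) [h * _]mulrC.
    rewrite -rnorm_scalar (le_trans (cxs _))// (le_trans (ler_wpM2l c0 (HQ h hd)))//.
    rewrite expr2 !mulrA ler_wpM2r ?normc_ge0//; have := normc_ge0 h; lra.
  have [cf [cfK cfT]] := taylor phiD.
  suff cfE n : cf n = xs (iter n A x).
    by have [K HK] := cfK r r01; exists K => n; rewrite -cfE.
  have a1 : 0 < a + 1 by rewrite ltr_wpDl.
  pose rho : R := (2 * (a + 1))^-1.
  have rho0 : 0 < rho by rewrite invr_gt0 mulr_gt0.
  have rho1 : rho <= 2^-1 by rewrite lef_pV2 ?posrE ?mulr_gt0// ler_peMr// lerDr.
  have arho : a * rho <= 2^-1.
    rewrite /rho invfM mulrCA ler_piMr ?invr_ge0// ler_pdivrMr// mul1r lerDl//.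
  have [K1 HK1] : exists K, forall n, normc (cf n) * rho ^+ n <= K.
    have h2 : 0 < (2^-1 : R) < 1 by rewrite invr_gt0 ltr0n invf_lt1// ltr1n.
    have [K HK] := cfK _ h2; exists K => k; rewrite (le_trans _ (HK k))//.
    rewrite ler_wpM2l ?normc_ge0//; apply: lerXn2r; rewrite ?nnegrE ?(ltW rho0) ?invr_ge0//.
  have xsA k : normc (xs (iter k A x)) <= c * rnorm x * a ^+ k.
    rewrite -rnorm_scalar (le_trans (cxs _))// -mulrA ler_wpM2l// mulrC.
    exact: iter_bound.
  apply/eqP; rewrite -subr_eq0; apply/eqP.
  apply: (@power_series_unique R (fun n => cf n - xs (iter n A x)) rho (K1 + c * rnorm x)) => //.
    move=> k; rewrite (le_trans (ler_wpM2r _ (normcB _ _))) ?exprn_ge0 ?(ltW rho0)//.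
    rewrite mulrDl lerD// (le_trans (ler_wpM2r _ (xsA k))) ?exprn_ge0 ?(ltW rho0)//.
    rewrite -[leLHS]mulrA -exprMn ler_piMr ?mulr_ge0 ?rnorm_ge0// exprn_ile1 ?mulr_ge0 ?(ltW rho0)//.
    by rewrite (le_trans arho)// invf_le1// ler1n.
  move=> w wrho; have w1 : normc w < 1.
    by rewrite (lt_le_trans wrho)// (le_trans rho1)// invf_le1// ler1n.
  have aw01 : 0 <= a * normc w < 1.
    rewrite mulr_ge0 ?normc_ge0//= (le_lt_trans (ler_wpM2l a0 (ltW wrho)))//.
    by rewrite (le_lt_trans arho)// invf_lt1// ltr1n.
  have [|B [bB AB BA HB]] := @neumann R X (fun x => w *: A x) 1 (a * normc w) (bl_scale w bA) aw01.
    move=> k y; rewrite mul1r; apply: iter_bound; first by case/andP: aw01.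
    by move=> v; rewrite rnormZ mulrC [leRHS]mulrAC ler_wpM2r ?normc_ge0.
  have BE : B x = Rw w x.
    by have [RA _] := RwE w w1; rewrite -[in RHS](BA x) RA.
  have gT := geometric_bound_null 1 aw01.
  apply: (null_leS _ _ (nullD (cfT w w1) (nullM (c * rnorm x) gT))) => m; first exact: normc_ge0.
  have -> : \sum_(k < m) (cf k - xs (iter k A x)) * w ^+ k =
     (\sum_(k < m) cf k * w ^+ k - xs (Rw w x)) +
     xs (B x - \sum_(k < m) iter k (fun y => w *: A y) x).
    rewrite (blB bxs) BE addrA subrK (bl_sum bxs) -sumrB; apply: eq_bigr => k _.
    by rewrite iter_scale// (blZ bxs) mulrBl -[_ *: xs _]/(_ * _) [w ^+ k * _]mulrC.
  rewrite (le_trans (normcD _ _))// lerD2l -rnorm_scalar (le_trans (cxs _))//.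
  rewrite -mulrA ler_wpM2l//; rewrite [leRHS]mulrC; exact: HB.
have exS n : exists S : blinear X X, S =1 (fun x => (r ^+ n)%:C *: iter n A x).
  by apply: bounded_linear_blinear; apply: bl_scale; exact: bl_iter.
have [S SE] := choice exS.
have [x xs|K K0 HK] := weakly_bounded_operators (S := S).
  have [K HK] := weak x xs; exists K => n.
  rewrite SE (blZ (blinear_bounded_linear xs)) -[_ *: xs _]/(_ * _) normcM normcR mulrC.
  by rewrite ger0_norm ?exprn_ge0 ?(ltW r0).
exists K => // n x; have := HK n x; rewrite SE rnormZ normcR mulrC.
by rewrite ger0_norm ?exprn_ge0 ?(ltW r0).
Qed.

End growth.

(** * The functional calculus *)

Section calculus.
Context (R : realType) (X : completeNormedModType R[i]).
Local Notation C := R[i].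
Variables (T : blinear X X) (f : C^o -> C^o).
Hypotheses (pT : power_bounded T) (gT : dGSF T) (bf : besov f).
Let bT := blinear_bounded_linear T.
Local Notation d k := (k.+1%:R^-1 : R).

Let d0 k : 0 < d k. Proof. by rewrite invr_gt0 ltr0n. Qed.
Let dT : d k @[k --> \oo] --> (0 : R). Proof. exact: cvg_harmonic. Qed.

(** The dGSF condition enters only through the constant K, which depends on x
    and xs, while the polynomials and the rate do not. *)
Lemma weak_approximation : exists p : nat -> {poly C},
  [/\ forall k, (1 < size (p k))%N,
      forall z, normc z <= 1 -> forall k, normc (disc_ext f z - (p k).[z]) <= d k &
      forall x (xs : dual X), exists2 K : R, 0 <= K & forall k,
        normc (calculus_form f (xs x) (fun z => xs (T_resolvent_sq T z x)) -
          xs (poly_op T (p k) x)) <= K * d k].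
Proof.
have [p [e [eT e0 psz pf He]]] := besov_approximation bf.
(* a subsequence with the monotone rate 1 / (k+1), as needed for Cauchy sequences *)
have exN k : exists n, e n <= d k.
  have [N HN] := (nullP (fun n => ltW (e0 n))).1 eT _ (d0 k).
  by exists N; rewrite ltW// HN.
have [ph Hph] := choice exN; exists (p \o ph); split => /=.
- by move=> k; exact: psz.
- by move=> z z1 k; rewrite (le_trans (pf _ z1 _)).
move=> x xs; have [M M0 TM] := power_boundedP pT.
have bxs := blinear_bounded_linear xs; have [_ [c c0 cxs]] := bxs.
have [Cg Cg0 HCg] := dGSF_bound xs x gT.
have tK n : normc (xs (iter n T x)) <= c * (M * rnorm x).
  by rewrite -rnorm_scalar (le_trans (cxs _))// ler_wpM2l.
have gE z : normc z < 1 -> _ := fun z1 => T_resolvent_sq_series TM xs x z1.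
have K0 : 0 <= c * (M * rnorm x) by rewrite !mulr_ge0// rnorm_ge0.
exists (c * (M * rnorm x) + Cg) => [|k]; first exact: addr_ge0.
have := He (fun n => xs (iter n T x)) (fun z => xs (T_resolvent_sq T z x)) _ Cg tK gE Cg0 HCg (ph k).
have -> : \sum_(j < size (p (ph k))) (p (ph k))`_j * xs (iter j T x) = xs (poly_op T (p (ph k)) x).
  by rewrite /poly_op (bl_sum bxs); apply: eq_bigr => j _; rewrite (blZ bxs).
by move=> /le_trans; apply; rewrite ler_wpM2l// addr_ge0.
Qed.

(** The operators (P m - P n) / (d m + d n) are weakly bounded, hence bounded:
    the P n form a Cauchy sequence in operator norm with a rate. The limit
    satisfies the equation defining f(T), and functionals separate points, so
    it is f(T). *)
Lemma calculus_approximation : exists (p : nat -> {poly C}) (K : R),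
  [/\ 0 <= K, forall k, (1 < size (p k))%N,
      forall z, normc z <= 1 -> forall k, normc (disc_ext f z - (p k).[z]) <= d k &
      forall k x, rnorm (calculus T f x - poly_op T (p k) x) <= K * d k * rnorm x].
Proof.
have [p [psz pf weak]] := weak_approximation.
have bP k := bl_poly_op bT (p k).
have exS (i : nat * nat) : exists S : blinear X X,
    S =1 (fun x => (d i.1 + d i.2)^-1%:C *: (poly_op T (p i.1) x - poly_op T (p i.2) x)).
  by apply: bounded_linear_blinear; apply: bl_scale; exact: bl_sub.
have [S SE] := choice exS.
have dd m n : 0 < d m + d n by rewrite addr_gt0.
have [x xs|K K0 HK] := weakly_bounded_operators (S := S).
  have [K K0 HK] := weak x xs; exists K => -[m n].
  have bxs := blinear_bounded_linear xs.
  rewrite SE (blZ bxs) (blB bxs) -[_ *: _]/(_ * _) normcM normcR gtr0_norm ?invr_gt0//=.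
  rewrite mulrC ler_pdivrMr// mulrDr.
  have h1 := HK m; have h2 := HK n; rewrite normc_distC in h1.
  by rewrite (le_trans (normc_distD _ _ _) (lerD h1 h2)).
have PK m n x : rnorm (poly_op T (p m) x - poly_op T (p n) x) <= K * (d m + d n) * rnorm x.
  have := HK (m, n) x; rewrite SE rnormZ normcR gtr0_norm ?invr_gt0//= mulrC ler_pdivrMr//.
  by rewrite mulrAC.
have dle m n : (n <= m)%N -> d m <= d n by move=> nm; rewrite lef_pV2 ?posrE ?ltr0n// ler_nat.
have exL x : exists l, forall n, rnorm (l - poly_op T (p n) x) <= 2 * K * d n * rnorm x.
  have eT : (2 * K * rnorm x) * d n @[n --> \oo] --> (0 : R) by exact: nullM.
  have [|l [Hl _]] := Cauchy_rnorm (u := fun n => poly_op T (p n) x) eT.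
    move=> m n nm; rewrite (le_trans (PK _ _ _))//.
    have -> : 2 * K * rnorm x * d n = K * rnorm x * (2 * d n) by ring.
    rewrite mulrAC ler_wpM2l ?mulr_ge0 ?rnorm_ge0//.
    by move: (d m) (d n) (dle _ _ nm) => u v; lra.
  by exists l => n; rewrite mulrAC.
have [L HL] := choice exL.
have bL : bounded_linear L.
  by apply: (limit_bounded_linear bP (nullM (2 * K) dT)) => n x; exact: HL.
have [S' S'E] := bounded_linear_blinear bL.
have S'c : is_calculus T f S'.
  move=> x xs; have [Kx Kx0 HKx] := weak x xs.
  have bxs := blinear_bounded_linear xs; have [_ [c c0 cxs]] := bxs.
  apply/eqP; rewrite -subr_eq0 -normc_eq0; apply/eqP.
  apply: (null_ge0_eq _ _ (nullM (c * (2 * K * rnorm x) + Kx) dT)) => [|n]; first exact: normc_ge0.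
  rewrite (le_trans (normc_distD (xs (poly_op T (p n) x)) _ _))// [leRHS]mulrDl; apply: lerD.
    rewrite -(blB bxs) -rnorm_scalar (le_trans (cxs _))// -[leRHS]mulrA ler_wpM2l//.
    by rewrite S'E [leRHS]mulrAC; exact: HL.
  by rewrite normc_distC; exact: HKx.
have Cc : is_calculus T f (calculus T f) by apply: (@getPex _ (is_calculus T f)); exists S'.
have CE x : calculus T f x = L x.
  apply/eqP; rewrite -subr_eq0; apply/eqP/rnorm0_eq0.
  have [phi [ph1 _]] := norming_functional (calculus T f x - L x).
  have : phi (calculus T f x - L x) = 0.
    by rewrite (blB (blinear_bounded_linear phi)) -S'E (Cc x phi) (S'c x phi) subrr.
  by rewrite ph1 => -[].
exists p, (2 * K); split => //; first exact: mulr_ge0.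
by move=> k x; rewrite CE; exact: HL.
Qed.

(** A single polynomial is close to f on the closed disc and, in operator
    norm, to f(T). All parts of the theorem are deduced from such polynomials.
    *)
Lemma polynomial_approximation (e : R) : 0 < e -> exists p : {poly C},
  [/\ (1 < size p)%N, forall z, normc z <= 1 -> normc (disc_ext f z - p.[z]) <= e &
      forall x, rnorm (calculus T f x - poly_op T p x) <= e * rnorm x].
Proof.
move=> e0; have [p [K [K0 psz pf pT']]] := calculus_approximation.
have K1 n : 0 <= (K + 1) * d n by rewrite mulr_ge0 ?(ltW (d0 n))// addr_ge0.
have [N HN] := (nullP K1).1 (nullM (K + 1) dT) _ e0.
have [h1 h2] : K * d N <= e /\ d N <= e.
  have := HN _ (leqnn N); move: (d N) (d0 N) => u u0; rewrite mulrDl mul1r => h.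
  have h3 := mulr_ge0 K0 (ltW u0).
  by split; rewrite ltW// (le_lt_trans _ h)// ?lerDl ?lerDr ?(ltW u0).
exists (p N); split => // [z z1|x]; first by rewrite (le_trans (pf _ z1 _)).
by rewrite (le_trans (pT' _ _))// ler_wpM2r ?rnorm_ge0.
Qed.

(** For a polynomial, p(T) x - p(l) x is q(T) (T x - l x); the error made by
    replacing f by p is at most e times the norm of x. *)
Lemma calculus_eigen_estimate (l : C) (e : R) : normc l <= 1 -> 0 < e ->
  exists2 c : R, 0 <= c & forall x,
    rnorm (calculus T f x - disc_ext f l *: x) <= e * rnorm x + c * rnorm (T x - l *: x).
Proof.
move=> l1 e0; have e2 : 0 < e / 2 by rewrite divr_gt0.
have [p [_ pf pT']] := polynomial_approximation e2.
have [q Hq] := poly_op_horner bT p l.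
have [_ [c c0 cq]] := bl_poly_op bT q; exists c => // x.
have [qx _] := Hq x.
have n1 := rdistD (poly_op T p x) (calculus T f x) (disc_ext f l *: x).
have n2 := rdistD (p.[l] *: x) (poly_op T p x) (disc_ext f l *: x).
have h1 := pT' x.
have h2 : rnorm (p.[l] *: x - disc_ext f l *: x) <= e / 2 * rnorm x.
  by rewrite -scalerBl rnormZ normc_distC ler_wpM2r ?rnorm_ge0// pf.
have h3 : rnorm (poly_op T p x - p.[l] *: x) <= c * rnorm (T x - l *: x).
  by rewrite rdistC qx [rnorm (T x - _)]rdistC.
move: (rnorm x) (c * _) h1 h2 h3 => X1 Y h1 h2 h3; lra.
Qed.

Lemma calculus_dual_eigen (l : C) (xs : dual X) x : normc l <= 1 ->
  (forall y, xs (T y) = l * xs y) -> xs (calculus T f x) = disc_ext f l * xs x.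
Proof.
move=> l1 xT; have bxs := blinear_bounded_linear xs; have [_ [c c0 cxs]] := bxs.
apply/eqP; rewrite -subr_eq0 -normc_eq0; apply/eqP/le_anti; rewrite normc_ge0 andbT.
apply/ler_addgt0Pr => e e0; rewrite add0r.
have k0 : 0 < 2 * (c * rnorm x) + 1 by rewrite ltr_wpDl// !mulr_ge0// rnorm_ge0.
have [|p [_ pf pT']] := @polynomial_approximation (e / (2 * (c * rnorm x) + 1)).
  by rewrite divr_gt0.
have [q Hq] := poly_op_horner bT p l.
have xp : xs (poly_op T p x) = p.[l] * xs x.
  have [_ qx] := Hq x.
  apply/eqP; rewrite eq_sym -subr_eq0 -[p.[l] * _]/(p.[l] *: xs x) -(blZ bxs) -(blB bxs) qx.
  by rewrite (blB bxs) (blZ bxs) xT subrr.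
have -> : xs (calculus T f x) - disc_ext f l * xs x =
    xs (calculus T f x - poly_op T p x) + (p.[l] - disc_ext f l) * xs x.
  by rewrite (blB bxs) xp mulrBl addrA subrK.
rewrite (le_trans (normcD _ _))// normcM normc_distC.
move: (pf l l1) (pT' x) k0; set a := e / _ => h1 h2 k0.
have ae : a * (2 * (c * rnorm x) + 1) = e by rewrite /a divfK// gt_eqF.
have a0 : 0 < a by rewrite divr_gt0.
have h3 : normc (xs (calculus T f x - poly_op T p x)) <= c * (a * rnorm x).
  by rewrite -rnorm_scalar (le_trans (cxs _))// ler_wpM2l.
have h4 : normc (disc_ext f l - p.[l]) * normc (xs x) <= a * (c * rnorm x).
  by apply: ler_pM; rewrite ?normc_ge0// -rnorm_scalar.
rewrite (le_trans (lerD h3 h4))// -ae.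
have -> : c * (a * rnorm x) + a * (c * rnorm x) = a * (2 * (c * rnorm x)) by ring.
by rewrite ler_wpM2l ?(ltW a0)// lerDl.
Qed.

Lemma calculus_commutes x : calculus T f (T x) = T (calculus T f x).
Proof.
have [_ [c c0 cT]] := bT.
apply/eqP; rewrite -subr_eq0; apply/eqP/rnorm0_eq0/le_anti; rewrite rnorm_ge0 andbT.
apply/ler_addgt0Pr => e e0; rewrite add0r.
have k0 : 0 < 2 * (c * rnorm x) + 1 by rewrite ltr_wpDl// !mulr_ge0// rnorm_ge0.
have [|p [_ _ pT']] := @polynomial_approximation (e / (2 * (c * rnorm x) + 1)).
  by rewrite divr_gt0.
have -> : calculus T f (T x) - T (calculus T f x) =
  (calculus T f (T x) - poly_op T p (T x)) - T (calculus T f x - poly_op T p x).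
  by rewrite (blB bT) poly_opT// opprB addrA subrK.
rewrite (le_trans (rnormB _ _))//.
move: (pT' (T x)) (pT' x); set a := e / _ => h1 h2.
have ae : a * (2 * (c * rnorm x) + 1) = e by rewrite /a divfK// gt_eqF.
have a0 : 0 < a by rewrite divr_gt0.
have h3 := le_trans h1 (ler_wpM2l (ltW a0) (cT x)).
have h4 := le_trans (cT _) (ler_wpM2l c0 h2).
rewrite (le_trans (lerD h3 h4))// -ae.
have -> : a * (c * rnorm x) + c * (a * rnorm x) = a * (2 * (c * rnorm x)) by ring.
by rewrite ler_wpM2l ?(ltW a0)// lerDl.
Qed.

(** For a close polynomial p, the operator p(l) - p(T) is invertible as well,
    and it has the commuting factor l - T. *)
Lemma invertible_calculus_resolvent (l : C) : normc l <= 1 ->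
  invertible (fun x => disc_ext f l *: x - calculus T f x) ->
  invertible (fun x => l *: x - T x).
Proof.
move=> l1 [B [bB SB BS]]; have [_ [b b0 cB]] := bB.
pose e : R := (4 * (b + 1))^-1.
have e0 : 0 < e by rewrite invr_gt0 mulr_gt0// ltr_wpDl.
have eb : e * (4 * (b + 1)) = 1 by rewrite /e mulVf// gt_eqF// mulr_gt0// ltr_wpDl.
have [p [_ pf pT']] := polynomial_approximation e0.
have [q Hq] := poly_op_horner bT p l.
apply: (@invertible_factor _ _ _ (poly_op T q) (fun x => p.[l] *: x - poly_op T p x)).
- exact: bl_poly_op.
- by move=> x; have [] := Hq x.
- by move=> x; have [] := Hq x.
have bc := blinear_bounded_linear (calculus T f); have bp := bl_poly_op bT p.
have bid := bl_id X.
have : invertible (fun x => (disc_ext f l *: x - calculus T f x) -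
    ((disc_ext f l - p.[l]) *: x - (calculus T f x - poly_op T p x))).
  apply: (perturbation _ _ bB SB BS b0 (_ : 0 <= 2 * e) cB).
  - by apply: bl_sub => //; exact: bl_scale.
  - by apply: bl_sub; [exact: bl_scale|exact: bl_sub].
  - by rewrite mulr_ge0// ltW.
  - move=> x; rewrite (le_trans (rnormB _ _))// rnormZ.
    have h1 := pT' x; have h2 := ler_wpM2r (rnorm_ge0 x) (pf l l1).
    by rewrite (le_trans (lerD h2 h1))// mulr_natl mulr2n mulrDl.
  - nra.
apply: invertible_eq => x.
by rewrite sub_sub_sub -scalerBl !subKr.
Qed.

(** Choose p close to f. Then m - w - p(T) is invertible for all small w,
    since m - w - p has no zero on the spectrum. Hence B = (m - p(T))^-1 has
    powers that grow at most like those of the inverse of the gap, and the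
    perturbation E = f(T) - p(T), which commutes with B and is smaller than
    the gap, gives an invertible m - f(T) = (m - p(T)) (1 - B E). Closeness of
    p(T) to f(T) alone would not suffice, since the norm of B is not
    controlled by the distance of m to the spectrum of p(T). *)
Lemma calculus_resolvent_invertible (m : C) : ~ (disc_ext f @` spectrum T) m ->
  invertible (fun x => m *: x - calculus T f x).
Proof.
move=> nm; have [M M0 TM] := power_boundedP pT.
have [|z z1 e e0|g g0 gap] := image_gap (@spectrum_closed R X T) _ _ nm.
- exact: (spectrum_in_disc TM).
- have [|p [_ pf _]] := @polynomial_approximation (e / 3); first by rewrite divr_gt0.
  have [L [B [L0 _ HL]]] := poly_lipschitz p.
  have L1 : 0 < L + 1 by rewrite ltr_wpDl.
  exists (e / 3 / (L + 1)) => [|w w1 wz]; first by rewrite !divr_gt0.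
  have h1 := pf w w1; have h2 := pf z z1; have [_ h3] := HL w z w1 z1.
  have n1 := normc_distD p.[w] (disc_ext f w) (disc_ext f z).
  have n2 := normc_distD p.[z] p.[w] (disc_ext f z).
  rewrite [normc (_.[z] - _)]normc_distC in n2.
  move: wz; rewrite ltr_pdivlMr// => wz; have := normc_ge0 (w - z); nra.
(* g/2 of the gap is left for w after the error g/8 of the polynomial *)
pose de : R := g / 2; have de0 : 0 < de by rewrite divr_gt0.
have e0 : 0 < g / 8 by rewrite divr_gt0.
have [p [psz pf pT']] := polynomial_approximation e0.
have bc := blinear_bounded_linear (calculus T f); have bp := bl_poly_op bT p.
have bid := bl_id X.
(* the polynomial m - w - p has no zero on the spectrum when w is small *)
have invp w : normc w < de -> invertible (fun x => (m - w) *: x - poly_op T p x).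
  move=> wd; have := @poly_op_invertible R X T bT ((m - w)%:P - p) _ _.
  move=> H; have {}H : invertible (poly_op T ((m - w)%:P - p)).
    apply: H => [|l].
      apply: contraTneq psz => /eqP; rewrite subr_eq0 => /eqP <-.
      by rewrite -leqNgt size_polyC_leq1.
    rewrite rootE hornerD hornerN hornerC subr_eq0 => /eqP pl.
    apply: contrapT => /(spectrumP T l) ls.
    have h1 := gap l ls; have h2 := pf l (spectrum_in_disc TM ls).
    have n1 := normc_distD p.[l] m (disc_ext f l); rewrite normc_distC in h2.
    have mpE : m - p.[l] = w by rewrite -pl opprB addrC subrK.
    rewrite mpE in n1; rewrite /de in wd; lra.
  by apply: invertible_eq H => x; rewrite poly_opD poly_opN poly_opC.
have [B [bB SB BS]] : invertible (fun x => m *: x - poly_op T p x).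
  by have := invp 0; rewrite normc0 subr0; apply.
have bS : bounded_linear (fun x => m *: x - poly_op T p x).
  by apply: bl_sub => //; exact: bl_scale.
pose A x := de%:C *: B x.
have bA : bounded_linear A by exact: bl_scale.
have h2 : 0 < (2^-1 : R) < 1 by rewrite invr_gt0 ltr0n invf_lt1// ltr1n.
have [w w1|K K0 HK] := resolvent_power_growth bA _ h2.
  have wd : normc (w * de%:C) < de.
    by rewrite normcM normcR gtr0_norm// gtr_pMl.
  have invB : invertible B by exists (fun x => m *: x - poly_op T p x).
  apply: invertible_eq (invertible_comp invB (invp _ wd)) => x.
  have -> : (m - w * de%:C) *: x - poly_op T p x = (m *: x - poly_op T p x) - (w * de%:C) *: x.
    by rewrite scalerBl addrAC.
  by rewrite (blB bB) SB (blZ bB) /A scalerA.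
pose E x := calculus T f x - poly_op T p x.
have bE : bounded_linear E by exact: bl_sub.
have TE x : E (T x) = T (E x).
  by rewrite /E calculus_commutes poly_opT// (blB bT).
have SE x : E (m *: x - poly_op T p x) = m *: E x - poly_op T p (E x).
  by rewrite (blB bE) (blZ bE) (poly_op_comm p x bE).
have BE x : B (E x) = E (B x).
  by rewrite -{1}(BS x) SE SB.
(* the powers of B grow like (4/g)^n and those of E like (g/8)^n *)
have de2 : g / 4 = de * 2^-1 by rewrite /de; field.
have [||Q [bQ SQ QS _]] := @neumann R X (fun x => B (E x)) K 2^-1 (bl_comp bB bE).
- by rewrite invr_ge0 ler0n invf_lt1// ltr1n.
- move=> n x; rewrite (iter_comp BE).
  have h3 := HK n (iter n E x).
  have h4 : rnorm (iter n E x) <= (g / 8) ^+ n * rnorm x by apply: iter_bound => //; exact: ltW.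
  move: h3; rewrite /A iter_scale// rnormZ normcX normcR (gtr0_norm de0) mulrAC -exprMn -de2 => h3.
  have g4 : 0 < (g / 4) ^+ n by rewrite exprn_gt0// divr_gt0.
  rewrite -(ler_pM2l g4) (le_trans h3)// (le_trans (ler_wpM2l K0 h4))//.
  have -> : (g / 8) ^+ n = (g / 4) ^+ n * 2^-1 ^+ n.
    by rewrite -exprMn; congr (_ ^+ n); field.
  by rewrite le_eqVlt; apply/orP; left; apply/eqP; ring.
have i1 : invertible (fun x => x - B (E x)) by exists Q.
have i2 : invertible (fun x => m *: x - poly_op T p x) by exists B.
apply: invertible_eq (invertible_comp i2 i1) => x.
by rewrite (blB bS) BS /E opprB addrA subrK.
Qed.

End calculus.

(** * The spectral mapping theorem *)

Theorem theorem3p8 (R : realType) (X : completeNormedModType R[i])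
    (T : blinear X X) (hT : power_bounded T) (hG : dGSF T)
    (f : R[i]^o -> R[i]^o) (hf : besov f) :
  spectrum (calculus T f) = disc_ext f @` spectrum T
  /\ forall l : R[i],
    (forall x : X, T x = l *: x -> calculus T f x = disc_ext f l *: x)
    /\ (forall xs : dual X,
          (forall x, adjoint T xs x = l *: xs x) ->
          forall x, adjoint (calculus T f) xs x = disc_ext f l *: xs x)
    /\ (forall x_ : nat -> X, (forall n, rnorm (x_ n) = 1) ->
          rnorm (T (x_ n) - l *: x_ n) @[n --> \oo] --> (0 : R) ->
          rnorm (calculus T f (x_ n) - disc_ext f l *: x_ n) @[n --> \oo]
            --> (0 : R)).
Proof.
have [M M0 TM] := power_boundedP hT; have bT := blinear_bounded_linear T.
split.
  apply/seteqP; split=> m.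
    move=> /spectrumP ms; apply: contrapT => nm; apply: ms.
    exact: calculus_resolvent_invertible.
  move=> [l ls <-]; apply/spectrumP => inv; move/spectrumP: (ls); apply.
  apply: (invertible_calculus_resolvent hT hG hf) inv.
  exact: spectrum_in_disc TM _ ls.
move=> l; split; last split.
- move=> x Tx; have [->|x0] := eqVneq x 0.
    by rewrite scaler0 (bl0 (blinear_bounded_linear _)).
  have xp : 0 < rnorm x.
    by rewrite lt_def rnorm_ge0 andbT; apply: contra_neq x0 => /rnorm0_eq0.
  have l1 : normc l <= 1.
    apply: (@le1_of_powers_bounded _ _ M) => [|n]; first exact: normc_ge0.
    rewrite -(ler_pM2r xp) -normcX -rnormZ (le_trans _ (TM n x))// le_eqVlt; apply/orP; left; apply/eqP.
    congr rnorm; elim: n => [|n IH]; first by rewrite scale1r.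
    by rewrite iterS -IH (blZ bT) Tx scalerA -exprSr.
  apply/eqP; rewrite -subr_eq0; apply/eqP/rnorm0_eq0/le_anti; rewrite rnorm_ge0 andbT.
  apply/ler_addgt0Pr => e e0; rewrite add0r.
  have [c _ /(_ x)] := calculus_eigen_estimate hT hG hf l1 (divr_gt0 e0 xp).
  by rewrite Tx subrr rnorm0 mulr0 addr0 divfK ?gt_eqF.
- move=> xs xT x; rewrite /adjoint /=.
  have bxs := blinear_bounded_linear xs; have [_ [c c0 cxs]] := bxs.
  have [xs0|/existsNP[y /eqP y0]] := pselect (forall y, xs y = 0).
    by rewrite !xs0 scaler0.
  apply: calculus_dual_eigen => //.
  have yp : 0 < normc (xs y) by rewrite normc_gt0.
  apply: (@le1_of_powers_bounded _ _ (c * (M * rnorm y) / normc (xs y))) => [|n].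
    exact: normc_ge0.
  rewrite ler_pdivlMr// -normcX -normcM.
  have -> : l ^+ n * xs y = xs (iter n T y).
    elim: n => [|n IH]; first by rewrite mul1r.
    by rewrite exprS -mulrA IH iterS; have := xT (iter n T y).
  by rewrite -rnorm_scalar (le_trans (cxs _))// ler_wpM2l.
- move=> x_ x1 xl.
  have l1 : normc l <= 1.
    apply: (@le1_of_powers_bounded _ _ M) => [|n]; first exact: normc_ge0.
    have [q Hq] := poly_op_horner bT 'X^n l.
    have [_ [c c0 cq]] := bl_poly_op bT q.
    apply: (le_null_lim _ _ (nullM c xl)) => k; first by rewrite mulr_ge0// rnorm_ge0.
    have [h _] := Hq (x_ k).
    have : rnorm (l ^+ n *: x_ k) <= rnorm (l ^+ n *: x_ k - iter n T (x_ k)) + rnorm (iter n T (x_ k)).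
      by rewrite -[X in rnorm X <= _](subrK (iter n T (x_ k))) rnormD.
    have hX : poly_op T 'X^n (x_ k) = iter n T (x_ k).
      by have := poly_op_monomial T 1 n (x_ k); rewrite mul1r scale1r.
    rewrite hX hornerXn in h; rewrite h rnormZ x1 mulr1 normcX => /le_trans; apply.
    rewrite addrC lerD//; first by rewrite (le_trans (TM n _))// x1 mulr1.
    by rewrite (le_trans (cq _))// rdistC.
  apply/nullP => [n|e e0]; first exact: rnorm_ge0.
  have e2 : 0 < e / 2 by rewrite divr_gt0.
  have [c c0 Hc] := calculus_eigen_estimate hT hG hf l1 e2.
  have cx0 n : 0 <= c * rnorm (T (x_ n) - l *: x_ n) by rewrite mulr_ge0// rnorm_ge0.
  have [N HN] := (nullP cx0).1 (nullM c xl) _ e2.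
  exists N => n Nn; have := HN n Nn; have := Hc (x_ n); rewrite x1 mulr1.
  move: (c * _) => Y; lra.
Qed.
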